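(* Let $(E,\mathcal{E})$ be a measurable space such that the $\sigma$-algebra $\mathcal{E}$ is countably generated, and let $Q\in\mathcal{T}(E,\mathcal{E})$ be a bounded positive kernel for which there exist an integer $\ell\ge1$ and a probability measure $\nu$ on $(E,\mathcal{E})$ with $\Delta_\nu(Q^\ell)^{1/\ell}<r(Q)$. Then: (i) the operator $Q$ is quasi-compact on $\mathcal{B}$ and $r_e(Q)\le\Delta_\nu(Q^\ell)^{1/\ell}$; (ii) if $\chi\in\mathcal{X}$ is such that $\|\chi\|\,\Delta_\nu(Q^\ell)^{1/\ell}<r(Q_\chi)$, then the operator $Q_\chi$ is quasi-compact on $\mathcal{B}$ and $r_e(Q_\chi)\le\|\chi\|\,\Delta_\nu(Q^\ell)^{1/\ell}$.
   Context: A bounded positive kernel on $(E,\mathcal{E})$ is a function $Q:E\times\mathcal{E}\to\mathbb{R}_+$ such that $Q(\cdot,A)$ is $\mathcal{E}$-measurable for every $A\in\mathcal{E}$, $Q(x,\cdot)$ is a positive measure for every $x\in E$, and $\sup_{x}Q(x,E)<+\infty$; $\mathcal{T}(E,\mathcal{E})$ is the set of these. $\mathcal{B}$ is the Banach space of bounded measurable complex functions on $E$ with the supremum norm $\|\cdot\|$. A kernel $Q\in\mathcal{T}(E,\mathcal{E})$ is identified with the bounded operator $Qf(x)=\int_E f(y)\,Q(x,dy)$ on $\mathcal{B}$; $Q^\ell$ is the $\ell$-th power. For a probability measure $\nu$ on $(E,\mathcal{E})$ and $Q\in\mathcal{T}(E,\mathcal{E})$, $\Delta_\nu(Q)=\limsup_{A\in\mathcal{E},\,\nu(A)\to0}\big(\sup_{x\in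 E}Q(x,A)\big)$, i.e. $\lim_{\eta\to0^+}\sup\{Q(x,A):x\in E,\ A\in\mathcal{E},\ \nu(A)\le\eta\}$. $\mathcal{X}$ is the space of bounded measurable complex functions on $E\times E$, with $\|\chi\|=\sup_{E\times E}|\chi|$, and $Q_\chi f(x)=\int_E f(y)\chi(x,y)\,Q(x,dy)$ for $f\in\mathcal{B}$. $r(\cdot)$ is the spectral radius of a bounded operator on $\mathcal{B}$. The essential spectral radius $r_e(T)$ of a bounded operator $T$ on a Banach space $\mathcal{B}$ is the infimum of $r(T)$ and of the real numbers $\rho\ge0$ such that $\mathcal{B}=F_\rho\oplus H_\rho$ where $F_\rho,H_\rho$ are $T$-invariant subspaces, $H_\rho$ is closed, $r(T_{|H_\rho})<\rho$, $\dim F_\rho<+\infty$ and all eigenvalues of $T_{|F_\rho}$ have modulus $\ge\rho$. $T$ is quasi-compact if $r_e(T)<r(T)$. *)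

(* Defs.v *)
From HB Require Import structures.
From mathcomp Require Import all_boot all_order all_algebra.
From mathcomp Require Import all_classical all_reals all_analysis.
From mathcomp Require Import measurable_realfun complex.

Set Implicit Arguments.
Unset Strict Implicit.
Unset Printing Implicit Defensive.

Import Order.TTheory GRing.Theory Num.Theory.
Import numFieldNormedType.Exports.

Local Open Scope classical_set_scope.
Local Open Scope ring_scope.

Notation normc := (@Normc.normc _).

(* A complex-valued function is measurable when its real and imaginary parts
   are. *)
Definition bounded_measurable d (T : measurableType d) (R : realType) :
    set (T -> R[i]) :=
  [set f : T -> R[i] | [/\ measurable_fun [set: T] (fun x => complex.Re (f x)),
               measurable_fun [set: T] (fun x => complex.Im (f x)) &
               exists M : R, forall x, normc (f x) <= M]].

Lemma Re_le_normc (R : rcfType) (z : R[i]) : `|complex.Re z| <= normc z.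
Proof. by case: z => a b /=; rewrite -sqrtr_sqr ler_wsqrtr// lerDl sqr_ge0. Qed.

Lemma Im_le_normc (R : rcfType) (z : R[i]) : `|complex.Im z| <= normc z.
Proof. by case: z => a b /=; rewrite -sqrtr_sqr ler_wsqrtr// lerDr sqr_ge0. Qed.

Lemma normc_le_ReIm (R : rcfType) (z : R[i]) :
  normc z <= `|complex.Re z| + `|complex.Im z|.
Proof.
case: z => a b /=.
rewrite -[leRHS]ger0_norm ?addr_ge0// -[leRHS]sqrtr_sqr ler_wsqrtr//.
by rewrite sqrrD !real_normK ?num_real// lerD2r lerDl mulrn_wge0// mulr_ge0.
Qed.

Lemma bounded_measurableM d (T : measurableType d) (R : realType)
    (f g : T -> R[i]) :
  bounded_measurable f -> bounded_measurable g ->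
  bounded_measurable (fun x => f x * g x).
Proof.
move=> [mRf mIf [M Mf]] [mRg mIg [N Ng]]; split.
- rewrite (_ : (fun x => _) = (fun x => complex.Re (f x) * complex.Re (g x)
      - complex.Im (f x) * complex.Im (g x))); last first.
    by apply/funext => x; case: (f x) (g x) => [a b] [c e].
  by apply: measurable_funB; apply: measurable_funM.
- rewrite (_ : (fun x => _) = (fun x => complex.Re (f x) * complex.Im (g x)
      + complex.Im (f x) * complex.Re (g x))); last first.
    by apply/funext => x; case: (f x) (g x) => [a b] [c e].
  by apply: measurable_funD; apply: measurable_funM.
- exists (M * N) => x; rewrite Normc.normcM ler_pM//.
  + by case: (f x) => ? ?; exact: sqrtr_ge0.
  + by case: (g x) => ? ?; exact: sqrtr_ge0.
Qed.

Lemma bounded_measurable_cst d (T : measurableType d) (R : realType)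
  (c : R[i]) : bounded_measurable (fun _ : T => c).
Proof. by split; [exact: measurable_cst..|exists (normc c)]. Qed.

Lemma bounded_measurableD d (T : measurableType d) (R : realType)
    (f g : T -> R[i]) :
  bounded_measurable f -> bounded_measurable g ->
  bounded_measurable (fun x => f x + g x).
Proof.
move=> [mRf mIf [M Mf]] [mRg mIg [N Ng]]; split.
- rewrite (_ : (fun x => _) = (fun x => complex.Re (f x) + complex.Re (g x))).
    exact: measurable_funD.
  by apply/funext => x; case: (f x) (g x) => [a b] [c e].
- rewrite (_ : (fun x => _) = (fun x => complex.Im (f x) + complex.Im (g x))).
    exact: measurable_funD.
  by apply/funext => x; case: (f x) (g x) => [a b] [c e].
- by exists (M + N) => x; rewrite (le_trans (le_normcD _ _))// lerD.
Qed.

Definition bmpred d (T : measurableType d) (R : realType) :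
  {pred T -> R[i]} := mem (@bounded_measurable d T R).

Record bmfun d (T : measurableType d) (R : realType) := BMFun {
  bmfun_fun :> T -> R[i] ;
  bmfun_subproof : bmfun_fun \in @bmpred d T R }.

HB.instance Definition _ d (T : measurableType d) (R : realType) :=
  [isSub for @bmfun_fun d T R].
HB.instance Definition _ d (T : measurableType d) (R : realType) :=
  [Choice of bmfun T R by <:].

Section bmfun_lmodule.
Context d (T : measurableType d) (R : realType).

Lemma bmfunP (f : bmfun T R) : bounded_measurable f.
Proof. by apply/set_mem; exact: bmfun_subproof. Qed.

Lemma bounded_measurable_submod :
  submod_closed (@bmpred d T R).
Proof.
split=> [|a f g]; first by rewrite inE; exact: bounded_measurable_cst.
rewrite !inE => mf mg; apply: bounded_measurableD => //.
by apply: bounded_measurableM => //; exact: bounded_measurable_cst.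
Qed.

HB.instance Definition _ :=
  GRing.isSubmodClosed.Build _ _ (@bmpred d T R)
    bounded_measurable_submod.

HB.instance Definition _ := [SubChoice_isSubLmodule of bmfun T R by <:].

Definition mk_bmfun (f : T -> R[i]) (mf : bounded_measurable f) : bmfun T R :=
  BMFun (mem_set mf).

Definition supnorm (f : bmfun T R) : R := sup (range (fun x => normc (f x))).

End bmfun_lmodule.
Section supnorm_normed.
Context d (T : measurableType d) (R : realType).
Local Open Scope complex_scope.
Implicit Types f g : bmfun T R.

Lemma normc_ge0 (z : R[i]) : 0 <= normc z.
Proof. by case: z => a b; exact: sqrtr_ge0. Qed.

Lemma supnorm_ub f x : normc (f x) <= supnorm f.
Proof.
have [_ _ [M fM]] := bmfunP f.
by apply: ub_le_sup; [exists M => _ [y _ <-]|exists x].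
Qed.

Lemma supnorm_le f (M : R) : 0 <= M ->
  (forall x, normc (f x) <= M) -> supnorm f <= M.
Proof.
move=> M0 fM; rewrite /supnorm.
have [->|/set0P ne] := eqVneq (range (fun x => normc (f x))) set0.
  by rewrite sup0.
by apply: ge_sup => // _ [y _ <-].
Qed.

Lemma supnorm_ge0 f : 0 <= supnorm f.
Proof.
rewrite /supnorm.
have [->|/set0P[_ [x _ _]]] := eqVneq (range (fun x => normc (f x))) set0.
  by rewrite sup0.
exact: le_trans (normc_ge0 _) (supnorm_ub f x).
Qed.

Let norm f : R[i] := (supnorm f)%:C.

Let ler_normD f g : norm (f + g) <= norm f + norm g.
Proof.
rewrite /norm -rmorphD/= lecR supnorm_le ?addr_ge0 ?supnorm_ge0// => x.
by rewrite (le_trans (le_normcD _ _))// lerD// supnorm_ub.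
Qed.

Let normrZ (a : R[i]) f : norm (a *: f) = `|a| * norm f.
Proof.
have scale_le (b : R[i]) (h : bmfun T R) :
    supnorm (b *: h) <= normc b * supnorm h.
  apply: supnorm_le; first by rewrite mulr_ge0 ?normc_ge0 ?supnorm_ge0.
  move=> x; rewrite (_ : (b *: h) x = b * h x)// Normc.normcM.
  by rewrite ler_wpM2l ?normc_ge0// supnorm_ub.
rewrite /norm (_ : `|a| = (normc a)%:C); last by case: a.
rewrite -rmorphM/=; congr (_%:C); apply/eqP; rewrite eq_le scale_le/=.
have [->|a0] := eqVneq a 0; first by rewrite Normc.normc0 mul0r supnorm_ge0.
have na0 : 0 < normc a.
  rewrite lt_neqAle normc_ge0 andbT eq_sym.
  by apply: contra a0 => /eqP/Normc.eq0_normc ->.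
rewrite mulrC -ler_pdivlMr// mulrC -Normc.normcV.
by rewrite -{1}(scale1r f) -(mulVf a0) -scalerA scale_le.
Qed.

Let normr0_eq0 f : norm f = 0 -> f = 0.
Proof.
move=> -[f0].
apply/val_inj/funext => x; apply/Normc.eq0_normc/eqP.
by rewrite eq_le normc_ge0 andbT -f0 supnorm_ub.
Qed.

HB.instance Definition _ :=
  @Lmodule_isNormed.Build R[i] (bmfun T R) norm ler_normD normrZ normr0_eq0.

Lemma bmfun_normE f : `|f| = (supnorm f)%:C.
Proof. by []. Qed.

End supnorm_normed.

Section cintegral.
Context d (T : measurableType d) (R : realType).

Definition cintegral (mu : {measure set T -> \bar R}) (f : T -> R[i]) : R[i] :=
  Complex (\int[mu]_y complex.Re (f y)) (\int[mu]_y complex.Im (f y)).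

Lemma bounded_integrable (mu : {measure set T -> \bar R}) (f : T -> R) (M : R) :
  (mu setT < +oo)%E -> measurable_fun [set: T] f -> (forall x, `|f x| <= M) ->
  mu.-integrable [set: T] (EFin \o f).
Proof.
move=> muoo mf fM; apply: (@measurable_bounded_integrable _ _ _ mu) => //.
by exists M; split; [exact: num_real|move=> N MN x _; exact: le_trans (fM x) (ltW MN)].
Qed.

Variable Q : R.-fker T ~> T.

Lemma kernelT_lty x : (Q x setT < +oo)%E.
Proof.
have [M QM] := measure_uub Q.
exact: lt_trans (QM x) (ltry M).
Qed.

Lemma measurable_Rintegral_kernel (f : T * T -> R) (M : R) :
  measurable_fun [set: T * T] f -> (forall z, `|f z| <= M) ->
  measurable_fun [set: T] (fun x => \int[Q x]_y f (x, y)).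
Proof.
move=> mf fM; apply: (measurableT_comp (fine_measurable measurableT)).
rewrite (_ : (fun x => _) = (fun x => \int[Q x]_y ((EFin \o f)^\+ (x, y))
    - \int[Q x]_y ((EFin \o f)^\- (x, y))))%E; last first.
  apply/funext => x; rewrite [LHS]integralE.
  by congr (_ - _)%E; apply: eq_integral => y _; rewrite ?funeposE ?funenegE.
apply: emeasurable_funB.
- apply: (measurable_fun_integral_finite_kernel ((EFin \o f)^\+)%E Q) => //.
  exact/measurable_funepos/measurable_EFinP.
- apply: (measurable_fun_integral_finite_kernel ((EFin \o f)^\-)%E Q) => //.
  exact/measurable_funeneg/measurable_EFinP.
Qed.

Lemma le_Rintegral_kernel : exists2 C : R, 0 <= C &
  forall (f : T -> R) (M : R) x, 0 <= M -> measurable_fun [set: T] f ->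
    (forall z, `|f z| <= M) -> `|\int[Q x]_y f y| <= M * C.
Proof.
have [C QC] := measure_uub Q.
exists (Num.max C 0); first by rewrite le_max lexx orbT.
move=> f M x M0 mf fM.
have intf := bounded_integrable (kernelT_lty x) mf fM.
rewrite (le_trans (le_normr_Rintegral _ _))//.
rewrite (@le_trans _ _ (\int[Q x]_y cst M y))//.
  apply: le_Rintegral => //.
  - by apply: (@bounded_integrable _ _ M) => //; [exact: kernelT_lty|
      exact: measurableT_comp|move=> z; rewrite normr_id].
  - by apply: (@bounded_integrable _ _ M) => //; [exact: kernelT_lty|
      move=> z; rewrite ger0_norm].
rewrite Rintegral_cst// ler_wpM2l// le_max; apply/orP; left.
rewrite -lee_fin fineK ?ltW//.
by rewrite ge0_fin_numE ?kernelT_lty.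
Qed.

Lemma bounded_measurable_cintegral (g : T * T -> R[i]) :
  bounded_measurable g ->
  bounded_measurable (fun x => cintegral (Q x) (fun y => g (x, y))).
Proof.
move=> [mRg mIg [M gM]].
have RM z : `|complex.Re (g z)| <= M := le_trans (Re_le_normc _) (gM z).
have IM z : `|complex.Im (g z)| <= M := le_trans (Im_le_normc _) (gM z).
split.
- exact: (measurable_Rintegral_kernel mRg RM).
- exact: (measurable_Rintegral_kernel mIg IM).
- have [C C0 QC] := le_Rintegral_kernel.
  exists (M * C + M * C) => x; rewrite (le_trans (normc_le_ReIm _))//=.
  have M0 : 0 <= M := le_trans (normr_ge0 _) (RM (x, x)).
  rewrite lerD//; apply: QC => //.
  + exact: (measurableT_comp mRg (pair1_measurable x)).
  + exact: (measurableT_comp mIg (pair1_measurable x)).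
Qed.

Lemma bounded_measurable_kernel_op (chi : bmfun (T * T)%type R)
    (f : bmfun T R) :
  bounded_measurable (fun x => cintegral (Q x) (fun y => f y * chi (x, y))).
Proof.
apply: (@bounded_measurable_cintegral (fun z => f z.2 * chi z)).
apply: bounded_measurableM; last exact: bmfunP.
have [mR mI [M fM]] := bmfunP f; split.
- exact: (measurableT_comp mR).
- exact: (measurableT_comp mI).
- by exists M => x.
Qed.

Lemma bounded_measurable_kernel_op1 (f : bmfun T R) :
  bounded_measurable (fun x => cintegral (Q x) f).
Proof.
apply: (@bounded_measurable_cintegral (fun z => f z.2)).
have [mR mI [M fM]] := bmfunP f; split.
- exact: (measurableT_comp mR).
- exact: (measurableT_comp mI).
- by exists M => x.
Qed.

Lemma cintegral_linear x (a : R[i]) (f g : T -> R[i]) :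
  bounded_measurable f -> bounded_measurable g ->
  cintegral (Q x) (fun y => a * f y + g y) =
  a * cintegral (Q x) f + cintegral (Q x) g.
Proof.
move=> bf bg.
have intR (h : T -> R[i]) : bounded_measurable h ->
    (Q x).-integrable setT (EFin \o (fun y => complex.Re (h y))).
  move=> [mR _ [M hM]]; apply: (@bounded_integrable _ _ M) => //.
    exact: kernelT_lty.
  by move=> z; exact: le_trans (Re_le_normc _) (hM z).
have intI (h : T -> R[i]) : bounded_measurable h ->
    (Q x).-integrable setT (EFin \o (fun y => complex.Im (h y))).
  move=> [_ mI [M hM]]; apply: (@bounded_integrable _ _ M) => //.
    exact: kernelT_lty.
  by move=> z; exact: le_trans (Im_le_normc _) (hM z).
have cZ (h : T -> R) (b : R) :
    (Q x).-integrable setT (EFin \o h) ->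
    (Q x).-integrable setT (EFin \o (fun y => b * h y)).
  by move=> ih; apply: eq_integrable (integrableZl _ b ih).
case: a => b c; rewrite /cintegral.
have iRf := intR _ bf; have iIf := intI _ bf.
have iRg := intR _ bg; have iIg := intI _ bg.
apply/eqP; rewrite eq_complex/=; apply/andP; split; apply/eqP.
- rewrite -RintegralZl// -RintegralZl// -RintegralB//; last 2 first.
    exact: cZ. exact: cZ.
  rewrite -RintegralD//; last first.
    by apply: eq_integrable (integrableB _ (cZ _ b iRf) (cZ _ c iIf)).
  by apply: eq_Rintegral => y _; case: (f y) (g y) => ? ? [].
- rewrite -RintegralZl// -RintegralZl// -RintegralD//; last 2 first.
    exact: cZ. exact: cZ.
  rewrite -RintegralD//; last first.
    by apply: eq_integrable (integrableD _ (cZ _ b iIf) (cZ _ c iRf)).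
  by apply: eq_Rintegral => y _; case: (f y) (g y) => ? ? [].
Qed.

(* Q f (x) = \int f(y) Q(x, dy) *)
Definition kernel_op (f : bmfun T R) : bmfun T R :=
  mk_bmfun (bounded_measurable_kernel_op1 f).

(* Q_chi f (x) = \int f(y) chi(x, y) Q(x, dy) *)
Definition kernel_mul_op (chi : bmfun (T * T)%type R) (f : bmfun T R) :
    bmfun T R :=
  mk_bmfun (bounded_measurable_kernel_op chi f).

End cintegral.
Section kernel_op_linear.
Context d (T : measurableType d) (R : realType) (Q : R.-fker T ~> T).

Lemma kernel_op_is_linear : linear (kernel_op Q).
Proof.
move=> a f g; apply/val_inj/funext => x.
by apply: cintegral_linear; exact: bmfunP.
Qed.

HB.instance Definition _ :=
  @GRing.isLinear.Build R[i] (bmfun T R) (bmfun T R) *:%R (kernel_op Q)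
    kernel_op_is_linear.

Variable chi : bmfun (T * T)%type R.

Lemma kernel_mul_op_is_linear : linear (kernel_mul_op Q chi).
Proof.
have chi2 x : bounded_measurable (fun y => chi (x, y)).
  have [mR mI [M chiM]] := bmfunP chi; split.
  - exact: (measurableT_comp mR (pair1_measurable x)).
  - exact: (measurableT_comp mI (pair1_measurable x)).
  - by exists M => y.
move=> a f g; apply/val_inj/funext => x.
rewrite [RHS](_ : _ = a * cintegral (Q x) (fun y => f y * chi (x, y))
  + cintegral (Q x) (fun y => g y * chi (x, y)))//.
rewrite -cintegral_linear; last 2 first.
- by apply: bounded_measurableM => //; exact: bmfunP.
- by apply: bounded_measurableM => //; exact: bmfunP.
by congr cintegral; apply/funext => y; rewrite mulrA -mulrDl.
Qed.

HB.instance Definition _ :=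
  @GRing.isLinear.Build R[i] (bmfun T R) (bmfun T R) *:%R
    (kernel_mul_op Q chi) kernel_mul_op_is_linear.

End kernel_op_linear.

Section operators.
Context (R : realType) (V : normedModType R[i]).
Implicit Types (T : {linear V -> V}) (F H : set V) (rho : R).

Definition invariant_subspace T H : Prop :=
  submod_closed (mem H) /\ T @` H `<=` H.

Definition finite_dim F : Prop := exists n (e : 'I_n -> V),
  forall v, F v -> exists c : 'I_n -> R[i], v = \sum_(i < n) c i *: e i.

Definition direct_sum F H : Prop :=
  F `&` H = [set 0] /\ forall v, exists u w, [/\ F u, H w & v = u + w].

(* [z] is in the resolvent set of the restriction of [T] to the invariant
   subspace [H] when [z - T] maps [H] bijectively onto itself with a bounded
   inverse. *)
Definition resolvent_on T H : set R[i] :=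
  [set z | (forall w, H w -> exists! v, H v /\ z *: v - T v = w) /\
           exists M : R[i], forall v, H v -> `|v| <= M * `|z *: v - T v|].

(* The spectral radius of the restriction of [T] to [H].  It is [0] when
   [H] is trivial, the spectrum being empty in that case. *)
Definition spectral_radius_on T H : R :=
  sup [set normc z | z in ~` resolvent_on T H].

Definition spectral_radius T : R := spectral_radius_on T [set: V].

Definition ess_decomposition T rho : Prop := exists F H,
  [/\ invariant_subspace T F, invariant_subspace T H & direct_sum F H] /\
  [/\ closed H, spectral_radius_on T H < rho, finite_dim F &
      forall (z : R[i]) v, F v -> v != 0 -> T v = z *: v -> rho <= normc z].

Definition ess_spectral_radius T : R :=
  inf (spectral_radius T |` [set rho | 0 <= rho /\ ess_decomposition T rho]).

Definition quasi_compact T : Prop :=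
  ess_spectral_radius T < spectral_radius T.

End operators.

Definition countably_generated d (T : measurableType d) : Prop :=
  exists G : set (set T), countable G /\ d.-measurable = <<s G >>.

Section kernel_power.
Context d (T : measurableType d) (R : realType).
Implicit Types Q : R.-fker T ~> T.

Section kernel_comp.
Variables k1 k2 : R.-fker T ~> T.

Definition ksnd : T * T -> {measure set T -> \bar R} := k2 \o snd.

Let measurable_ksnd U : measurable U -> measurable_fun [set: T * T] (ksnd ^~ U).
Proof.
by move=> mU; exact: (measurableT_comp (measurable_kernel k2 U mU)).
Qed.

HB.instance Definition _ := @isKernel.Build _ _ _ _ _ ksnd measurable_ksnd.

Let ksnd_uub : measure_fam_uub ksnd.
Proof. by have [M k2M] := measure_uub k2; exists M => -[]. Qed.

HB.instance Definition _ := @Kernel_isFinite.Build _ _ _ _ _ ksnd ksnd_uub.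

Import KCOMP_FINITE_KERNEL.

Definition kernel_comp : R.-fker T ~> T := mkcomp k1 ksnd.

Lemma kernel_compE x A : kernel_comp x A = (\int[k1 x]_y k2 y A)%E.
Proof. by []. Qed.

End kernel_comp.

Definition kernel_id : R.-fker T ~> T := kdirac (@measurable_id _ T setT).

(* Q^(n+1)(x, A) = \int Q^n(y, A) Q(x, dy): the kernel of the n-th power of
   the operator [kernel_op Q]. *)
Fixpoint kernel_pow Q n : R.-fker T ~> T :=
  if n is n'.+1 then kernel_comp Q (kernel_pow Q n') else kernel_id.

(* The limit exists, the supremum being nondecreasing in [eta], and it is
   finite, since the masses of [Q] are uniformly bounded. *)
Definition Delta (nu : probability T R) Q : R :=
  fine (lim (ereal_sup [set u | exists x A,
      [/\ measurable A, (nu A <= eta%:E)%E & u = Q x A]] @[eta --> 0^'+])).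

End kernel_power.

(* Main.v *)
(* The weak norm is the [L^1] norm of a finite sum [mu] of the measures
    [nu Q^i]. Writing [L] for [Q] or [Q_chi], the definition of [Delta] gives a
    Lasota-Yorke inequality [|L^(jl) f| <= a^j |f| + C_j |f|_1] for every [a]
    larger than [|chi|^l Delta].

    A Hahn decomposition of [mu(dx) Q^l(x, dy) - n mu(dx) mu(dy)] on [E * E]
    splits [L^l = S + W] with [|S| <= a] and [W] of bounded density with respect
    to [mu]. Such a [W] is Hilbert-Schmidt, hence a limit, as operator from the sup
    norm to the [L^1] norm, of finite-rank operators of bounded sup norm: average
    over a finite partition that nearly maximizes
    [sum_A |W 1_A|_2^2 / mu(A)].

    Expanding [L^(lm) = S^m + sum_i L^(l(m-1-i)) W S^i], replacing [W] by a
    finite-rank operator and bounding the error with the Lasota-Yorke inequality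
    shows that [L^(lm)] is a finite-rank operator plus an operator of norm
    [O(m a^m)]. An operator [A = P + F] with [F] of finite rank and [P] small has,
    beyond the radius [4 |P|], finitely many eigenvalues counted with algebraic
    multiplicity (Riesz' lemma), and the kernel and the range of the product of
    the corresponding [lambda_i - A] split the space. *)

From HB Require Import structures.
Require Import Defs.
From mathcomp Require Import all_boot all_order all_algebra.
From mathcomp Require Import all_classical all_reals all_analysis.
From mathcomp Require Import measurable_realfun complex ring lra.

Set Implicit Arguments.
Unset Strict Implicit.
Unset Printing Implicit Defensive.

Import Order.TTheory GRing.Theory Num.Theory.
Import numFieldNormedType.Exports.

Local Open Scope classical_set_scope.
Local Open Scope ring_scope.

(** * Finite-rank perturbations of invertible operators *)

(** The finite-rank approximation of [W] holds only from the sup norm to [L^1], whereas the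
    essential spectral radius is a sup-norm notion. The Lasota-Yorke inequality pays for this loss
    because its constants multiply only the [L^1] error, which is chosen after them. The sup norm of
    the error is not small but stays below twice the bound for [W], so each of the [m] terms of the
    expansion costs a constant times [a^m]; a factor linear in [m] is harmless, since [a] may be
    taken below [r^l] for any [r] above the target radius. The measure [nu Q] may charge [nu]-null
    sets, so [L] need not be bounded for the [L^1] norm of [nu]; this is why the orbit is summed up
    to the exponent [l m]. In the spectral half, [z - A] is an invertible operator minus a
    finite-rank one, which turns invertibility and the construction of dual forms into finite linear
    systems. The [4] in [4 |P|] arises because the vectors of Riesz' lemma have norm at most [2], so
    that their differences have norm at most [4]. *)

Section real_norm.
Context (R : realType) (V : normedModType R[i]).
Implicit Types (u v w : V) (a : R[i]).
Local Open Scope complex_scope.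

(** The norm of a normed module over [R[i]] is itself a complex number. Being nonnegative it is
    real, and its real part can be compared in the ordered field [R]. *)
Definition rnorm v : R := complex.Re `|v|.

Lemma rnormE v : `|v| = (rnorm v)%:C.
Proof.
have : 0 <= `|v| by [].
rewrite /rnorm; case: (`|v|) => a b /=.
by rewrite lecE/= => /andP[/eqP -> _].
Qed.

Lemma normcE a : `|a| = (normc a)%:C.
Proof. by case: a. Qed.

Lemma rnorm_ge0 v : 0 <= rnorm v.
Proof. by rewrite -lecR -rnormE; exact: normr_ge0. Qed.

Lemma rnormD v w : rnorm (v + w) <= rnorm v + rnorm w.
Proof. by rewrite -lecR rmorphD/= -!rnormE ler_normD. Qed.

Lemma rnormZ a v : rnorm (a *: v) = normc a * rnorm v.
Proof. by apply: complexI; rewrite rmorphM/= -!rnormE normrZ normcE. Qed.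

Lemma rnorm0 : rnorm 0 = 0.
Proof. by apply: complexI; rewrite -rnormE normr0. Qed.

Lemma rnorm_eq0 v : rnorm v = 0 -> v = 0.
Proof. by move=> v0; apply/normr0_eq0; rewrite rnormE v0. Qed.

Lemma rnormN v : rnorm (- v) = rnorm v.
Proof. by apply: complexI; rewrite -!rnormE normrN. Qed.

Lemma rnormB v w : rnorm (v - w) <= rnorm v + rnorm w.
Proof. by rewrite -[rnorm w]rnormN rnormD. Qed.

Lemma rnorm_sum (I : Type) (r : seq I) (P : pred I) (f : I -> V) :
  rnorm (\sum_(i <- r | P i) f i) <= \sum_(i <- r | P i) rnorm (f i).
Proof.
elim/big_rec2: _ => [|i x y _ h]; first by rewrite rnorm0.
by rewrite (le_trans (rnormD _ _))// lerD2l.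
Qed.

Lemma normc_sum (I : Type) (r : seq I) (P : pred I) (f : I -> R[i]) :
  normc (\sum_(i <- r | P i) f i) <= \sum_(i <- r | P i) normc (f i).
Proof.
elim/big_rec2: _ => [|i x y _ h]; first by rewrite Normc.normc0.
by rewrite (le_trans (le_normcD _ _))// lerD2l.
Qed.

End real_norm.

Section linear_predicates.
Context (R : realType) (V W : lmodType R[i]).
Variable f : V -> W.
Hypothesis f_lin : linear f.

Lemma lin0 : f 0 = 0.
Proof. by have := f_lin (-1) 0 0; rewrite scaler0 addr0 scaleN1r addNr. Qed.

Lemma linD u v : f (u + v) = f u + f v.
Proof. by have := f_lin 1 u v; rewrite !scale1r. Qed.

Lemma linZ a u : f (a *: u) = a *: f u.
Proof. by have := f_lin a u 0; rewrite lin0 !addr0. Qed.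

Lemma linN u : f (- u) = - f u.
Proof. by rewrite -scaleN1r linZ scaleN1r. Qed.

Lemma linB u v : f (u - v) = f u - f v.
Proof. by rewrite linD linN. Qed.

Lemma lin_sum (I : Type) (r : seq I) (P : pred I) (g : I -> V) :
  f (\sum_(i <- r | P i) g i) = \sum_(i <- r | P i) f (g i).
Proof.
elim/big_rec2: _ => [|i x y _ h]; first by rewrite lin0.
by rewrite linD h.
Qed.

End linear_predicates.

Section finite_rank_perturbations.
Context (R : realType) (V : normedModType R[i]).
Implicit Types (u v w : V) (f g F G K L : V -> V).
Local Notation C := (R[i]).

Definition bounded_op f :=
  linear f /\ exists2 c : R, 0 <= c & forall v, rnorm (f v) <= c * rnorm v.

Definition bounded_form (phi : V -> C) :=
  scalar phi /\ exists2 c : R, 0 <= c & forall v, normc (phi v) <= c * rnorm v.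

Definition finite_rank F := exists n (phi : 'I_n -> V -> C) (u : 'I_n -> V),
  (forall i, bounded_form (phi i)) /\
  forall v, F v = \sum_(i < n) phi i v *: u i.

Definition bounded_below L :=
  exists2 c : R, 0 <= c & forall v, rnorm v <= c * rnorm (L v).

Definition surj L := forall w, exists v, L v = w.

(** Fredholm operators of index zero, given by their data: an invertible operator minus one of
    finite rank. Boundedness of the inverse is recorded in the data, since [V] need not be
    complete. *)
Definition fredholm K := exists L F,
  [/\ bounded_op L, surj L, bounded_below L, finite_rank F &
      forall v, K v = L v - F v].

Lemma bounded_op_comp f g : bounded_op f -> bounded_op g -> bounded_op (f \o g).
Proof.
move=> [lf [c c0 fc]] [lg [e e0 ge]]; split=> [a u v /=|]; first by rewrite lg lf.
exists (c * e); first exact: mulr_ge0.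
by move=> v /=; rewrite (le_trans (fc _))// -mulrA ler_wpM2l.
Qed.

Lemma bounded_op_id : bounded_op id.
Proof. by split=> //; exists 1 => // v; rewrite mul1r. Qed.

Lemma bounded_opD f g : bounded_op f -> bounded_op g ->
  bounded_op (fun v => f v + g v).
Proof.
move=> [lf [c c0 fc]] [lg [e e0 ge]]; split=> [a u v|].
  by rewrite lf lg scalerDr addrACA.
exists (c + e) => [|v]; first exact: addr_ge0.
by rewrite (le_trans (rnormD _ _))// mulrDl lerD.
Qed.

Lemma bounded_opB f g : bounded_op f -> bounded_op g ->
  bounded_op (fun v => f v - g v).
Proof.
move=> [lf [c c0 fc]] [lg [e e0 ge]]; split=> [a u v|].
  by rewrite lf lg scalerBr opprD addrACA.
exists (c + e) => [|v]; first exact: addr_ge0.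
by rewrite (le_trans (rnormB _ _))// mulrDl lerD.
Qed.

Lemma bounded_op_scale (z : C) : bounded_op (fun v : V => z *: v).
Proof.
split=> [a u v|]; first by rewrite scalerDr !scalerA mulrC.
by exists (normc z); [exact: normc_ge0|move=> v; rewrite rnormZ].
Qed.

Lemma form_comp (phi : V -> C) g : bounded_form phi -> bounded_op g ->
  bounded_form (phi \o g).
Proof.
move=> [lf [c c0 fc]] [lg [e e0 ge]]; split=> [a u v /=|]; first by rewrite lg lf.
exists (c * e); first exact: mulr_ge0.
by move=> v /=; rewrite (le_trans (fc _))// -mulrA ler_wpM2l.
Qed.

Lemma form_sum n (phi : 'I_n -> V -> C) (a : 'I_n -> C) :
  (forall i, bounded_form (phi i)) ->
  bounded_form (fun v => \sum_(i < n) a i * phi i v).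
Proof.
move=> bphi; split=> [z u v|].
  rewrite mulr_sumr -big_split/=; apply: eq_bigr => i _.
  by rewrite (bphi i).1 mulrDr !mulrA (mulrC z).
have /choice[c cP] : forall i, exists c : R, 0 <= c /\
    forall v, normc (phi i v) <= c * rnorm v.
  by move=> i; have [_ [c c0 cP]] := bphi i; exists c.
exists (\sum_i normc (a i) * c i).
  by apply: sumr_ge0 => i _; rewrite mulr_ge0 ?normc_ge0// (cP i).1.
move=> v; rewrite (le_trans (normc_sum _ _ _))// mulr_suml ler_sum// => i _.
by rewrite Normc.normcM -mulrA ler_wpM2l ?normc_ge0// (cP i).2.
Qed.

Lemma form_sumE (phi : V -> C) : scalar phi ->
  forall (I : Type) (r : seq I) (P : pred I) (g : I -> V),
  phi (\sum_(i <- r | P i) g i) = \sum_(i <- r | P i) phi (g i).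
Proof. by move=> lphi I r P g; rewrite (@lin_sum _ _ C^o phi). Qed.

Lemma formZ (phi : V -> C) : scalar phi -> forall a v, phi (a *: v) = a * phi v.
Proof. by move=> lphi a v; rewrite (@linZ _ _ C^o phi). Qed.

Lemma formD (phi : V -> C) : scalar phi ->
  forall u v, phi (u + v) = phi u + phi v.
Proof. by move=> lphi u v; rewrite (@linD _ _ C^o phi). Qed.

Lemma formB (phi : V -> C) : scalar phi ->
  forall u v, phi (u - v) = phi u - phi v.
Proof. by move=> lphi u v; rewrite (@linB _ _ C^o phi). Qed.

Lemma form0 (phi : V -> C) : scalar phi -> phi 0 = 0.
Proof. by move=> lphi; rewrite (@lin0 _ _ C^o phi). Qed.

Lemma finite_rank_linear F : finite_rank F -> linear F.
Proof.
move=> [n [phi [u [bphi FE]]]] a x y; rewrite !FE scaler_sumr -big_split/=.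
by apply: eq_bigr => i _; rewrite (bphi i).1 scalerDl scalerA.
Qed.

Lemma finite_rank_bounded F : finite_rank F -> bounded_op F.
Proof.
move=> frF; split; first exact: finite_rank_linear.
have [n [phi [u [bphi FE]]]] := frF.
have /choice[c cP] : forall i, exists c : R, 0 <= c /\
    forall v, normc (phi i v) <= c * rnorm v.
  by move=> i; have [_ [c c0 cP]] := bphi i; exists c.
exists (\sum_i c i * rnorm (u i)).
  by apply: sumr_ge0 => i _; rewrite mulr_ge0 ?rnorm_ge0// (cP i).1.
move=> v; rewrite FE (le_trans (rnorm_sum _ _ _))// mulr_suml ler_sum// => i _.
by rewrite rnormZ mulrAC ler_wpM2r ?rnorm_ge0// (cP i).2.
Qed.

Lemma eq_finite_rank F G : F =1 G -> finite_rank F -> finite_rank G.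
Proof.
move=> FG [n [phi [u [bphi FE]]]]; exists n, phi, u; split=> // v.
by rewrite -FG.
Qed.

Lemma finite_rank0 : finite_rank (fun=> 0).
Proof.
exists 0%N, (fun _ _ => 0), (fun _ => 0); split; first by case.
by move=> v; rewrite big_ord0.
Qed.

Lemma finite_rankD F G : finite_rank F -> finite_rank G ->
  finite_rank (fun v => F v + G v).
Proof.
move=> [n [phi [u [bphi FE]]]] [m [psi [w [bpsi GE]]]].
exists (n + m)%N,
  (fun i => match fintype.split i with inl j => phi j | inr j => psi j end),
  (fun i => match fintype.split i with inl j => u j | inr j => w j end).
split=> [i|v]; first by case: fintype.split.
rewrite big_split_ord/= FE GE; congr (_ + _); apply: eq_bigr => i _.
  by rewrite (unsplitK (inl i)).
by rewrite (unsplitK (inr i)).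
Qed.

Lemma finite_rank_sum (I : Type) (r : seq I) (P : pred I) (F : I -> V -> V) :
  (forall i, finite_rank (F i)) ->
  finite_rank (fun v => \sum_(i <- r | P i) F i v).
Proof.
move=> frF; elim: r => [|i r ih].
  by apply: eq_finite_rank finite_rank0 => v; rewrite big_nil.
case Pi : (P i); last by apply: eq_finite_rank ih => v; rewrite big_cons Pi.
by apply: eq_finite_rank (finite_rankD (frF i) ih) => v; rewrite big_cons Pi.
Qed.

Lemma finite_rank_compl F G : linear G -> finite_rank F -> finite_rank (G \o F).
Proof.
move=> lG [n [phi [u [bphi FE]]]]; exists n, phi, (G \o u); split=> // v /=.
by rewrite FE lin_sum//; apply: eq_bigr => i _; rewrite linZ.
Qed.

Lemma finite_rank_compr F G : bounded_op G -> finite_rank F ->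
  finite_rank (F \o G).
Proof.
move=> bG [n [phi [u [bphi FE]]]]; exists n, (fun i => phi i \o G), u.
by split=> [i|v /=]; [exact: form_comp|rewrite FE].
Qed.

Lemma finite_rankN F : finite_rank F -> finite_rank (fun v => - F v).
Proof.
by apply: (@finite_rank_compl F (fun v => - v)) => a u v; rewrite scalerN opprD.
Qed.

Lemma fredholm_bounded K : fredholm K -> bounded_op K.
Proof.
move=> [L [F [bL _ _ frF KE]]].
have [lin b] := bounded_opB bL (finite_rank_bounded frF).
split=> [a u v|]; first by rewrite !KE lin.
by have [c c0 cP] := b; exists c => // v; rewrite KE.
Qed.

Lemma fredholm_finite_rankD K F : fredholm K -> finite_rank F ->
  fredholm (fun v => K v + F v).
Proof.
move=> [L [G [bL sL bbL frG KE]]] frF; exists L, (fun v => G v - F v); split=> //.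
  exact/finite_rankD/finite_rankN.
by move=> v; rewrite KE opprB addrA addrAC.
Qed.

Lemma eq_fredholm K K' : K =1 K' -> fredholm K -> fredholm K'.
Proof. by move=> KK' [L [F [? ? ? ? KE]]]; exists L, F; split=> // v; rewrite -KK'. Qed.

Lemma fredholm_id : fredholm id.
Proof.
exists id, (fun=> 0); split.
- exact: bounded_op_id.
- by move=> v; exists v.
- by exists 1 => // v; rewrite mul1r.
- exact: finite_rank0.
- by move=> v; rewrite subr0.
Qed.

Lemma fredholm_comp K1 K2 : fredholm K1 -> fredholm K2 -> fredholm (K1 \o K2).
Proof.
move=> fK1 fK2; have bK2 := fredholm_bounded fK2.
move: fK1 fK2 => [L1 [F1 [bL1 sL1 [c1 c10 bbL1] frF1 KE1]]].
move=> [L2 [F2 [bL2 sL2 [c2 c20 bbL2] frF2 KE2]]].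
exists (L1 \o L2), (fun v => L1 (F2 v) + F1 (K2 v)); split.
- exact: bounded_op_comp.
- by move=> w; have [v <-] := sL1 w; have [u <-] := sL2 v; exists u.
- exists (c2 * c1); first exact: mulr_ge0.
  by move=> v; rewrite (le_trans (bbL2 _))// -mulrA ler_wpM2l//= bbL1.
- apply: finite_rankD; last exact: finite_rank_compr.
  by apply: finite_rank_compl => //; exact: bL1.1.
- by move=> v /=; rewrite KE1 opprD addrA -linB ?KE2//; exact: bL1.1.
Qed.

(* Solving [K v = w] thus reduces to a finite linear system. *)
Lemma fredholm_factor K : fredholm K ->
  exists L n (phi : 'I_n -> V -> C) (w : 'I_n -> V),
  [/\ bounded_op L, surj L, bounded_below L, forall i, bounded_form (phi i) &
      forall v, K v = L (v - \sum_(i < n) phi i v *: w i)].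
Proof.
move=> [L [F [bL sL bbL [n [phi [u [bphi FE]]]] KE]]].
have /choice[w wP] : forall i, exists w, L w = u i by move=> i; exact: sL.
have lL := bL.1.
exists L, n, phi, w; split=> // v; rewrite KE FE (linB lL) (lin_sum lL).
by congr (_ - _); apply: eq_bigr => i _; rewrite (linZ lL) wP.
Qed.

Lemma bounded_below_inj L v : linear L -> bounded_below L -> L v = 0 -> v = 0.
Proof.
move=> lL [c c0 bb] Lv0; apply/rnorm_eq0/eqP; rewrite eq_le rnorm_ge0 andbT.
by rewrite (le_trans (bb v))// Lv0 rnorm0 mulr0.
Qed.

(** With [K v = L (v - sum_i phi_i(v) w_i)], the unknowns are the numbers [phi_i(v)], governed by
    the matrix [M] with entries [delta_ij - phi_i(w_j)]. A null vector [c] of [M] would give the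
    null vector [sum_j c_j w_j] of [K], so injectivity makes [M] invertible; solving the system
    yields both surjectivity and the lower bound. *)
Lemma fredholm_alternative K : fredholm K -> (forall v, K v = 0 -> v = 0) ->
  surj K /\ bounded_below K.
Proof.
move=> /fredholm_factor[L [n [phi [w [bL sL bbL bphi KE]]]]] inj.
pose M : 'M[C]_n := \matrix_(i, j) ((i == j)%:R - phi i (w j)).
have lphi i : scalar (phi i) := (bphi i).1.
have MU : M \in unitmx.
  rewrite unitmxE unitfE; apply/negP => /eqP; rewrite -det_tr => /eqP/det0P.
  move=> [c c0 cM]; move: c0.
  pose v := \sum_j c 0 j *: w j.
  have phiv i : phi i v = c 0 i.
    have /matrixP/(_ 0 i) := cM; rewrite !mxE => /eqP.
    under eq_bigr do rewrite !mxE mulrBr.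
    rewrite sumrB subr_eq0 (bigD1 i)//= eqxx mulr1 big1 ?addr0; last first.
      by move=> j ji; rewrite eq_sym (negbTE ji) mulr0.
    move=> /eqP ->; rewrite /v form_sumE//; apply: eq_bigr => j _.
    by rewrite formZ.
  have v0 : v = 0.
    apply: inj; rewrite KE; under eq_bigr do rewrite phiv.
    by rewrite subrr lin0//; exact: bL.1.
  by apply/negP; rewrite negbK; apply/eqP/rowP => i; rewrite mxE -phiv v0 form0.
have ME (c : 'cV[C]_n) i :
    (M *m c) i 0 = c i 0 - \sum_j c j 0 * phi i (w j).
  rewrite mxE; under eq_bigr do rewrite mxE mulrBl.
  rewrite sumrB (bigD1 i)//= eqxx mul1r big1 ?addr0; last first.
    by move=> j ji; rewrite eq_sym (negbTE ji) mul0r.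
  by congr (_ - _); apply: eq_bigr => j _; rewrite mulrC.
split.
- move=> y; have [x <-] := sL y.
  (* This [c] makes [phi i v = c i] for the [v] below, so that the subtraction inside [L] leaves
     exactly [x]. *)
  pose c := invmx M *m (\col_i phi i x).
  pose v := x + \sum_j c j 0 *: w j.
  have phiv i : phi i v = c i 0.
    have /colP/(_ i) : M *m c = \col_i phi i x by rewrite mulKVmx.
    rewrite ME [RHS]mxE => cE; rewrite /v formD// form_sumE// -cE.
    apply/eqP; rewrite -addrA addrC -subr_eq0 addrK addrC subr_eq0; apply/eqP.
    by apply: eq_bigr => j _; rewrite formZ.
  exists v; rewrite KE; congr L; under eq_bigr do rewrite phiv.
  by rewrite /v addrK.
- have [c c0 cL] := bbL.
  have /choice[e eP] : forall i, exists e : R, 0 <= e /\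
      forall v, normc (phi i v) <= e * rnorm v.
    by move=> i; have [_ [e e0 eP]] := bphi i; exists e.
  pose D := \sum_i \sum_j normc (invmx M i j) * e j * rnorm (w i).
  have D0 : 0 <= D.
    apply: sumr_ge0 => i _; apply: sumr_ge0 => j _.
    by rewrite !mulr_ge0 ?normc_ge0 ?rnorm_ge0// (eP j).1.
  exists ((1 + D) * c) => [|v]; first by rewrite mulr_ge0// addr_ge0.
  rewrite -mulrA KE; set x := v - _.
  apply: (@le_trans _ _ ((1 + D) * rnorm x)); last first.
    by rewrite ler_wpM2l ?addr_ge0.
  have Mphi : \col_i phi i v = invmx M *m \col_i phi i x.
    apply: (canRL (mulKmx MU)); apply/colP => i; rewrite ME !mxE.
    rewrite /x formB// form_sumE//; congr (_ - _); apply: eq_bigr => j _.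
    by rewrite formZ// mxE.
  have -> : v = x + \sum_i phi i v *: w i by rewrite /x subrK.
  rewrite (le_trans (rnormD _ _))// mulrDl mul1r lerD2l.
  rewrite (le_trans (rnorm_sum _ _ _))// /D mulr_suml ler_sum// => i _.
  have -> : phi i v = \sum_j invmx M i j * phi j x.
    have /matrixP/(_ i 0) := Mphi; rewrite !mxE => ->.
    by apply: eq_bigr => j _; rewrite mxE.
  rewrite rnormZ -mulr_suml mulrAC ler_wpM2r ?rnorm_ge0// mulr_suml.
  rewrite (le_trans (normc_sum _ _ _))// ler_sum// => j _.
  by rewrite Normc.normcM -mulrA ler_wpM2l ?normc_ge0// (eP j).2.
Qed.

(** On the kernel of [K] one has [v = sum_l phi_l(v) w_l], so the bounded forms [phi_l] separate its
    points. A right inverse of the matrix of the [phi_j(v_i)] combines them into a dual system. *)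
Lemma dual_forms K n (v : 'I_n -> V) : fredholm K -> (forall i, K (v i) = 0) ->
  (forall c : 'I_n -> C, \sum_i c i *: v i = 0 -> forall i, c i = 0) ->
  exists psi : 'I_n -> V -> C, (forall i, bounded_form (psi i)) /\
    forall i j, psi i (v j) = (i == j)%:R.
Proof.
move=> /fredholm_factor[L [m [phi [w [bL sL bbL bphi KE]]]]] Kv free.
have lphi i : scalar (phi i) := (bphi i).1.
pose B : 'M[C]_(n, m) := \matrix_(i, j) phi j (v i).
have vE i : v i = \sum_l phi l (v i) *: w l.
  by apply/eqP; rewrite -subr_eq0; apply/eqP/(bounded_below_inj bL.1 bbL); rewrite -KE.
have : row_free B.
  rewrite -kermx_eq0; apply/rowV0P => c /sub_kermxP cB.
  apply/rowP => i; rewrite mxE; apply: (free (fun i => c 0 i)).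
  under eq_bigr do rewrite vE scaler_sumr.
  rewrite exchange_big big1//= => l _; under eq_bigr do rewrite scalerA.
  rewrite -scaler_suml; have /matrixP/(_ 0 l) := cB; rewrite !mxE => cl.
  rewrite (eq_bigr (fun i => c 0 i * B i l)) ?cl ?scale0r// => k _.
  by rewrite mxE.
move=> /row_freeP[N BN].
exists (fun i x => \sum_l N l i * phi l x); split=> [i|i j]; first exact: form_sum.
have /matrixP/(_ j i) := BN; rewrite !mxE eq_sym => <-.
by apply: eq_bigr => l _; rewrite mxE mulrC.
Qed.

End finite_rank_perturbations.

(** * Triangular flags and the spectral splitting *)

Section spans.
Context (R : realType) (V : lmodType R[i]).
Local Notation C := (R[i]).
Implicit Types (v : nat -> V) (x y : V).

(** Families are indexed by [nat] and cut off at [k], so that a flag can be truncated or extended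
    without changing its type. *)
Definition span v k x := exists c : nat -> C, x = \sum_(j < k) c j *: v j.

Lemma span0 v k : span v k 0.
Proof. by exists (fun=> 0); rewrite big1// => j _; rewrite scale0r. Qed.

Lemma spanZD v k a x y : span v k x -> span v k y -> span v k (a *: x + y).
Proof.
move=> [c ->] [e ->]; exists (fun j => a * c j + e j).
rewrite scaler_sumr -big_split/=; apply: eq_bigr => j _.
by rewrite scalerDl scalerA.
Qed.

Lemma spanD v k x y : span v k x -> span v k y -> span v k (x + y).
Proof. by move=> hx hy; rewrite -[x]scale1r; exact: spanZD. Qed.

Lemma spanZ v k a x : span v k x -> span v k (a *: x).
Proof. by move=> hx; rewrite -[_ *: _]addr0; apply: spanZD => //; exact: span0. Qed.

Lemma spanB v k x y : span v k x -> span v k y -> span v k (x - y).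
Proof. by move=> hx hy; rewrite -scaleN1r; apply: spanD => //; exact: spanZ. Qed.

Lemma spanS v k x : span v k.+1 x <-> exists c y, span v k y /\ x = c *: v k + y.
Proof.
split=> [[c ->]|[c [y [[e ->] ->]]]].
  exists (c k), (\sum_(j < k) c j *: v j); split; first by exists c.
  by rewrite big_ord_recr addrC.
exists (fun j => if j == k then c else e j); rewrite big_ord_recr/= eqxx addrC.
by congr (_ + _); apply: eq_bigr => j _; rewrite (ltn_eqF (ltn_ord j)).
Qed.

Lemma span_le v k m x : (k <= m)%N -> span v k x -> span v m x.
Proof.
move=> /subnK <-; elim: (m - k)%N => // i ih /ih h.
by apply/spanS; exists 0, x; rewrite scale0r add0r.
Qed.

Lemma span_gen v k j : (j < k)%N -> span v k (v j).
Proof.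
move=> jk; apply: (span_le jk); apply/spanS; exists 1, 0.
by rewrite scale1r addr0; split=> //; exact: span0.
Qed.

Lemma eq_span v v' k x : (forall j, (j < k)%N -> v j = v' j) ->
  span v k x -> span v' k x.
Proof.
by move=> vv' [c ->]; exists c; apply: eq_bigr => j _; rewrite vv'.
Qed.

End spans.

Lemma closed_rnorm (R : realType) (V : normedModType R[i]) (H : set V) :
  (forall x, (forall e, 0 < e -> exists h, H h /\ rnorm (x - h) < e) -> H x) ->
  closed H.
Proof.
move=> hH x clx; apply: hH => e e0.
have e0' : 0 < real_complex R e by rewrite ltcR.
have [h [Hh xh]] := clx _ (nbhsx_ballx x _ e0').
by exists h; split=> //; move: xh; rewrite -ball_normE/= rnormE ltcR.
Qed.

Section flags.
Context (R : realType) (V : normedModType R[i]).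
Local Notation C := (R[i]).
Variables A : V -> V.
Hypothesis A_lin : linear A.
Implicit Types (v : nat -> V) (x y : V) (lam : nat -> C).

(* A flag spans an [A]-invariant subspace on which [A] is triangular, with
   diagonal entries of modulus at least [t]. *)
Definition flag (t : R) n v lam := forall i, (i < n)%N ->
  [/\ t <= normc (lam i), span v i (A (v i) - lam i *: v i) &
      ~ span v i (v i)].

Lemma flagW t n m v lam : (m <= n)%N -> flag t n v lam -> flag t m v lam.
Proof. by move=> mn fl i im; apply: fl; exact: leq_trans mn. Qed.

Lemma flag_free t n v lam : flag t n v lam ->
  forall c : nat -> C, \sum_(j < n) c j *: v j = 0 ->
    forall j, (j < n)%N -> c j = 0.
Proof.
elim: n => [//|n ih] fl c; rewrite big_ord_recr/= => h.
have cn : c n = 0.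
  apply/eqP/negPn/negP => cn; have [_ _] := fl n (leqnn _); apply.
  have -> : v n = (- (c n)^-1) *: \sum_(j < n) c j *: v j.
    move/eqP: h; rewrite addr_eq0 => /eqP ->.
    by rewrite scaleNr scalerN opprK scalerA mulVf// scale1r.
  by apply: spanZ; exists c.
move: h; rewrite cn scale0r addr0 => /(ih (flagW (leqnSn _) fl)) h j.
by rewrite ltnS leq_eqVlt => /predU1P[->//|/h].
Qed.

(** On the quotient of two consecutive spans [A] acts as multiplication by [lam i]. *)
Lemma flag_shift t n v lam i x : flag t n v lam -> (i < n)%N ->
  span v i.+1 x -> span v i (A x - lam i *: x).
Proof.
move=> fl; elim: i x => [|i ih] x /[dup] i_n.
  move=> /fl[_ h _] /spanS[c [y [[e ->] ->]]].
  rewrite big_ord0 addr0 (linZ A_lin) scalerA mulrC -scalerA -scalerBr.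
  exact: spanZ.
move=> /fl[_ h _] /spanS[c [y [hy ->]]].
rewrite (linD A_lin) (linZ A_lin) scalerDr opprD addrACA; apply: spanD.
  by rewrite scalerA mulrC -scalerA -scalerBr; exact: spanZ.
rewrite -[A y](subrK (lam i *: y)) -addrA; apply: spanD.
  by apply: (span_le (leqnSn i)); apply: ih => //; exact: ltnW.
by rewrite -scalerBl; exact: spanZ.
Qed.

(** The factor with the largest index acts first: each factor then sends a span of the flag into the
    preceding one. *)
Fixpoint shift_prod lam n x :=
  if n is n'.+1 then shift_prod lam n' (lam n' *: x - A x) else x.

Lemma shift_prod_lin lam n : linear (shift_prod lam n).
Proof.
elim: n => [//|n ih] a x y /=; rewrite -ih; congr shift_prod.
by rewrite A_lin scalerBr scalerDr !scalerA mulrC opprD addrACA.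
Qed.

Lemma shift_prod_comm lam n (B : V -> V) : linear B ->
  (forall x, A (B x) = B (A x)) ->
  forall x, shift_prod lam n (B x) = B (shift_prod lam n x).
Proof.
move=> lB AB; elim: n => [//|n ih] x /=.
by rewrite AB -(linZ lB) -(linB lB) ih.
Qed.

Lemma flag_kill t n v lam x : flag t n v lam -> span v n x ->
  shift_prod lam n x = 0.
Proof.
elim: n x => [|n ih] x fl; first by move=> [c ->]; rewrite big_ord0.
move=> hx /=; apply: ih; first exact: flagW (leqnSn _) fl.
by rewrite -opprB -scaleN1r; apply: spanZ; exact: (flag_shift fl).
Qed.

(** If [z] differs from the last diagonal entry, a nonzero multiple of [x] lies one level lower,
    hence so does [x]; were [z] to differ from all entries, [x] would descend to the zero span. *)
Lemma flag_eigen t n v lam x z : flag t n v lam -> span v n x -> x != 0 ->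
  A x = z *: x -> exists2 i, (i < n)%N & z = lam i.
Proof.
move=> fl hx x0 Ax.
apply: contrapT => zl; move/eqP: x0; apply.
have {}zl i : (i < n)%N -> z != lam i.
  by move=> i_n; apply/eqP => zi; apply: zl; exists i.
elim: n fl hx zl => [_ [c ->] _|n ih fl hx zl]; first by rewrite big_ord0.
apply: ih; first exact: flagW (leqnSn _) fl.
- have := flag_shift fl (leqnn _) hx; rewrite Ax -scalerBl.
  move=> /(spanZ (z - lam n)^-1); rewrite scalerA mulVf ?scale1r//.
  by rewrite subr_eq0 zl.
- by move=> i i_n; apply: zl; exact: ltnW.
Qed.

Lemma shift_prod_closure (t : R) lam n (U : set V) x :
  (forall i, (i < n)%N -> t <= normc (lam i)) ->
  (forall y, U y -> U (- y)) ->
  (forall y z, t <= normc z -> U (A y - z *: y) -> U y) ->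
  U (shift_prod lam n x) -> U x.
Proof.
move=> tl UN Ucl; elim: n x tl => [//|n ih] x tl /= h.
apply: (Ucl _ (lam n)); first exact: tl.
rewrite -opprB; apply: UN; apply: ih h => i i_n; apply: tl; exact: ltnW.
Qed.

End flags.

(** Index of [s] in a subdivision of [[-B, B]] of mesh [h]. The finite index type serves both a
    pigeonhole argument and the discretization of bounded functions. *)
Definition grid_cell (R : realType) (B h : R) (s : R) :
    'I_(Num.truncn ((B + B) / h)).+1 :=
  inord (Num.truncn ((s + B) / h)).

Lemma grid_cellP (R : realType) (B h s t : R) : 0 < h -> `|s| <= B -> `|t| <= B ->
  grid_cell B h s = grid_cell B h t -> `|s - t| < h.
Proof.
move=> h0; rewrite !ler_norml => /andP[Bs sB] /andP[Bt tB].
have val_cell r : - B <= r -> r <= B ->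
    grid_cell B h r = Num.truncn ((r + B) / h) :> nat.
  move=> Br rB; rewrite /grid_cell inordK// ltnS; apply: le_truncn.
  by rewrite ler_pM2r ?invr_gt0// lerD2r.
move=> /(congr1 val)/=; rewrite !val_cell// => e.
have bnd r : - B <= r -> (Num.truncn ((r + B) / h))%:R * h <= r + B <
    (Num.truncn ((r + B) / h)).+1%:R * h.
  move=> Br; rewrite -ler_pdivlMr// -ltr_pdivrMr//; apply: truncn_itv.
  by rewrite divr_ge0 ?(ltW h0)//; lra.
have := bnd _ Bs; have := bnd _ Bt; rewrite e.
move: (Num.truncn _) => k; rewrite -natr1 mulrDl mul1r => /andP[? ?] /andP[? ?].
by rewrite ltr_norml; apply/andP; split; lra.
Qed.

Section spectral_splitting.
Context (R : realType) (V : normedModType R[i]).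
Local Notation C := (R[i]).
Variables (A P F : V -> V) (q : R).
Hypotheses (A_bounded : bounded_op A) (P_lin : linear P) (q_ge0 : 0 <= q)
  (P_le : forall x, rnorm (P x) <= q * rnorm x) (F_fr : finite_rank F)
  (AE : forall x, A x = P x + F x)
  (shift_surj : forall z, q < normc z -> surj (fun x => z *: x - P x)).

Let A_lin : linear A := A_bounded.1.

Lemma rnorm_subr (x y : V) : rnorm x - rnorm y <= rnorm (x - y).
Proof. by rewrite lerBlDr (le_trans _ (rnormD _ _))// subrK. Qed.

(** For [q < |z|], [z - P] is bounded below with constant [1 / (|z| - q)]. That it is onto is the
    assumption [shift_surj], because [V] is not supposed complete; a Neumann series supplies it for
    bounded functions. *)
Lemma fredholm_shift z : q < normc z -> fredholm (fun x => z *: x - A x).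
Proof.
move=> qz; exists (fun x => z *: x - P x), F; split=> //.
- apply: bounded_opB; first exact: bounded_op_scale.
  by split=> //; exists q.
- exact: shift_surj.
- have d0 : 0 < normc z - q by rewrite subr_gt0.
  exists (normc z - q)^-1; first by rewrite invr_ge0 ltW.
  move=> x; rewrite mulrC ler_pdivlMr// mulrC mulrBl (le_trans _ (rnorm_subr _ _))//.
  by rewrite rnormZ lerB.
- by move=> x; rewrite AE opprD addrA.
Qed.

Lemma fredholm_shift_prod lam n : (forall i, (i < n)%N -> q < normc (lam i)) ->
  fredholm (shift_prod A lam n).
Proof.
elim: n => [_|n ih h]; first exact: fredholm_id.
apply: (@eq_fredholm _ _ (shift_prod A lam n \o (fun x => lam n *: x - A x))) => //.
apply: fredholm_comp; last by apply: fredholm_shift; exact: h.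
by apply: ih => i i_n; apply: h; exact: ltnW.
Qed.

Section flag_length.
Variable t : R.
Hypothesis qt : 4 * q < t.

Let q_lt_t : q < t.
Proof. by apply: le_lt_trans qt; rewrite ler_peMl// ler1n. Qed.

(** The flag vectors are independent and killed by the product of shifts, which is Fredholm because
    the diagonal entries exceed [q] in modulus. *)
Lemma flag_dual n (v : nat -> V) lam : flag A t n v lam ->
  exists psi : 'I_n -> V -> C, (forall i, bounded_form (psi i)) /\
    forall i j : 'I_n, psi i (v j) = (i == j)%:R.
Proof.
move=> fl; apply: (@dual_forms _ _ (shift_prod A lam n)).
- by apply: fredholm_shift_prod => i /fl[/(lt_le_trans q_lt_t)].
- by move=> i; apply: (flag_kill A_lin fl); exact: span_gen.
- move=> c; pose c' j := if insub j is Some i then c i else 0.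
  have c'E (i : 'I_n) : c' i = c i by rewrite /c' valK.
  under eq_bigr do rewrite -c'E.
  by move=> /(flag_free fl) h i; rewrite -c'E h.
Qed.

(** The distance from [v i] to the preceding span is positive: the last dual form equals [1] on
    [v i - s] for every [s] in that span, which keeps [rnorm (v i - s)] above [1 / e]. A
    near-minimizer is then rescaled. *)
Lemma flag_riesz n (v : nat -> V) lam : flag A t n v lam -> forall i, (i < n)%N ->
  exists y, [/\ rnorm y <= 2, span v i.+1 y &
    forall s, span v i s -> 1 <= rnorm (y - s)].
Proof.
move=> fl i i_n; have [psi [bpsi psiv]] := flag_dual (flagW i_n fl).
have [lpsi [e e0 psie]] := bpsi ord_max.
have psi1 s : span v i s -> psi ord_max (v i - s) = 1.
  move=> [c ->]; rewrite formB// form_sumE//.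
  rewrite (psiv ord_max ord_max) eqxx big1 ?subr0// => j _; rewrite formZ//.
  rewrite (psiv _ (widen_ord (leqnSn i) j)).
  by rewrite -val_eqE/= gtn_eqF ?mulr0.
have eP s : span v i s -> 1 <= e * rnorm (v i - s).
  by move=> /psi1 h; have := psie (v i - s); rewrite h Normc.normc1.
have {e0}e0 : 0 < e.
  rewrite lt_def e0 andbT; apply/eqP => e0'.
  by have := eP 0 (span0 _ _); rewrite e0' mul0r ler10.
pose D := [set rnorm (v i - s) | s in span v i].
have D0 : D !=set0 by exists (rnorm (v i - 0)), 0 => //; exact: span0.
have Dlb : lbound D e^-1.
  by move=> _ [s hs <-]; rewrite -[leLHS]mulr1 mulrC ler_pdivrMr// mulrC eP.
have lbD : has_lbound D by exists e^-1.
have d0 : 0 < inf D.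
  by apply: (@lt_le_trans _ _ e^-1); rewrite ?invr_gt0// lb_le_inf.
(* The tolerance is [inf D] itself: the distance reached is below [2 * inf D], which becomes the
   bound [2] after scaling. *)
have [_ [s hs <-] hsd] := inf_adherent d0 (conj D0 lbD).
exists ((inf D)^-1%:C%C *: (v i - s)).
have nE : normc (inf D)^-1%:C%C = (inf D)^-1.
  by rewrite /= expr0n addr0 sqrtr_sqr ger0_norm// invr_ge0 ltW.
split.
- by rewrite rnormZ nE mulrC ler_pdivrMr// mulr_natl mulr2n ltW.
- apply/spanZ/spanB; first exact: span_gen.
  exact: (span_le (leqnSn i)).
- move=> s' hs'.
  have -> : (inf D)^-1%:C%C *: (v i - s) - s' =
      (inf D)^-1%:C%C *: (v i - (s + (inf D)%:C%C *: s')).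
    rewrite opprD addrA [RHS]scalerBr scalerA -rmorphM/= mulVf ?gt_eqF//.
    by rewrite rmorph1 scale1r.
  rewrite rnormZ nE mulrC ler_pdivlMr// mul1r ge_inf//.
  by eexists; last reflexivity; apply: spanD => //; exact: spanZ.
Qed.

(* The vectors given by Riesz' lemma have images under [A] at distance at least
   [t], while [P] contributes at most [4 q] and the finite-rank part [F] takes
   finitely many values up to a small error. *)
Lemma flag_bounded : exists d, forall n v lam, flag A t n v lam -> (n <= d)%N.
Proof.
have [m [phi [u [bphi FE]]]] := F_fr.
have /choice[e eP] : forall i, exists e : R, 0 <= e /\
    forall v, normc (phi i v) <= e * rnorm v.
  by move=> i; have [_ [e e0 eP]] := bphi i; exists e.
pose B := \sum_i e i * 2.
have phiB i y : rnorm y <= 2 -> normc (phi i y) <= B.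
  move=> y2; rewrite (le_trans ((eP i).2 y))// /B (bigD1 i)//=.
  rewrite (le_trans (ler_wpM2l (eP i).1 y2))// lerDl sumr_ge0// => j _.
  by rewrite mulr_ge0// (eP j).1.
pose U := \sum_i rnorm (u i).
have U0 : 0 <= U by apply: sumr_ge0 => i _; exact: rnorm_ge0.
(* For two vectors in one cell, [|phi_i (y - y')| <= 2 h], so [F] separates them by at most [2 h U];
   this [h] makes that less than [t - 4 q]. *)
pose h := (t - 4 * q) / (4 * (U + 1)).
have h0 : 0 < h by rewrite divr_gt0 ?subr_gt0// mulr_gt0// ltr_wpDl.
pose M := (Num.truncn ((B + B) / h)).+1.
pose cell y : {ffun 'I_m -> 'I_M * 'I_M} :=
  [ffun i => (grid_cell B h (complex.Re (phi i y)),
              grid_cell B h (complex.Im (phi i y)))].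
have cellP y y' : rnorm y <= 2 -> rnorm y' <= 2 -> cell y = cell y' ->
    rnorm (A (y - y')) < t.
  move=> y2 y2' /ffunP cc.
  rewrite AE (le_lt_trans (rnormD _ _))//.
  have Phi i : normc (phi i (y - y')) <= 2 * h.
    have := cc i; rewrite !ffunE => -[].
    have RB z : rnorm z <= 2 -> `|complex.Re (phi i z)| <= B.
      by move=> /(phiB i); apply: le_trans; exact: Re_le_normc.
    have IB z : rnorm z <= 2 -> `|complex.Im (phi i z)| <= B.
      by move=> /(phiB i); apply: le_trans; exact: Im_le_normc.
    move=> /(grid_cellP h0 (RB _ y2) (RB _ y2')) hR.
    move=> /(grid_cellP h0 (IB _ y2) (IB _ y2')) hI.
    rewrite (le_trans (normc_le_ReIm _))// formB; last exact: (bphi i).1.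
    rewrite mulr_natl mulr2n; apply/ltW; apply: ltrD.
      by move: hR; case: (phi i y) (phi i y') => [? ?] [? ?].
    by move: hI; case: (phi i y) (phi i y') => [? ?] [? ?].
  have FU : rnorm (F (y - y')) <= 2 * h * U.
    rewrite FE (le_trans (rnorm_sum _ _ _))// /U mulr_sumr ler_sum// => i _.
    by rewrite rnormZ ler_wpM2r ?rnorm_ge0.
  have PU : rnorm (P (y - y')) <= 4 * q.
    rewrite (le_trans (P_le _))// mulrC ler_wpM2r//.
    by rewrite (le_trans (rnormB _ _))//; lra.
  have : 2 * h * U < t - 4 * q.
    have -> : t - 4 * q = h * (4 * (U + 1)).
      by rewrite /h divfK// gt_eqF// mulr_gt0// ltr_wpDl.
    by nra.
  by lra.
exists #|{: {ffun 'I_m -> 'I_M * 'I_M}}| => n v lam fl.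
have /choice[y yP] : forall i : 'I_n, exists y, [/\ rnorm y <= 2,
    span v i.+1 y & forall s, span v i s -> 1 <= rnorm (y - s)].
  by move=> i; exact: (flag_riesz fl).
suff inj : injective (fun i => cell (y i)).
  by rewrite -[n]card_ord; apply: leq_card inj.
have sep (i k : 'I_n) : (k < i)%N -> cell (y i) = cell (y k) -> False.
  move=> ki cc; have [yi2 yi far] := yP i; have [yk2 yk _] := yP k.
  have := cellP _ _ yi2 yk2 cc; apply/negP; rewrite -leNgt.
  have [tl _ _] := fl _ (ltn_ord i).
  have l0 : lam i != 0.
    apply/eqP => l0; move: tl; rewrite l0 Normc.normc0; apply/negP.
    by rewrite -ltNge (le_lt_trans _ q_lt_t).
  (* [A (y i - y k)] is [lam i] times [y i - s / lam i], and [s] lies in the span of the first [i]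
     vectors: [A - lam i] lowers [y i], while [A (y k)] stays in that span because [k < i]. The
     separation of [y i] from the span then gives norm at least [t]. *)
  pose s := lam i *: y i - A (y i) + A (y k).
  have ss : span v i s.
    apply: spanD.
      by rewrite -opprB -scaleN1r; apply: spanZ; exact: (flag_shift A_lin fl).
    apply: (span_le ki); rewrite -[A _](subrK (lam k *: y k)); apply: spanD.
      by apply: (span_le (leqnSn k)); exact: (flag_shift A_lin fl).
    exact: spanZ.
  have -> : A (y i - y k) = lam i *: (y i - (lam i)^-1 *: s).
    rewrite scalerBr scalerA divff// scale1r /s (linB A_lin).
    by rewrite opprD opprB addrA subrKC.
  rewrite rnormZ (le_trans tl)// ler_peMr ?normc_ge0//; apply: far.
  exact: spanZ.
move=> i k /= cc; apply/val_inj/eqP; rewrite eqn_leq leqNgt [X in _ && X]leqNgt.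
by apply/andP; split; apply/negP => /sep; apply.
Qed.

(** A flag of maximal length, which exists by [flag_bounded]: a vector [x] outside its span with
    [A x - z x] inside could be appended to it. *)
Lemma exists_closed_flag : exists n v lam, flag A t n v lam /\
  forall x z, t <= normc z -> span v n (A x - z *: x) -> span v n x.
Proof.
have [d dP] := flag_bounded.
pose len n := `[< exists v lam, flag A t n v lam >].
have len0 : exists n, len n by exists 0%N; apply/asboolP; exists (fun=> 0), (fun=> 0).
have lend n : len n -> (n <= d)%N by move=> /asboolP[v [lam /dP]].
have [n /asboolP[v [lam fl]] nmax] := ex_maxnP len0 lend.
exists n, v, lam; split=> // x z tz hx; apply: contrapT => nx.
suff : (n.+1 <= n)%N by rewrite ltnn.
apply: nmax; apply/asboolP.
pose v' j := if (j < n)%N then v j else x.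
pose lam' j := if (j < n)%N then lam j else z.
have vv' i : (i <= n)%N -> forall j, (j < i)%N -> v j = v' j.
  by move=> i_n j ji; rewrite /v' (leq_trans ji i_n).
exists v', lam' => i; rewrite ltnS leq_eqVlt => /predU1P[->|i_n].
  rewrite /v' /lam' ltnn; split=> //; first exact: (eq_span (vv' n _)).
  by move=> h; apply: nx; apply: eq_span h => j jn; rewrite jn.
rewrite /v' /lam' i_n; have [h1 h2 h3] := fl _ i_n; split=> //.
  exact: (eq_span (vv' i (ltnW i_n))).
move=> h; apply: h3; apply: eq_span h => j ji.
by rewrite (ltn_trans ji i_n).
Qed.

End flag_length.

End spectral_splitting.

(** * Splitting into the kernel and the range of the product of shifts *)

Section closed_flag.
Context (R : realType) (V : normedModType R[i]).
Local Notation C := (R[i]).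
Variables (A P F : V -> V) (q : R).
Hypotheses (A_bounded : bounded_op A) (P_lin : linear P) (q_ge0 : 0 <= q)
  (P_le : forall x, rnorm (P x) <= q * rnorm x) (F_fr : finite_rank F)
  (AE : forall x, A x = P x + F x)
  (shift_surj : forall z, q < normc z -> surj (fun x => z *: x - P x)).
Variables (t : R) (n : nat) (v : nat -> V) (lam : nat -> C).
Hypotheses (qt : 4 * q < t) (fl : flag A t n v lam)
  (cl : forall x z, t <= normc z -> span v n (A x - z *: x) -> span v n x).

Let A_lin : linear A := A_bounded.1.
Let K := shift_prod A lam n.
Let K_lin : linear K := shift_prod_lin A_lin lam n.

Let q_lt_t : q < t.
Proof. by apply: le_lt_trans qt; rewrite ler_peMl// ler1n. Qed.

Let K_fredholm : fredholm K.
Proof.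
apply: (fredholm_shift_prod P_lin q_ge0 P_le F_fr AE shift_surj).
by move=> i /fl[/(lt_le_trans q_lt_t)].
Qed.

Let closure x : span v n (K x) -> span v n x.
Proof.
apply: (@shift_prod_closure _ _ A t lam n (span v n)).
- by move=> i /fl[].
- by move=> y hy; rewrite -scaleN1r; exact: spanZ.
- by move=> y z tz; exact: cl.
Qed.

Lemma closed_flagE x : span v n x <-> K x = 0.
Proof.
split; first exact: (flag_kill A_lin fl).
by move=> Kx; apply: closure; rewrite Kx; exact: span0.
Qed.

(** Together with [closed_flagE], this means that [K] and its square have the same kernel: no
    generalized eigenvector is left outside the span. *)
Lemma closed_flag_disj x : span v n (K x) -> K x = 0.
Proof. by move=> /closure h; exact/closed_flagE. Qed.

Variable psi : 'I_n -> V -> C.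
Hypotheses (psi_form : forall i, bounded_form (psi i))
  (psiv : forall i j : 'I_n, psi i (v j) = (i == j)%:R).

(** A bounded projection onto the span of the flag, built from the dual forms. *)
Let Psi x := \sum_i psi i x *: v i.

Let Psi_fr : finite_rank Psi.
Proof. by exists n, psi, (fun i : 'I_n => v i). Qed.

Let Psi_span x : span v n (Psi x).
Proof.
exists (fun j => if insub j is Some i then psi i x else 0).
by apply: eq_bigr => i _; rewrite valK.
Qed.

Let Psi_id x : span v n x -> Psi x = x.
Proof.
move=> [c ->]; apply: eq_bigr => i _; rewrite form_sumE; last exact: (psi_form i).1.
rewrite (bigD1 i)//= big1 ?addr0 => [|j ji];
  rewrite formZ ?psiv; try exact: (psi_form i).1.
  by rewrite eqxx mulr1.
by rewrite eq_sym (negbTE ji) mulr0.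
Qed.

(* [K] restricted to its range, corrected by [Psi] on its kernel, is bijective:
   this yields the splitting of [V] into the kernel and the range of [K]. *)
Lemma corrected_bij (B : V -> V) : fredholm B ->
    (forall x, B (K x) = K (B x)) -> (forall x, B (K x) = 0 -> K x = 0) ->
  surj (fun x => B (K x) + Psi x) /\ bounded_below (fun x => B (K x) + Psi x).
Proof.
move=> fB BK inj; apply: fredholm_alternative.
  by apply: fredholm_finite_rankD => //; exact: (fredholm_comp fB).
move=> x h.
have BKx : B (K x) = 0.
  rewrite BK; apply: closed_flag_disj.
  rewrite -BK; move/eqP: h; rewrite addr_eq0 => /eqP ->.
  by rewrite -scaleN1r; apply: spanZ; exact: Psi_span.
have /closed_flagE/Psi_id <- := inj _ BKx.
by move: h; rewrite BKx add0r.
Qed.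

(** Preimages under [K] can thus be normalized to have no component along the span, which turns
    bounds for [K + Psi] into bounds on the range of [K]. *)
Let K_modPsi x : K (x - Psi x) = K x /\ Psi (x - Psi x) = 0.
Proof.
have /closed_flagE KPsi := Psi_span x.
split; first by rewrite (linB K_lin) KPsi subr0.
rewrite (linB (finite_rank_linear Psi_fr)) [Psi (Psi x)]Psi_id ?subrr//.
Qed.

Let K_plus_Psi : surj (fun x => K x + Psi x) /\ bounded_below (fun x => K x + Psi x).
Proof. by apply: (@corrected_bij id) => //; exact: fredholm_id. Qed.

Lemma closed_flag_sum x : exists u w, span v n u /\ x = u + K w.
Proof.
have [w <-] := K_plus_Psi.1 x; exists (Psi w), w; split; first exact: Psi_span.
by rewrite addrC.
Qed.

(** A limit [x] of points of the range is [K w + Psi w] for some [w]. For [K y'] near [x] with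
    [Psi y' = 0], the lower bound for [K + Psi] makes [w - y'] small, hence also
    [Psi w = Psi (w - y')]; so [Psi w] vanishes. *)
Lemma closed_range : closed (range K).
Proof.
have [c c0 cK] := K_plus_Psi.2.
have [_ [e e0 Pe]] := finite_rank_bounded Psi_fr.
apply: closed_rnorm => x xlim.
have [w wx] := K_plus_Psi.1 x; exists w => //.
suff : Psi w = 0 by move=> Pw; move: wx; rewrite Pw addr0.
apply/rnorm_eq0/eqP; rewrite eq_le rnorm_ge0 andbT; apply/ler_addgt0Pr => d d0.
have D0 : 0 < d / (e * c + 1) by rewrite divr_gt0// ltr_wpDl// mulr_ge0.
have [_ [[y _ <-] xy]] := xlim _ D0.
have [Ky Py] := K_modPsi y; move: xy; rewrite -Ky; set y' := y - _ => xy.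
rewrite add0r.
have -> : Psi w = Psi (w - y').
  by rewrite (linB (finite_rank_linear Psi_fr)) Py subr0.
rewrite (le_trans (Pe _))//.
rewrite (@le_trans _ _ (e * (c * rnorm (x - K y'))))//.
  rewrite ler_wpM2l// (le_trans (cK _))// ler_wpM2l// -wx.
  by rewrite (linB K_lin) (linB (finite_rank_linear Psi_fr)) Py subr0 addrAC.
rewrite mulrA (@le_trans _ _ ((e * c + 1) * rnorm (x - K y')))//.
  by rewrite ler_wpM2r ?rnorm_ge0// lerDl.
by rewrite mulrC -ler_pdivlMr ?ltW// ltr_wpDl// mulr_ge0.
Qed.

(** [corrected_bij] is applied to [B = z - A], which commutes with [K]. It is injective on the range
    because an eigenvector for [z] lies in the span, by closedness of the flag, and the span meets
    the range only in [0]. *)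
Lemma closed_flag_resolvent z : t <= normc z ->
  (forall x, range K x -> A x = z *: x -> x = 0) /\
  (forall h, range K h -> exists2 k, range K k & z *: k - A k = h) /\
  exists2 c : R, 0 <= c & forall h, range K h -> rnorm h <= c * rnorm (z *: h - A h).
Proof.
move=> tz.
have inj x : range K x -> A x = z *: x -> x = 0.
  move=> [w _ <-] Kw; apply: closed_flag_disj; apply: (cl tz).
  by rewrite Kw subrr; exact: span0.
split=> //.
pose B x := z *: x - A x.
have fB : fredholm B.
  by apply: (fredholm_shift P_lin q_ge0 P_le F_fr AE shift_surj);
    exact: lt_le_trans tz.
have B_lin : linear B := (fredholm_bounded fB).1.
have BK x : B (K x) = K (B x).
  apply/esym/shift_prod_comm => // {}x.
  by rewrite /B (linB A_lin) (linZ A_lin).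
have Binj x : B (K x) = 0 -> K x = 0.
  by move=> /eqP; rewrite subr_eq0 => /eqP h; apply: inj.
have [sM [c c0 bM]] := corrected_bij fB BK Binj.
split.
- move=> _ [w _ <-]; have [x xw] := sM (K w).
  exists (K x) => //.
  (* The equation [B (K x) + Psi x = K w] puts [Psi x] in the range as well as in the span. *)
  suff Px : Psi x = 0 by move: xw; rewrite Px addr0.
  have Pk : Psi x = K (w - B x) by rewrite (linB K_lin) -BK -xw addrC addKr.
  by rewrite Pk; apply: closed_flag_disj; rewrite -Pk.
- have [_ [e e0 Ke]] := fredholm_bounded K_fredholm.
  exists (e * c) => [|_ [w _ <-]]; first exact: mulr_ge0.
  have [<- Py] := K_modPsi w; set y := w - _ in Py *.
  rewrite (le_trans (Ke _))// -mulrA ler_wpM2l// (le_trans (bM _))//.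
  by rewrite Py addr0.
Qed.

End closed_flag.

(** * From a power of an operator back to the operator *)

Section ess_decomposition.
Context (R : realType) (V : normedModType R[i]).
Local Notation C := (R[i]).
Variable T : {linear V -> V}.
Hypothesis T_bounded : bounded_op T.

(** The cofactor [sum_j z^j T^(m-1-j)] of [z - T] in [z^m - T^m]. It turns a resolvent of [T^m] at
    [z^m] into one of [T] at [z]. *)
Fixpoint geom_op (z : C) m x :=
  if m is m'.+1 then z ^+ m' *: x + T (geom_op z m' x) else 0.

Lemma geom_opE z m x : z *: geom_op z m x - T (geom_op z m x) =
  z ^+ m *: x - iter m T x.
Proof.
elim: m x => [|m ih] x /=; first by rewrite linear0 scaler0 !subr0 expr0 scale1r subrr.
rewrite scalerDr linearD scalerA -exprS opprD addrACA.
by rewrite -linearZ -linearB ih linearB/= addrA subrK.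
Qed.

Lemma geom_op_bounded z m : bounded_op (geom_op z m).
Proof.
elim: m => [|m ih].
  split=> [a u v|]; first by rewrite scaler0 addr0.
  by exists 0 => // v; rewrite /= rnorm0 mul0r.
apply: bounded_opD; first exact: bounded_op_scale.
exact: bounded_op_comp T_bounded ih.
Qed.

Lemma iter_bounded m : bounded_op (iter m T).
Proof.
by elim: m => [|m ih]; [exact: bounded_op_id|exact: bounded_op_comp T_bounded ih].
Qed.

Lemma geom_op_comm z m (B : V -> V) : linear B -> (forall x, T (B x) = B (T x)) ->
  forall x, geom_op z m (B x) = B (geom_op z m x).
Proof.
move=> lB TB; elim: m => [|m ih] x /=; first by rewrite (lin0 lB).
by rewrite ih TB (linD lB) (linZ lB).
Qed.

Lemma normcX (z : C) m : normc (z ^+ m) = normc z ^+ m.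
Proof.
elim: m => [|m ih]; first by rewrite !expr0 Normc.normc1.
by rewrite !exprS Normc.normcM ih.
Qed.

(** An essential decomposition at [rho] demands spectral radius strictly below [rho] on one summand
    and eigenvalues of modulus at least [rho] on the other. The entries being finitely many, the
    threshold can be lowered to some [r0 < rho] with no modulus between [r0^N] and [rho^N]. *)
Lemma exists_root_gap (N n : nat) (lam : nat -> C) (r rho : R) : (0 < N)%N ->
  0 < r -> r < rho -> exists r0, [/\ r <= r0, r0 < rho &
    forall i, (i < n)%N -> normc (lam i) < rho ^+ N -> normc (lam i) < r0 ^+ N].
Proof.
move=> N0 r_gt0 rrho; have rho0 := lt_trans r_gt0 rrho.
elim: n => [|n [s [rs srho sP]]]; first by exists r.
have [ln|ln] := leP (rho ^+ N) (normc (lam n)).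
  exists s; split=> // i; rewrite ltnS leq_eqVlt => /predU1P[->|/sP//].
  by rewrite ltNge ln.
pose p := normc (lam n) `^ N%:R^-1.
have pN : p ^+ N = normc (lam n).
  rewrite -powR_mulrn ?powR_ge0// -powRrM mulVf ?powRr1 ?normc_ge0//.
  by rewrite pnatr_eq0 -lt0n.
have prho : p < rho.
  by rewrite -(@ltr_pXn2r _ N)// ?nnegrE ?powR_ge0 ?(ltW rho0)// pN.
pose s' := Num.max s ((p + rho) / 2).
have s'0 : 0 <= s' by rewrite le_max (le_trans (ltW r_gt0) rs).
exists s'; split=> [||i].
- by rewrite le_max rs.
- by rewrite gt_max srho/=; lra.
- rewrite ltnS leq_eqVlt => /predU1P[-> _|i_n /(sP _ i_n) h].
    rewrite -pN ltr_pXn2r ?nnegrE ?powR_ge0// lt_max; apply/orP; right.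
    by lra.
  rewrite (lt_le_trans h)// lerXn2r ?nnegrE ?(le_trans (ltW r_gt0) rs)//.
  by rewrite le_max lexx.
Qed.

Variables (P F : V -> V) (q : R) (N : nat) (r rho : R).
Hypotheses (P_lin : linear P) (q_ge0 : 0 <= q)
  (P_le : forall x, rnorm (P x) <= q * rnorm x) (F_fr : finite_rank F)
  (TE : forall x, iter N T x = P x + F x)
  (shift_surj : forall z, q < normc z -> surj (fun x => z *: x - P x))
  (N_gt0 : (0 < N)%N) (r_gt0 : 0 < r) (r_rho : r < rho) (qr : 4 * q < r ^+ N).

Let A := iter N T.
Let A_bounded : bounded_op A := iter_bounded N.
Let A_lin : linear A := A_bounded.1.

(** Two flags are used. The diagonal of the one at level [r^N] contains every eigenvalue of [A] of
    modulus at least [r^N]; once [r0] has been placed in a gap of this finite list, the one at level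
    [r0^N] gives the splitting. *)
Theorem ess_decomposition_power : ess_decomposition T rho.
Proof.
have [n1 [v1 [lam1 [fl1 cl1]]]] :=
  exists_closed_flag A_bounded P_lin q_ge0 P_le F_fr TE shift_surj qr.
have [r0 [rr0 r0rho r0P]] := exists_root_gap n1 lam1 N_gt0 r_gt0 r_rho.
have r0_gt0 : 0 < r0 := lt_le_trans r_gt0 rr0.
have leX a b : 0 < a -> a <= b -> a ^+ N <= b ^+ N.
  move=> a0 ab; have b0 := le_trans (ltW a0) ab.
  by rewrite lerXn2r ?nnegrE ?(ltW a0).
have qr0 : 4 * q < r0 ^+ N by rewrite (lt_le_trans qr)// leX.
have [n [v [lam [fl cl]]]] :=
  exists_closed_flag A_bounded P_lin q_ge0 P_le F_fr TE shift_surj qr0.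
have [psi [psi_form psiv]] :=
  flag_dual A_bounded P_lin q_ge0 P_le F_fr TE shift_surj qr0 fl.
pose K := shift_prod A lam n.
have K_lin : linear K by exact: shift_prod_lin.
have KT x : K (T x) = T (K x).
  by apply: shift_prod_comm => [|y]; [exact: linearP|rewrite /A -iterSr].
have UE x : span v n x <-> K x = 0 by exact: (closed_flagE A_bounded fl cl).
have disj x : span v n (K x) -> K x = 0 by exact: (closed_flag_disj A_bounded fl cl).
have T_lin : linear T by exact: linearP.
exists (span v n), (range K); split; split.
(* Invariance under [T], not merely under [A]: the span is the kernel of [K], and [K] commutes with
   [T]. *)
- split; last by move=> _ [x /UE Kx <-]; apply/UE; rewrite KT Kx linear0.
  split; first by rewrite inE; exact: span0.
  by move=> a x y; rewrite !inE; exact: spanZD.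
- split; last by move=> _ [_ [x _ <-] <-]; exists (T x).
  split; first by rewrite inE; exists 0 => //; exact: lin0.
  move=> a x y; rewrite !inE => -[x' _ <-] [y' _ <-].
  by exists (a *: x' + y') => //; exact: K_lin.
- split.
    apply/seteqP; split => [_ [/[swap] -[x _ <-]] /disj//|_ ->].
    by split; [exact: span0|exists 0 => //; exact: lin0].
  move=> x; have [u [w [uU xE]]] := closed_flag_sum A_bounded P_lin q_ge0 P_le F_fr TE
    shift_surj qr0 fl cl psi_form psiv x.
  by exists u, (K w); split=> //; exists w.
- exact: (closed_range A_bounded P_lin q_ge0 P_le F_fr TE
    shift_surj qr0 fl cl psi_form psiv).
- apply: le_lt_trans r0rho.
  suff S z : z \notin resolvent_on T (range K) -> normc z <= r0.
    rewrite /spectral_radius_on; set D := [set _ | _ in _].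
    have [->|/set0P D0] := eqVneq D set0; first by rewrite sup0 ltW.
    by apply: ge_sup => // _ [z /= zr <-]; apply: S; apply/negP; rewrite inE.
  apply: contraNT; rewrite -ltNge => r0z; rewrite inE.
  have r0zN : r0 ^+ N <= normc (z ^+ N).
    by rewrite normcX leX// ltW.
  have [inj [sur [c c0 cA]]] := closed_flag_resolvent A_bounded P_lin q_ge0 P_le F_fr TE
    shift_surj qr0 fl cl psi_form psiv r0zN.
  have iterT x m : T x = z *: x -> iter m T x = z ^+ m *: x.
    move=> Tx; elim: m => [|m ih]; first by rewrite expr0 scale1r.
    by rewrite iterS ih linearZ/= Tx scalerA -exprSr.
  have [lG [g g0 gG]] := geom_op_bounded z N.
  split.
  + move=> h Hh; have [k [k' _ kk'] kh] := sur _ Hh.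
    exists (geom_op z N k); split.
      split; last by rewrite geom_opE.
      exists (geom_op z N k') => //; rewrite -kk'.
      by apply/esym/geom_op_comm => // x; exact/esym/KT.
    (* Uniqueness: the difference of two solutions is killed by [z - T], hence by [z^N - A], and
       [inj] applies. *)
    move=> y [[y' _ yy'] yh].
    apply/eqP; rewrite -subr_eq0; apply/eqP; apply: inj.
      exists (geom_op z N k' - y') => //.
      rewrite [LHS](linB K_lin) yy' -kk'; congr (_ - _).
      by apply/esym/geom_op_comm => // x; exact/esym/KT.
    have e : z *: geom_op z N k - T (geom_op z N k) = z *: y - T y.
      by rewrite geom_opE kh yh.
    apply: iterT; rewrite linearB/= scalerBr (canRL (subrK _) e).
    by rewrite addrAC [X in _ = X + _]addrAC subrr add0r addrC.
  + exists (real_complex R (c * g)) => x Hx.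
    rewrite !rnormE -rmorphM/= lecR (le_trans (cA _ Hx))// -mulrA ler_wpM2l//.
    rewrite -geom_opE.
    have -> : z *: geom_op z N x - T (geom_op z N x) = geom_op z N (z *: x - T x).
      rewrite (linB lG) (linZ lG); congr (_ - _).
      by apply/esym/geom_op_comm.
    exact: gG.
- exists n, (fun i : 'I_n => v i) => x [c ->]; by exists (fun i => c i).
- move=> z x Ux x0 Tx; rewrite leNgt; apply/negP => zrho.
  have Ax : A x = z ^+ N *: x.
    rewrite /A; elim: N => [|m ih]; first by rewrite expr0 scale1r.
    by rewrite iterS ih linearZ/= Tx scalerA -exprSr.
  have [i i_n zi] := flag_eigen A_lin fl Ux x0 Ax.
  have [r0z _ _] := fl _ i_n; rewrite -zi in r0z.
  (* As [x] also lies in the first span, [z^N] is one of the listed values; if [|z| < rho], the gap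
     forces it below [r0^N], contrary to the level of the second flag. *)
  have Ux1 : span v1 n1 x.
    apply: (cl1 _ (z ^+ N)); last by rewrite Ax subrr; exact: span0.
    by rewrite (le_trans _ r0z)// leX.
  have [j j_n zj] := flag_eigen A_lin fl1 Ux1 x0 Ax.
  move: r0z; apply/negP; rewrite -ltNge zj r0P// -zj normcX.
  by rewrite ltr_pXn2r ?nnegrE ?normc_ge0// ltW// (lt_trans r0_gt0).
Qed.

End ess_decomposition.

(** * Bounded kernels acting on bounded measurable functions *)

Lemma geometric_limit (R : realType) (a : nat -> R) (c r : R) :
  0 <= c -> 0 <= r < 1 -> (forall k, `|a k| <= c * r ^+ k) ->
  exists l, (series a @ \oo --> l) /\
    forall n, `|l - \sum_(k < n) a k| <= c * r ^+ n / (1 - r).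
Proof.
move=> c0 /andP[r0 r1] ar.
have r1' : 0 < 1 - r by rewrite subr_gt0.
have cvg_a : cvgn (series a).
  apply: normed_cvg; apply: (@series_le_cvg _ _ (geometric c r)) => //.
  - by move=> n; exact: normr_ge0.
  - by move=> n; rewrite geometric_ge0.
  - by apply: is_cvg_geometric_series; rewrite ger0_norm.
exists (limn (series a)); split=> // n.
have part j : `|\sum_(k < n + j) a k - \sum_(k < n) a k| <= c * r ^+ n / (1 - r).
  rewrite big_split_ord/= addrAC subrr add0r (le_trans (ler_norm_sum _ _ _))//.
  rewrite (@le_trans _ _ (\sum_(i < j) c * r ^+ n * r ^+ i))//.
    by rewrite ler_sum// => i _; rewrite -mulrA -exprD.
  rewrite -mulr_sumr ler_wpM2l ?mulr_ge0 ?exprn_ge0//.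
  rewrite -[leLHS](mulfK (lt0r_neq0 r1')) ler_pdivrMr// mulVf ?gt_eqF//.
  by rewrite mulrC -opprB mulNr -subrX1 opprB gerBl exprn_ge0.
apply/ler_addgt0Pr => e e0.
have /cvgrPdist_lt/(_ _ e0)[N _ NP] := cvg_a.
have := NP (n + N)%N (leq_addl _ _); rewrite seriesEord/= => h.
rewrite -(subrK (\sum_(k < n + N) a k) (limn _)) -addrA addrC.
by rewrite (le_trans (ler_normD _ _))// lerD// ltW.
Qed.

Lemma le_geometric_le0 (R : realType) (x c r : R) : 0 <= r < 1 ->
  (forall n, x <= c * r ^+ n) -> x <= 0.
Proof.
move=> /andP[r0 r1] xr; apply/ler_addgt0Pr => e e0; rewrite add0r.
have r1' : `|r| < 1 by rewrite ger0_norm.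
have /cvgrPdist_lt/(_ _ e0)[N _ NP] := cvg_geometric c r1'.
have := NP N (leqnn N); rewrite /= sub0r normrN => h.
by rewrite (le_trans (xr N))// (le_trans (ler_norm _))// ltW.
Qed.

Section bmfun_complete.
Context d (E : measurableType d) (R : realType).
Local Notation B := (bmfun E R).
Implicit Types f g : B.

Lemma rnorm_supnorm f : rnorm f = supnorm f.
Proof. by []. Qed.

Lemma bmfun_ext f g : f =1 g -> f = g.
Proof. by move=> fg; apply/val_inj/funext. Qed.

Lemma bmfun_sumE (I : Type) (r : seq I) (P : pred I) (F : I -> B) x :
  (\sum_(i <- r | P i) F i) x = \sum_(i <- r | P i) F i x.
Proof. by elim/big_rec2: _ => // i y z _ <-. Qed.

Lemma Re_sum (I : Type) (r : seq I) (P : pred I) (F : I -> R[i]) :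
  complex.Re (\sum_(i <- r | P i) F i) = \sum_(i <- r | P i) complex.Re (F i).
Proof. by elim/big_rec2: _ => // i y z _ <-; case: (F i) z => [? ?] []. Qed.

Lemma Im_sum (I : Type) (r : seq I) (P : pred I) (F : I -> R[i]) :
  complex.Im (\sum_(i <- r | P i) F i) = \sum_(i <- r | P i) complex.Im (F i).
Proof. by elim/big_rec2: _ => // i y z _ <-; case: (F i) z => [? ?] []. Qed.

(** The limit is taken pointwise, so its measurability is that of a pointwise limit; treating real
    and imaginary parts separately costs the factor [2]. *)
Lemma bmfun_geometric_limit (u : nat -> B) (c r : R) :
  0 <= c -> 0 <= r < 1 -> (forall k, supnorm (u k) <= c * r ^+ k) ->
  exists s : B, forall n,
    supnorm (s - \sum_(k < n) u k) <= 2 * (c * r ^+ n / (1 - r)).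
Proof.
move=> c0 r01 ur.
have uRe x k : `|complex.Re (u k x)| <= c * r ^+ k.
  by rewrite (le_trans (Re_le_normc _))// (le_trans (supnorm_ub _ _)).
have uIm x k : `|complex.Im (u k x)| <= c * r ^+ k.
  by rewrite (le_trans (Im_le_normc _))// (le_trans (supnorm_ub _ _)).
have /choice[a aP] := fun x => geometric_limit c0 r01 (uRe x).
have /choice[b bP] := fun x => geometric_limit c0 r01 (uIm x).
have D0 n : 0 <= c * r ^+ n / (1 - r).
  have /andP[r0 r1] := r01.
  by rewrite divr_ge0 ?mulr_ge0 ?exprn_ge0// subr_ge0 ltW.
have close x n : normc (Complex (a x) (b x) - \sum_(k < n) u k x) <=
    2 * (c * r ^+ n / (1 - r)).
  rewrite (le_trans (normc_le_ReIm _))// mulr_natl mulr2n.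
  have := (aP x).2 n; have := (bP x).2 n.
  rewrite -Re_sum -Im_sum; case: (\sum_(k < n) u k x) => p q /= hb ha.
  exact: lerD.
have ms : bounded_measurable (fun x => Complex (a x) (b x)).
  split.
  - apply: (@measurable_fun_cvg _ _ _ _ (fun n x => \sum_(k < n) complex.Re (u k x))).
      move=> n; apply: measurable_sum => k; by have [] := bmfunP (u k).
    by move=> x _; have := (aP x).1; rewrite seriesEord.
  - apply: (@measurable_fun_cvg _ _ _ _ (fun n x => \sum_(k < n) complex.Im (u k x))).
      move=> n; apply: measurable_sum => k; by have [] := bmfunP (u k).
    by move=> x _; have := (bP x).1; rewrite seriesEord.
  - exists (2 * (c * r ^+ 0 / (1 - r))) => x.
    by have := close x 0%N; rewrite big_ord0 subr0.
exists (mk_bmfun ms) => n; apply: supnorm_le; first by rewrite mulr_ge0.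
move=> x.
have -> : (mk_bmfun ms - \sum_(k < n) u k) x = Complex (a x) (b x) - \sum_(k < n) u k x.
  by rewrite -bmfun_sumE.
exact: close.
Qed.

(** Neumann series with terms [z^-(k+1) P^k w]. The defect of its sum is at most a constant times
    [(q / |z|)^n] for every [n], and so vanishes. *)
Lemma bmfun_shift_surj (P : B -> B) (q : R) (z : R[i]) : linear P -> 0 <= q ->
  (forall f, rnorm (P f) <= q * rnorm f) -> q < normc z ->
  surj (fun f => z *: f - P f).
Proof.
move=> lP q0 Pq qz w; have z0 : 0 < normc z := le_lt_trans q0 qz.
have zn0 : z != 0.
  by apply: contraTN z0 => /eqP ->; rewrite Normc.normc0 ltxx.
pose r := q / normc z.
have r01 : 0 <= r < 1.
  by rewrite divr_ge0 ?(ltW z0)//= ltr_pdivrMr// mul1r.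
pose u k := z^-1 ^+ k.+1 *: iter k P w.
have Pk k : rnorm (iter k P w) <= q ^+ k * rnorm w.
  elim: k => [|k ih]; first by rewrite expr0 mul1r.
  by rewrite iterS (le_trans (Pq _))// exprS -mulrA ler_wpM2l.
have ur k : supnorm (u k) <= (normc z)^-1 * rnorm w * r ^+ k.
  rewrite -rnorm_supnorm rnormZ normcX Normc.normcV.
  have -> : (normc z)^-1 * rnorm w * r ^+ k =
      (normc z)^-1 ^+ k.+1 * (q ^+ k * rnorm w) by rewrite exprMn exprS; ring.
  by rewrite ler_wpM2l ?exprn_ge0 ?invr_ge0 ?(ltW z0).
have c0 : 0 <= (normc z)^-1 * rnorm w.
  by rewrite mulr_ge0 ?rnorm_ge0 ?invr_ge0 ?(ltW z0).
have [s sP] := bmfun_geometric_limit c0 r01 ur.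
have partial n : z *: (\sum_(k < n) u k) - P (\sum_(k < n) u k) =
    w - z^-1 ^+ n *: iter n P w.
  elim: n => [|n ih]; first by rewrite big_ord0 scaler0 (lin0 lP) expr0 scale1r !subrr.
  rewrite big_ord_recr/= scalerDr (linD lP) opprD addrACA ih /u (linZ lP).
  by rewrite scalerA (exprS z^-1 n) mulVKf// addrA subrK.
set c := (normc z)^-1 * rnorm w in c0 ur sP.
exists s; apply/eqP; rewrite -subr_eq0; apply/eqP/rnorm_eq0/eqP.
rewrite eq_le rnorm_ge0 andbT.
apply: (@le_geometric_le0 _ _ ((normc z + q) * (2 * (c / (1 - r))) + rnorm w) r r01).
move=> n; set sn := \sum_(k < n) u k in sP *.
have -> : z *: s - P s - w =
    (z *: (s - sn) - P (s - sn)) - z^-1 ^+ n *: iter n P w.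
  rewrite -[X in _ - X = _](subrK (z^-1 ^+ n *: iter n P w)) -partial -/sn.
  rewrite opprD addrA scalerBr (linB lP) !opprB; congr (_ - _).
  rewrite addrACA [RHS]addrACA; congr (_ + _); exact: addrC.
rewrite (le_trans (rnormB _ _))// mulrDl lerD//.
  rewrite (le_trans (rnormB _ _))// rnormZ -mulrA mulrDl.
  have -> : 2 * (c / (1 - r)) * r ^+ n = 2 * (c * r ^+ n / (1 - r)) by ring.
  rewrite lerD//; first by rewrite ler_wpM2l ?normc_ge0//; exact: sP.
  by rewrite (le_trans (Pq _))// ler_wpM2l//; exact: sP.
rewrite rnormZ normcX Normc.normcV mulrC.
rewrite (le_trans (ler_wpM2r _ (Pk n))) ?exprn_ge0 ?invr_ge0 ?(ltW z0)//.
by rewrite mulrAC mulrC -exprMn.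
Qed.

End bmfun_complete.

Section complex_integral_bounds.
Context d (T : measurableType d) (R : realType).
Implicit Types f g : T -> R[i].

Lemma measurable_normc f : bounded_measurable f ->
  measurable_fun [set: T] (fun x => normc (f x)).
Proof.
move=> [mR mI _].
rewrite (_ : (fun x => _) =
    Num.sqrt \o (fun x => complex.Re (f x) ^+ 2 + complex.Im (f x) ^+ 2)).
  apply: measurableT_comp.
    by apply: continuous_measurable_fun; exact: sqrt_continuous.
  by apply: measurable_funD; exact: measurable_funX.
by apply/funext => x /=; case: (f x).
Qed.

Lemma measurable_enormc f : bounded_measurable f ->
  measurable_fun [set: T] (fun x => (normc (f x))%:E).
Proof. by move=> bf; apply/measurable_EFinP/measurable_normc. Qed.

Lemma measurable_Rintegral_fker d' (X : measurableType d') (k : R.-fker X ~> T)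
    (f : X * T -> R) (M : R) :
  measurable_fun [set: X * T] f -> (forall z, `|f z| <= M) ->
  measurable_fun [set: X] (fun x => \int[k x]_y f (x, y)).
Proof.
move=> mf fM; apply: (measurableT_comp (fine_measurable measurableT)).
rewrite (_ : (fun x => _) = (fun x => \int[k x]_y ((EFin \o f)^\+ (x, y))
    - \int[k x]_y ((EFin \o f)^\- (x, y))))%E; last first.
  apply/funext => x; rewrite [LHS]integralE.
  by congr (_ - _)%E; apply: eq_integral => y _; rewrite ?funeposE ?funenegE.
apply: emeasurable_funB.
- apply: (measurable_fun_integral_finite_kernel ((EFin \o f)^\+)%E k) => //.
  exact/measurable_funepos/measurable_EFinP.
- apply: (measurable_fun_integral_finite_kernel ((EFin \o f)^\-)%E k) => //.
  exact/measurable_funeneg/measurable_EFinP.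
Qed.

Variable Q : R.-fker T ~> T.

Lemma normc_cintegral_le x f : bounded_measurable f ->
  ((normc (cintegral (Q x) f))%:E <= \int[Q x]_y (normc (f y))%:E)%E.
Proof.
move=> bf; set w := cintegral _ _.
have [w0|w0] := eqVneq w 0.
  rewrite w0 Normc.normc0 integral_ge0// => y _.
  by rewrite lee_fin normc_ge0.
have nw0 : 0 < normc w.
  by rewrite lt_def normc_ge0 andbT; apply: contra w0 => /eqP/Normc.eq0_normc ->.
(* the rotation [u] makes the integral real and nonnegative *)
pose u := (normc w)%:C%C / w.
have nu : normc u = 1.
  rewrite Normc.normcM Normc.normcV.
  by rewrite /= expr0n addr0 sqrtr_sqr ger0_norm ?normc_ge0// divff ?gt_eqF.
have buf : bounded_measurable (fun y => u * f y).
  by apply: bounded_measurableM => //; exact: bounded_measurable_cst.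
have uw : cintegral (Q x) (fun y => u * f y) = (normc w)%:C%C.
  (* Homogeneity is read off from linearity with scalar [u - 1] and second summand [f]. *)
  have := @cintegral_linear _ _ _ Q x (u - 1) f f bf bf.
  have -> : (fun y => (u - 1) * f y + f y) = (fun y => u * f y).
    by apply/funext => y; rewrite mulrBl mul1r subrK.
  by rewrite mulrBl mul1r subrK -/w /u divfK.
have -> : normc w = \int[Q x]_y complex.Re (u * f y).
  by have /(congr1 (@complex.Re _)) := uw.
have [mR mI [M fM]] := buf.
have iR : (Q x).-integrable setT (EFin \o (fun y => complex.Re (u * f y))).
  apply: (@bounded_integrable _ _ _ _ _ M) => //; first exact: kernelT_lty.
  by move=> y; exact: le_trans (Re_le_normc _) (fM y).
rewrite /Rintegral fineK; last exact: integrable_fin_num.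
rewrite (le_trans (lee_abs _))// (le_trans (le_abse_integral _ _ _))//.
  exact/measurable_EFinP.
apply: ge0_le_integral => //.
- exact/measurableT_comp/measurable_EFinP.
- exact: measurable_enormc.
- by move=> y _; rewrite lee_fin (le_trans (Re_le_normc _))// Normc.normcM nu mul1r.
Qed.

End complex_integral_bounds.

Section kernel_operator_bounds.
Context d (T : measurableType d) (R : realType).
Variables (Q : R.-fker T ~> T) (chi : bmfun (T * T)%type R).
Implicit Types f : bmfun T R.
Local Notation L := (kernel_mul_op Q chi).

Lemma normc_measurable f : measurable_fun [set: T] (fun x => (normc (f x))%:E).
Proof. exact/measurable_enormc/bmfunP. Qed.

Lemma kernel_mul_op_le f x :
  ((normc (L f x))%:E <= (supnorm chi)%:E * \int[Q x]_y (normc (f y))%:E)%E.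
Proof.
rewrite (le_trans (normc_cintegral_le _ _ _))//.
  apply: bounded_measurableM; first exact: bmfunP.
  have [mR mI [M chiM]] := bmfunP chi; split.
  - exact: (measurableT_comp mR (pair1_measurable x)).
  - exact: (measurableT_comp mI (pair1_measurable x)).
  - by exists M => y.
rewrite -ge0_integralZl_EFin ?supnorm_ge0//; last 2 first.
- by move=> y _; rewrite lee_fin normc_ge0.
- exact: normc_measurable.
apply: ge0_le_integral => //.
- by move=> y _; rewrite lee_fin normc_ge0.
- apply: measurable_enormc; apply: bounded_measurableM; first exact: bmfunP.
  have [mR mI [M chiM]] := bmfunP chi; split.
  - exact: (measurableT_comp mR (pair1_measurable x)).
  - exact: (measurableT_comp mI (pair1_measurable x)).
  - by exists M => y.
- by apply: measurable_funeM; exact: normc_measurable.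
- move=> y _; rewrite -EFinM lee_fin Normc.normcM mulrC ler_wpM2r ?normc_ge0//.
  exact: supnorm_ub.
Qed.

Lemma integral_kernel_comp (k1 k2 : R.-fker T ~> T) x (f : T -> \bar R) :
  (forall y, 0 <= f y)%E -> measurable_fun [set: T] f ->
  (\int[kernel_comp k1 k2 x]_y f y = \int[k1 x]_z \int[k2 z]_y f y)%E.
Proof. by move=> f0 mf; rewrite (@integral_kcomp _ _ _ _ _ _ _ k1 (ksnd k2)). Qed.

Lemma measurable_integral_kernel (k : R.-fker T ~> T) (f : T -> \bar R) :
  (forall y, 0 <= f y)%E -> measurable_fun [set: T] f ->
  measurable_fun [set: T] (fun x => \int[k x]_y f y)%E.
Proof.
move=> f0 mf.
apply: (measurable_fun_integral_finite_kernel (fun z : T * T => f z.2) k) => //.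
exact: measurableT_comp mf measurable_snd.
Qed.

(** Estimates on the complex operator pass through this domination by the positive kernel [Q^l]. The
    integral is kept in the extended reals, where kernels compose and monotonicity holds for all
    nonnegative measurable functions. *)
Lemma iter_kernel_mul_op_le l f x : ((normc (iter l L f x))%:E <=
  (supnorm chi ^+ l)%:E * \int[kernel_pow Q l x]_y (normc (f y))%:E)%E.
Proof.
elim: l x => [|l ih] x.
  by rewrite expr0 mul1e integral_dirac ?diracT ?mul1e//=; exact: normc_measurable.
have n0 y : (0 <= (normc (f y))%:E)%E by rewrite lee_fin normc_ge0.
have mn := normc_measurable f.
rewrite iterS (le_trans (kernel_mul_op_le _ _))// exprS EFinM -muleA.
rewrite lee_wpmul2l ?lee_fin ?supnorm_ge0//= integral_kernel_comp//.
have s0 : 0 <= supnorm chi ^+ l by rewrite exprn_ge0 ?supnorm_ge0.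
rewrite -ge0_integralZl_EFin//; last 2 first.
- by move=> z _; exact: integral_ge0.
- exact: measurable_integral_kernel.
apply: ge0_le_integral => //.
- by move=> y _; rewrite lee_fin normc_ge0.
- exact: normc_measurable.
- by apply: measurable_funeM; exact: measurable_integral_kernel.
Qed.

End kernel_operator_bounds.

(** * Cutting an iterated complex kernel along a measurable subset of the square *)

Section kernel_cut.
Context d (T : measurableType d) (R : realType).
Variables (Q : R.-fker T ~> T) (chi : bmfun (T * T)%type R).
Implicit Types (f g : bmfun T R) (phi : bmfun (T * T)%type R) (G : set (T * T)).
Local Notation L := (kernel_mul_op Q chi).

Lemma fker_bound (k : R.-fker T ~> T) :
  exists2 c : R, 0 <= c & forall x, (k x setT <= c%:E)%E.
Proof.
have [c kc] := measure_uub k; exists (Num.max 0 c); first by rewrite le_max lexx.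
by move=> x; rewrite (le_trans (ltW (kc x)))// lee_fin le_max lexx orbT.
Qed.

Lemma integral_normc_le (mu : {measure set T -> \bar R}) f :
  (\int[mu]_y (normc (f y))%:E <= (supnorm f)%:E * mu setT)%E.
Proof.
rewrite -integral_cst//; apply: ge0_le_integral => //.
- by move=> y _; rewrite lee_fin normc_ge0.
- exact: normc_measurable.
- by move=> y _; rewrite lee_fin supnorm_ub.
Qed.

Lemma kernel_mul_op_bounded : bounded_op L.
Proof.
split; first exact: linearP.
have [c c0 Qc] := fker_bound Q.
exists (supnorm chi * c); first by rewrite mulr_ge0 ?supnorm_ge0.
move=> f; rewrite !rnorm_supnorm; apply: supnorm_le => [|x].
  by rewrite !mulr_ge0 ?supnorm_ge0.
rewrite -lee_fin (le_trans (kernel_mul_op_le _ _ _ _))// -mulrA EFinM.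
rewrite lee_wpmul2l ?lee_fin ?supnorm_ge0// (le_trans (integral_normc_le _ _))//.
by rewrite EFinM muleC lee_wpmul2r ?lee_fin ?supnorm_ge0.
Qed.

Lemma bounded_measurable_section phi z : bounded_measurable (fun y => phi (z, y)).
Proof.
have [mR mI [M phiM]] := bmfunP phi; split.
- exact: (measurableT_comp mR (pair1_measurable z)).
- exact: (measurableT_comp mI (pair1_measurable z)).
- by exists M => y.
Qed.

Definition bmsection phi z : bmfun T R := mk_bmfun (bounded_measurable_section phi z).

Lemma supnorm_section phi z : supnorm (bmsection phi z) <= supnorm phi.
Proof.
apply: supnorm_le; first exact: supnorm_ge0.
by move=> y; exact: (supnorm_ub phi (z, y)).
Qed.

Lemma bounded_measurable_op_section phi :
  bounded_measurable (fun p : T * T => L (bmsection phi p.1) p.2).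
Proof.
pose h (w : (T * T) * T) := phi (w.1.1, w.2) * chi (w.1.2, w.2).
have bh : bounded_measurable h.
  apply: bounded_measurableM.
    have [mR mI [M phiM]] := bmfunP phi.
    have m : measurable_fun [set: (T * T) * T] (fun w => (w.1.1, w.2)).
      apply/measurable_fun_pairP; split; last exact: measurable_snd.
      exact: measurableT_comp measurable_fst measurable_fst.
    by split; [exact: (measurableT_comp mR m)|exact: (measurableT_comp mI m)|
      by exists M => w].
  have [mR mI [M chiM]] := bmfunP chi.
  have m : measurable_fun [set: (T * T) * T] (fun w => (w.1.2, w.2)).
    apply/measurable_fun_pairP; split; last exact: measurable_snd.
    exact: measurableT_comp measurable_snd measurable_fst.
  by split; [exact: (measurableT_comp mR m)|exact: (measurableT_comp mI m)|
    by exists M => w].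
have [mR mI [M hM]] := bh; split.
- apply: (measurable_Rintegral_fker (ksnd Q) mR (M := M)) => w.
  exact: le_trans (Re_le_normc _) (hM w).
- apply: (measurable_Rintegral_fker (ksnd Q) mI (M := M)) => w.
  exact: le_trans (Im_le_normc _) (hM w).
- have [_ [c c0 Lc]] := kernel_mul_op_bounded.
  exists (c * supnorm phi) => p; rewrite (le_trans (supnorm_ub _ _))//.
  by rewrite (le_trans (Lc _))// ler_wpM2l// supnorm_section.
Qed.

(** The complex kernel of [L^l] is never constructed. To integrate against it a function that varies
    with the base point [x], the variable is doubled: [L^l] acts on the section at [z], measurably
    in both points, and [z = x] is set afterwards. *)
Lemma bounded_measurable_iter_section l phi :
  bounded_measurable (fun p : T * T => iter l L (bmsection phi p.1) p.2).
Proof.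
elim: l phi => [|l ih] phi.
  have -> : (fun p : T * T => iter 0 L (bmsection phi p.1) p.2) = phi.
    by apply/funext => -[].
  exact: bmfunP.
have := ih (mk_bmfun (bounded_measurable_op_section phi)).
have E z : bmsection (mk_bmfun (bounded_measurable_op_section phi)) z =
    L (bmsection phi z) by exact: bmfun_ext.
by under eq_fun do rewrite E -iterSr.
Qed.

Lemma bounded_measurable_diag phi : bounded_measurable (fun x => phi (x, x)).
Proof.
have [mR mI [M phiM]] := bmfunP phi.
have m : measurable_fun [set: T] (fun x => (x, x)).
  by apply/measurable_fun_pairP; split; exact: measurable_id.
by split; [exact: (measurableT_comp mR m)|exact: (measurableT_comp mI m)|by exists M => w].
Qed.

Lemma bounded_measurable_restrict G f : measurable G ->
  bounded_measurable (fun p : T * T => (\1_G p)%:C%C * f p.2).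
Proof.
move=> mG; apply: bounded_measurableM.
  split=> /=; first exact: measurable_indic.
    exact: measurable_cst.
  by exists 1 => p; rewrite /= expr0n addr0 sqrtr_sqr ger0_norm//.
have [mR mI [M fM]] := bmfunP f; split; last by exists M => p.
- exact: measurableT_comp mR measurable_snd.
- exact: measurableT_comp mI measurable_snd.
Qed.

Definition restrict2 G (mG : measurable G) f : bmfun (T * T)%type R :=
  mk_bmfun (bounded_measurable_restrict f mG).

(* [f] |-> [x |-> \int_(y in G_x) f(y) L^l(x, dy)], where [G_x] is the section of
   [G] at [x] and [L^l(x, dy)] is the complex kernel of the [l]-th iterate. *)
Definition cut_op l G (mG : measurable G) f : bmfun T R :=
  mk_bmfun (bounded_measurable_diag
    (mk_bmfun (bounded_measurable_iter_section l (restrict2 mG f)))).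

Lemma cut_opE l G (mG : measurable G) f x :
  cut_op l mG f x = iter l L (bmsection (restrict2 mG f) x) x.
Proof. by []. Qed.

Lemma iter_kernel_linear l : linear (iter l L).
Proof. exact: (iter_bounded kernel_mul_op_bounded l).1. Qed.

Lemma cut_op_linear l G (mG : measurable G) : linear (cut_op l mG).
Proof.
move=> a f g; apply: bmfun_ext => x; rewrite cut_opE.
have -> : bmsection (restrict2 mG (a *: f + g)) x =
    a *: bmsection (restrict2 mG f) x + bmsection (restrict2 mG g) x.
  apply: bmfun_ext => y /=.
  rewrite [LHS](_ : _ = (\1_G (x, y))%:C%C * (a * f y + g y))//.
  by rewrite mulrDr mulrCA.
by rewrite iter_kernel_linear.
Qed.

Lemma cut_op_setC l G (mG : measurable G) f :
  iter l L f = cut_op l mG f + cut_op l (measurableC mG) f.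
Proof.
apply: bmfun_ext => x.
rewrite [RHS](_ : _ = iter l L (bmsection (restrict2 mG f) x) x +
  iter l L (bmsection (restrict2 (measurableC mG) f) x) x)//.
rewrite -[RHS](_ : (iter l L (bmsection (restrict2 mG f) x) +
  iter l L (bmsection (restrict2 (measurableC mG) f) x)) x = _)//.
rewrite -(linD (@iter_kernel_linear l)); congr (iter l L _ x).
apply: bmfun_ext => y.
rewrite [RHS](_ : _ = (\1_G (x, y))%:C%C * f y + (\1_(~` G) (x, y))%:C%C * f y)//.
rewrite -mulrDl -rmorphD/= !indicE in_setC.
by case: (_ \in _); rewrite /= ?addr0 ?add0r rmorph1 mul1r.
Qed.

Lemma cut_op_le l G (mG : measurable G) f x :
  ((normc (cut_op l mG f x))%:E <= (supnorm chi ^+ l)%:E *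
    \int[kernel_pow Q l x]_(y in xsection G x) (normc (f y))%:E)%E.
Proof.
rewrite cut_opE (le_trans (iter_kernel_mul_op_le _ _ _ _ _))//.
rewrite lee_wpmul2l ?lee_fin ?exprn_ge0 ?supnorm_ge0//.
rewrite [leRHS]integral_mkcond le_eqVlt; apply/orP; left; apply/eqP.
apply: eq_integral => y _; rewrite patchE mem_xsection.
rewrite (_ : bmsection _ _ y = (\1_G (x, y))%:C%C * f y)// Normc.normcM indicE.
rewrite /= expr0n addr0 sqrtr_sqr ger0_norm//.
by case: (_ \in _); rewrite ?mul1r ?mul0r.
Qed.

End kernel_cut.

(** * Finite-rank approximation of operators with a bounded density *)

(** Pythagoras in weighted [L^2]: for nonnegative weights, the densities [a_j / p_j] have mean
    [(sum a) / (sum p)], and the left side is their unnormalized variance. The hypothesis makes null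
    indices contribute nothing, division by zero being zero. *)
Lemma weighted_variance (R : realType) (J : finType) (a p : J -> R) :
  (forall j, p j = 0 -> a j = 0) ->
  \sum_j (a j - p j / (\sum_k p k) * \sum_k a k) ^+ 2 / p j =
  \sum_j a j ^+ 2 / p j - (\sum_k a k) ^+ 2 / \sum_k p k.
Proof.
move=> ap; set s := \sum_k a k; set q := \sum_k p k.
have -> : \sum_j (a j - p j / q * s) ^+ 2 / p j =
    \sum_j (a j ^+ 2 / p j - a j * (2 * s / q) + p j * (s / q) ^+ 2).
  apply: eq_bigr => j _; have [pj0|pj0] := eqVneq (p j) 0.
    by rewrite pj0 (ap j pj0) invr0; ring.
  have [->|q0] := eqVneq q 0; first by rewrite invr0; ring.
  by field; rewrite pj0 q0.
rewrite big_split/= sumrB -!mulr_suml -/s -/q -addrA; congr (_ + _).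
have [->|q0] := eqVneq q 0; first by rewrite invr0; ring.
by field.
Qed.

Lemma normc_sqr (R : realType) (z : R[i]) :
  normc z ^+ 2 = complex.Re z ^+ 2 + complex.Im z ^+ 2.
Proof. by case: z => a b /=; rewrite sqr_sqrtr// addr_ge0 ?sqr_ge0. Qed.

Lemma weighted_variance_complex (R : realType) (J : finType) (a : J -> R[i])
    (p : J -> R) : (forall j, p j = 0 -> a j = 0) ->
  \sum_j normc (a j - (p j / (\sum_k p k))%:C%C * \sum_k a k) ^+ 2 / p j =
  \sum_j normc (a j) ^+ 2 / p j - normc (\sum_k a k) ^+ 2 / \sum_k p k.
Proof.
move=> ap; set q := \sum_k p k.
have ReE j : complex.Re (a j - (p j / q)%:C%C * \sum_k a k) =
    complex.Re (a j) - p j / q * \sum_k complex.Re (a k).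
  by rewrite -Re_sum; case: (a j) (\sum_k a k) => [? ?] [? ?] /=; ring.
have ImE j : complex.Im (a j - (p j / q)%:C%C * \sum_k a k) =
    complex.Im (a j) - p j / q * \sum_k complex.Im (a k).
  by rewrite -Im_sum; case: (a j) (\sum_k a k) => [? ?] [? ?] /=; ring.
under eq_bigr do rewrite normc_sqr ReE ImE mulrDl.
rewrite big_split/= !weighted_variance; last 2 first.
- by move=> j /ap ->.
- by move=> j /ap ->.
rewrite -Re_sum -Im_sum normc_sqr [in RHS]mulrDl.
under [in RHS]eq_bigr do rewrite normc_sqr mulrDl.
by rewrite [in RHS]big_split/=; ring.
Qed.

Section finite_partitions.
Context d (T : measurableType d) (R : realType).
Variables (k : R.-fker T ~> T) (x0 : T).
Local Notation mu := (k x0).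
Implicit Types (f g : bmfun T R) (I J : finType).

Lemma in_fiber I (p : T -> I) i x : (x \in p @^-1` [set i]) = (p x == i).
Proof. by apply/idP/eqP => [/set_mem|h]; last exact/mem_set. Qed.

(** A finite partition is coded by a map to a finite type, so that a common refinement is a pair of
    maps. The reference measure is a value [k x0] of a kernel, which makes the estimates for
    [cintegral] along a kernel available. *)
Definition measurable_cells I (p : T -> I) :=
  forall i, measurable (p @^-1` [set i]).

Lemma measurable_cells_pair I J (p : T -> I) (p' : T -> J) :
  measurable_cells p -> measurable_cells p' ->
  measurable_cells (fun x => (p x, p' x)).
Proof.
move=> mp mp' [i j].
rewrite (_ : _ @^-1` _ = p @^-1` [set i] `&` p' @^-1` [set j]).
  exact: measurableI.
by apply/seteqP; split=> x /= => [[]|[-> ->]].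
Qed.

Lemma bounded_measurable_cell I (p : T -> I) : measurable_cells p -> forall i,
  bounded_measurable (fun x => ((p x == i)%:R : R)%:C%C).
Proof.
move=> mp i; split=> /=.
- rewrite (_ : (fun x => _) = \1_(p @^-1` [set i])); first exact: measurable_indic.
  by apply/funext => x; rewrite indicE in_fiber.
- exact: measurable_cst.
- exists 1 => x; rewrite /= expr0n addr0 sqrtr_sqr ger0_norm//.
  by rewrite lern1 leq_b1.
Qed.

Definition cell I (p : T -> I) (mp : measurable_cells p) i : bmfun T R :=
  mk_bmfun (bounded_measurable_cell mp i).

Definition weight I (p : T -> I) i : R := fine (mu (p @^-1` [set i])).

Lemma cellE I (p : T -> I) (mp : measurable_cells p) i x :
  cell mp i x = ((p x == i)%:R)%:C%C.
Proof. by []. Qed.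

Lemma mu_fin_num (A : set T) : measurable A -> mu A \is a fin_num.
Proof.
move=> mA; rewrite ge0_fin_numE// (le_lt_trans _ (kernelT_lty k x0))//.
by rewrite le_measure ?inE.
Qed.

Lemma weight_ge0 I (p : T -> I) i : 0 <= weight p i.
Proof. exact: fine_ge0. Qed.

Lemma weightK I (p : T -> I) i : measurable_cells p ->
  (weight p i)%:E = mu (p @^-1` [set i]).
Proof. by move=> mp; rewrite fineK// mu_fin_num. Qed.

Lemma measure_cells I (p : T -> I) (A : set T) : measurable_cells p ->
  measurable A -> (mu A = \sum_i mu (A `&` p @^-1` [set i]))%E.
Proof.
move=> mp mA.
have mAi i : measurable (A `&` p @^-1` [set i]) by exact: measurableI.
transitivity (\int[mu]_x (\sum_i (\1_(A `&` p @^-1` [set i]) x)%:E))%E; last first.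
  rewrite ge0_integral_sum//.
  - by apply: eq_bigr => i _; rewrite integral_indic// setIT.
  - by move=> i; apply/measurable_EFinP; exact: measurable_indic.
rewrite -[in LHS](setIT A) -integral_indic//; apply: eq_integral => x _.
rewrite sumEFin; congr (_%:E); rewrite (bigD1 (p x))//= big1 ?addr0.
  by rewrite !indicE in_setI in_fiber eqxx andbT.
by move=> i ip; rewrite indicE in_setI in_fiber eq_sym (negbTE ip) andbF.
Qed.

Lemma weight_sum I (p : T -> I) : measurable_cells p ->
  \sum_i weight p i = fine (mu setT).
Proof.
move=> mp; apply: EFin_inj; rewrite fineK ?mu_fin_num//.
rewrite (measure_cells mp)// -sumEFin; apply: eq_bigr => i _.
by rewrite setTI weightK.
Qed.

Lemma weight_refine I J (p : T -> I) (p' : T -> J) : measurable_cells p ->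
  measurable_cells p' ->
  forall i, weight p i = \sum_j weight (fun x => (p x, p' x)) (i, j).
Proof.
move=> mp mp' i; apply: EFin_inj; rewrite weightK// (measure_cells mp')//.
rewrite -sumEFin; apply: eq_bigr => j _; rewrite weightK; last exact: measurable_cells_pair.
congr (mu _); by apply/seteqP; split=> x /= => [[-> ->]|[]].
Qed.

Lemma cell_refine I J (p : T -> I) (p' : T -> J) (mp : measurable_cells p)
    (mp' : measurable_cells p') i :
  cell mp i = \sum_j cell (measurable_cells_pair mp mp') (i, j).
Proof.
apply: bmfun_ext => x; rewrite bmfun_sumE (bigD1 (p' x))//= big1 ?addr0.
  by rewrite xpair_eqE eqxx andbT.
by move=> j jp; rewrite xpair_eqE [_ == j]eq_sym (negbTE jp) andbF.
Qed.

(* On a null cell the average is [0], because [0^-1 = 0]. *)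
Definition average I (p : T -> I) (mp : measurable_cells p) i f : R[i] :=
  ((weight p i)^-1)%:C%C * cintegral mu (fun y => cell mp i y * f y).

Lemma average_scalar I (p : T -> I) (mp : measurable_cells p) i :
  scalar (average mp i).
Proof.
move=> a f g; rewrite /average mulrCA -mulrDr; congr (_ * _).
rewrite -cintegral_linear; last 2 first.
- by apply: bounded_measurableM; exact: bmfunP.
- by apply: bounded_measurableM; exact: bmfunP.
congr cintegral; apply/funext => y; rewrite mulrCA -mulrDr.
by rewrite [in LHS](_ : (a *: f + g) y = a * f y + g y).
Qed.

Lemma integral_cell I (p : T -> I) (mp : measurable_cells p) i :
  (\int[mu]_y (normc (cell mp i y))%:E = (weight p i)%:E)%E.
Proof.
have mpi := mp i; rewrite weightK// -[in RHS](setIT (_ @^-1` _)) -integral_indic//.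
apply: eq_integral => y _; congr (_%:E).
by rewrite /= expr0n addr0 sqrtr_sqr ger0_norm// indicE in_fiber.
Qed.

Lemma average_le I (p : T -> I) (mp : measurable_cells p) i f :
  normc (average mp i f) <= supnorm f.
Proof.
have wi := weight_ge0 p i.
rewrite Normc.normcM /= expr0n addr0 sqrtr_sqr ger0_norm ?invr_ge0//.
have [->|w0] := eqVneq (weight p i) 0; first by rewrite invr0 mul0r supnorm_ge0.
rewrite ler_pdivrMl ?lt_def ?w0//.
have bm : bounded_measurable (fun y => cell mp i y * f y).
  by apply: bounded_measurableM; exact: bmfunP.
rewrite -lee_fin (le_trans (normc_cintegral_le _ _ _))//.
rewrite mulrC EFinM -(integral_cell mp) -ge0_integralZl_EFin ?supnorm_ge0//.
- apply: ge0_le_integral => //.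
  + by move=> y _; rewrite lee_fin normc_ge0.
  + exact: measurable_enormc.
  + by apply: measurable_funeM; exact: normc_measurable.
  + move=> y _; rewrite -EFinM lee_fin Normc.normcM mulrC.
    by rewrite ler_wpM2r ?normc_ge0// supnorm_ub.
- by move=> y _; rewrite lee_fin normc_ge0.
- exact: normc_measurable.
Qed.

Lemma average_form I (p : T -> I) (mp : measurable_cells p) i :
  bounded_form (average mp i).
Proof.
split; first exact: average_scalar.
by exists 1 => // f; rewrite mul1r; exact: average_le.
Qed.

Definition cond_exp I (p : T -> I) (mp : measurable_cells p) f : bmfun T R :=
  \sum_i average mp i f *: cell mp i.

Lemma cond_expE I (p : T -> I) (mp : measurable_cells p) f x :
  cond_exp mp f x = average mp (p x) f.
Proof.
rewrite /cond_exp bmfun_sumE (bigD1 (p x))//= big1 ?addr0.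
  by rewrite [LHS](_ : _ = average mp (p x) f * cell mp (p x) x)// cellE eqxx mulr1.
move=> i ip; rewrite [LHS](_ : _ = average mp i f * cell mp i x)//.
by rewrite cellE eq_sym (negbTE ip) mulr0.
Qed.

Lemma cond_exp_le I (p : T -> I) (mp : measurable_cells p) f :
  supnorm (cond_exp mp f) <= supnorm f.
Proof.
apply: supnorm_le; first exact: supnorm_ge0.
by move=> x; rewrite cond_expE average_le.
Qed.

Lemma finite_rank_cond_exp I (p : T -> I) (mp : measurable_cells p) :
  finite_rank (cond_exp mp).
Proof.
apply: finite_rank_sum => i.
exists 1%N, (fun=> average mp i), (fun=> cell mp i); split.
  by move=> _; exact: average_form.
by move=> f; rewrite big_ord1.
Qed.

End finite_partitions.

Section bounded_density.
Context d (T : measurableType d) (R : realType).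
Variables (k : R.-fker T ~> T) (x0 : T).
Local Notation mu := (k x0).
Variables (W : bmfun T R -> bmfun T R) (cW C : R).
Local Notation cell := (@cell d T R _ _).
Hypotheses (W_lin : linear W) (cW0 : 0 <= cW)
  (W_le : forall f, supnorm (W f) <= cW * supnorm f) (C0 : 0 <= C).
Hypothesis W_density : forall A, measurable A -> forall f : bmfun T R,
  (forall x, f x = (\1_A x)%:C%C) ->
  {ae mu, forall x, normc (W f x) <= C * fine (mu A)}.
Implicit Types (f g : bmfun T R) (I J : finType).

Let M := fine (mu setT).

Let M0 : 0 <= M. Proof. exact: fine_ge0. Qed.

Let ae_cells I (p : T -> I) (mp : measurable_cells p) :
  {ae mu, forall x, forall i, normc (W (cell mp i) x) <= C * weight k x0 p i}.
Proof.
apply: filter_forall => i; apply: W_density; first exact: mp.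
by move=> x; rewrite cellE indicE in_fiber.
Qed.

(** If [W] has density [w(x, y)], this is the squared [L^2(mu)] norm of the conditional expectation
    of [w(x, .)] on the partition; its integral is the squared Hilbert-Schmidt norm of [W] composed
    with the averaging. *)
Definition energy I (p : T -> I) (mp : measurable_cells p) x : R :=
  \sum_i normc (W (cell mp i) x) ^+ 2 / weight k x0 p i.

(** The squared [L^2(mu)] distance between the conditional expectations of the density on the
    refined and on the initial partition. *)
Definition energy_gap I J (p : T -> I) (p' : T -> J) (mp : measurable_cells p)
    (mp' : measurable_cells p') x : R :=
  let mpp := measurable_cells_pair mp mp' in
  \sum_(ij : I * J) normc (W (cell mpp ij) x -
    (weight k x0 (fun x => (p x, p' x)) ij / weight k x0 p ij.1)%:C%C *
      W (cell mp ij.1) x) ^+ 2 / weight k x0 (fun x => (p x, p' x)) ij.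

Lemma energy_ge0 I (p : T -> I) (mp : measurable_cells p) x : 0 <= energy mp x.
Proof.
by apply: sumr_ge0 => i _; rewrite divr_ge0 ?sqr_ge0//; exact: weight_ge0.
Qed.

Lemma energy_gap_ge0 I J (p : T -> I) (p' : T -> J) (mp : measurable_cells p)
  (mp' : measurable_cells p') x : 0 <= energy_gap mp mp' x.
Proof.
by apply: sumr_ge0 => i _; rewrite divr_ge0 ?sqr_ge0//; exact: weight_ge0.
Qed.

Lemma measurable_energy I (p : T -> I) (mp : measurable_cells p) :
  measurable_fun [set: T] (energy mp).
Proof.
apply: measurable_sum => i; apply: measurable_funM => //; apply: measurable_funX.
exact/measurable_normc/bmfunP.
Qed.

Lemma measurable_energy_gap I J (p : T -> I) (p' : T -> J)
    (mp : measurable_cells p) (mp' : measurable_cells p') :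
  measurable_fun [set: T] (energy_gap mp mp').
Proof.
apply: measurable_sum => ij; apply: measurable_funM => //; apply: measurable_funX.
set c := (weight _ _ _ _ / _)%:C%C.
apply: (@measurable_normc _ _ _
  (W (cell (measurable_cells_pair mp mp') ij) - c *: W (cell mp ij.1))).
exact: bmfunP.
Qed.

(** [weighted_variance_complex] within each cell of [p]. Equality is almost everywhere because the
    density bound makes [W] of a null cell vanish only almost everywhere. *)
Lemma energy_refine I J (p : T -> I) (p' : T -> J) (mp : measurable_cells p)
    (mp' : measurable_cells p') :
  {ae mu, forall x, energy (measurable_cells_pair mp mp') x =
    energy mp x + energy_gap mp mp' x}.
Proof.
apply: filterS (ae_cells (measurable_cells_pair mp mp')) => x dx.
rewrite /energy_gap /energy.
pose a i j := W (cell (measurable_cells_pair mp mp') (i, j)) x.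
pose w i j := weight k x0 (fun x => (p x, p' x)) (i, j).
have sum_pair (F : I * J -> R) : \sum_ij F ij = \sum_i \sum_j F (i, j).
  by rewrite pair_bigA/=; apply: eq_bigr => -[].
rewrite !sum_pair/=.
rewrite -big_split/=; apply: eq_bigr => i _.
have -> : weight k x0 p i = \sum_j w i j by exact: weight_refine.
have -> : W (cell mp i) x = \sum_j a i j.
  by rewrite (cell_refine R mp mp') (lin_sum W_lin) bmfun_sumE.
rewrite weighted_variance_complex ?subrKC// => j wij.
apply: Normc.eq0_normc; apply/eqP; rewrite eq_le normc_ge0 andbT.
have : w i j = 0 by exact: wij.
by move=> wij0; have := dx (i, j); rewrite -/(w i j) wij0 mulr0.
Qed.

Lemma energy_le I (p : T -> I) (mp : measurable_cells p) :
  (\int[mu]_x (energy mp x)%:E <= (C ^+ 2 * M * M)%:E)%E.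
Proof.
rewrite EFinM [X in (_ <= _ * X)%E]fineK; last exact: mu_fin_num.
rewrite -integral_cst//; apply: ae_ge0_le_integral => //.
- by move=> x _; rewrite lee_fin energy_ge0.
- exact/measurable_EFinP/measurable_energy.
- by move=> x _; rewrite lee_fin mulr_ge0// exprn_ge0.
- apply: filterS (ae_cells mp) => x dx _; rewrite lee_fin.
  rewrite /M -(weight_sum _ _ mp) mulr_sumr ler_sum// => i _.
  have [->|w0] := eqVneq (weight k x0 p i) 0; first by rewrite invr0 !mulr0.
  rewrite ler_pdivrMr ?lt_def ?w0 ?weight_ge0//.
  rewrite -mulrA -expr2 -exprMn lerXn2r ?nnegrE ?normc_ge0//.
  by rewrite mulr_ge0 ?weight_ge0.
Qed.

(** Energies are bounded independently of the partition, so some partition comes within [e] of their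
    supremum, and by [energy_refine] no refinement can add more. *)
Lemma near_maximal_partition (e : R) : 0 < e ->
  exists I (p : T -> I) (mp : measurable_cells p),
  forall J (p' : T -> J) (mp' : measurable_cells p'),
    (\int[mu]_x (energy_gap mp mp' x)%:E <= e%:E)%E.
Proof.
move=> e0.
pose S := [set u : \bar R | exists I (p : T -> I) (mp : measurable_cells p),
  u = (\int[mu]_x (energy mp x)%:E)%E].
have Sub : (ereal_sup S <= (C ^+ 2 * M * M)%:E)%E.
  by apply: ge_ereal_sup => _ [I [p [mp ->]]]; exact: energy_le.
have m1 : measurable_cells (fun _ : T => tt).
  by move=> []; rewrite (_ : _ @^-1` _ = setT)//; apply/seteqP; split.
have Sfin : ereal_sup S \is a fin_num.
  rewrite ge0_fin_numE ?(le_lt_trans Sub) ?ltry//.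
  apply: (@le_trans _ _ (\int[mu]_x (energy m1 x)%:E)%E).
    by apply: integral_ge0 => x _; rewrite lee_fin energy_ge0.
  by apply: ereal_sup_ubound; exists unit, (fun=> tt), m1.
have [_ [I [p [mp ->]]] Ip] := ub_ereal_sup_adherent e0 Sfin.
exists I, p, mp => J p' mp'.
have : (\int[mu]_x (energy (measurable_cells_pair mp mp') x)%:E <= ereal_sup S)%E.
  by apply: ereal_sup_ubound; eexists _, _, _; reflexivity.
have -> : (\int[mu]_x (energy (measurable_cells_pair mp mp') x)%:E =
    \int[mu]_x ((energy mp x)%:E + (energy_gap mp mp' x)%:E))%E.
  apply: ge0_ae_eq_integral => //.
  - exact/measurable_EFinP/measurable_energy.
  - by apply: emeasurable_funD; apply/measurable_EFinP;
      [exact: measurable_energy|exact: measurable_energy_gap].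
  - by move=> x _; rewrite lee_fin energy_ge0.
  - by move=> x _; rewrite adde_ge0// lee_fin ?energy_ge0 ?energy_gap_ge0.
  - by apply: filterS (energy_refine mp mp') => x -> _.
rewrite ge0_integralD//; last 4 first.
- by move=> x _; rewrite lee_fin energy_ge0.
- exact/measurable_EFinP/measurable_energy.
- by move=> x _; rewrite lee_fin energy_gap_ge0.
- exact/measurable_EFinP/measurable_energy_gap.
have Efin : (\int[mu]_x (energy mp x)%:E)%E \is a fin_num.
  rewrite ge0_fin_numE ?(le_lt_trans (energy_le mp)) ?ltry//.
  by apply: integral_ge0 => x _; rewrite lee_fin energy_ge0.
rewrite addeC -leeBrDr// => /le_trans; apply.
by rewrite leeBlDl// -leeBlDr// ltW.
Qed.

Lemma simple_approximation f (h : R) : 0 < h ->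
  exists J (p : T -> J) (mp : measurable_cells p) (c : J -> R[i]),
    (forall j, normc (c j) <= supnorm f) /\
    supnorm (f - \sum_j c j *: cell mp j) <= h.
Proof.
move=> h0; pose B := supnorm f; pose h' := h / 2.
have h'0 : 0 < h' by rewrite divr_gt0.
have [mR mI _] := bmfunP f.
have mcell (g : T -> R) : measurable_fun [set: T] g -> (forall x, `|g x| <= B) ->
    measurable_cells (fun x => grid_cell B h' (g x)).
  move=> mg gB i.
  pose n x : R := (Num.truncn ((g x + B) / h'))%:R.
  have mn : measurable_fun [set: T] n.
    have mt : measurable_fun [set: R] (fun t : R => (Num.truncn ((t + B) / h'))%:R : R).
      apply: nondecreasing_measurable => // s t st.
      by rewrite ler_nat le_truncn// ler_pM2r ?invr_gt0// lerD2r.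
    exact: (measurableT_comp mt mg).
  rewrite (_ : _ @^-1` _ = n @^-1` [set (i : nat)%:R]).
    by rewrite -[X in measurable X]setTI; exact: mn.
  apply/seteqP; split=> x /=.
    move=> <-; rewrite /n /grid_cell inordK// ltnS; apply: le_truncn.
    by rewrite ler_pM2r ?invr_gt0// lerD2r (le_trans (ler_norm _)).
  move=> /eqP; rewrite eqr_nat => /eqP ni; apply/val_inj => /=.
  by rewrite /grid_cell ni inord_val.
have RB x : `|complex.Re (f x)| <= B.
  exact: le_trans (Re_le_normc _) (supnorm_ub _ _).
have IB x : `|complex.Im (f x)| <= B.
  exact: le_trans (Im_le_normc _) (supnorm_ub _ _).
have mp := measurable_cells_pair (mcell _ mR RB) (mcell _ mI IB).
set p := fun x => (_, _) in mp.
have /choice[c cP] j : exists c : R[i], normc c <= B /\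
    forall x, p x = j -> normc (f x - c) <= h.
  have [[y py]|ny] := pselect (exists y, p y = j); last first.
    exists 0; rewrite Normc.normc0; split; first exact: supnorm_ge0.
    by move=> x px; exfalso; apply: ny; exists x.
  exists (f y); split; first exact: supnorm_ub.
  move=> x; rewrite -py => -[/(grid_cellP h'0 (RB x) (RB y)) hR].
  move=> /(grid_cellP h'0 (IB x) (IB y)) hI.
  rewrite (le_trans (normc_le_ReIm _))//.
  rewrite (_ : h = h' + h'); last by rewrite /h'; lra.
  apply/ltW; move: hR hI; case: (f x) (f y) => [? ?] [? ?] /= hR hI.
  exact: ltrD.
exists _, p, mp, c; split=> [j|]; first exact: (cP j).1.
apply: supnorm_le => [|x]; first exact: ltW.
rewrite (_ : (f - _) x = f x - c (p x)); first exact: (cP (p x)).2.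
rewrite [LHS](_ : _ = f x - (\sum_j c j *: cell mp j) x)//; congr (_ - _).
rewrite bmfun_sumE (bigD1 (p x))//= big1 ?addr0.
  by rewrite [LHS](_ : _ = c (p x) * cell mp (p x) x)// cellE eqxx mulr1.
move=> i ip; rewrite [LHS](_ : _ = c i * cell mp i x)//.
by rewrite cellE eq_sym (negbTE ip) mulr0.
Qed.

Lemma cintegral_cell I (p : T -> I) (mp : measurable_cells p) i :
  cintegral mu (cell mp i) = (weight k x0 p i)%:C%C.
Proof.
have mpi := mp i; rewrite /cintegral /Rintegral; congr Complex.
  rewrite /weight -[X in mu X](setIT (_ @^-1` _)) -integral_indic//; congr fine.
  by apply: eq_integral => y _; rewrite /= indicE in_fiber.
by rewrite integral0_eq// => y _.
Qed.

Lemma average_cell I J (p : T -> I) (p' : T -> J) (mp : measurable_cells p)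
    (mp' : measurable_cells p') i j :
  average k x0 mp i (cell mp' j) =
  (weight k x0 (fun x => (p x, p' x)) (i, j) / weight k x0 p i)%:C%C.
Proof.
rewrite mulrC rmorphM/=; congr (_ * _).
rewrite -(cintegral_cell (measurable_cells_pair mp mp')).
congr cintegral; apply/funext => y.
rewrite (cellE R mp) (cellE R mp') cellE xpair_eqE -rmorphM/= -natrM mulnb.
by [].
Qed.

(** Both terms are expanded on the common refinement, where the differences that appear are those
    squared in [energy_gap]. *)
Lemma cond_exp_simple I J (p : T -> I) (p' : T -> J) (mp : measurable_cells p)
    (mp' : measurable_cells p') (c : J -> R[i]) (x : T) :
  let f := \sum_j c j *: cell mp' j in
  (W f - W (cond_exp k x0 mp f)) x =
  \sum_(ij : I * J) c ij.2 * (W (cell (measurable_cells_pair mp mp') ij) x -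
    (weight k x0 (fun x => (p x, p' x)) ij / weight k x0 p ij.1)%:C%C *
      W (cell mp ij.1) x).
Proof.
move=> f.
have fE : f = \sum_(ij : I * J) c ij.2 *: cell (measurable_cells_pair mp mp') ij.
  apply: bmfun_ext => y; rewrite !bmfun_sumE.
  rewrite (bigD1 (p' y))//= big1 ?addr0 => [|j jp]; last first.
    rewrite [LHS](_ : _ = c j * cell mp' j y)//.
    by rewrite cellE eq_sym (negbTE jp) mulr0.
  rewrite [RHS](bigD1 (p y, p' y))//= big1 ?addr0 => [|[i j] ijp]; last first.
    rewrite [LHS](_ : _ = c j * cell (measurable_cells_pair mp mp') (i, j) y)//.
    by rewrite cellE eq_sym (negbTE ijp) mulr0.
  rewrite [LHS](_ : _ = c (p' y) * cell mp' (p' y) y)//.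
  rewrite [RHS](_ : _ = c (p' y) * cell (measurable_cells_pair mp mp') (p y, p' y) y)//.
  by rewrite !cellE !eqxx.
have condE : cond_exp k x0 mp f = \sum_(ij : I * J)
    (c ij.2 * (weight k x0 (fun x => (p x, p' x)) ij / weight k x0 p ij.1)%:C%C) *:
      cell mp ij.1.
  transitivity (\sum_i \sum_j (c j * (weight k x0 (fun x => (p x, p' x)) (i, j) /
      weight k x0 p i)%:C%C) *: cell mp i); last first.
    by rewrite pair_bigA/=; apply: eq_bigr => -[].
  apply: eq_bigr => i _; rewrite -scaler_suml; congr (_ *: _).
  have sc := average_scalar k x0 mp i.
  rewrite form_sumE//; apply: eq_bigr => j _.
  by rewrite formZ// average_cell.
rewrite condE [in W f]fE !(lin_sum W_lin) -sumrB bmfun_sumE; apply: eq_bigr => ij _.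
by rewrite !(linZ W_lin) mulrBr mulrA.
Qed.

(** [F] is [W] after averaging over a near-maximal partition. That partition is fixed before [f]:
    whatever simple function approximates [f], its cells only refine the partition, and the gap
    bound is uniform over refinements. Averaging is a contraction, so [F] inherits the sup bound of
    [W]. *)
Lemma finite_rank_approximation (e : R) : 0 < e -> exists F,
  [/\ finite_rank F, forall f, supnorm (F f) <= cW * supnorm f &
      forall f, (\int[mu]_x (normc ((W f - F f) x))%:E <= (e * supnorm f)%:E)%E].
Proof.
move=> e0; pose t := e / (M * M + 1).
have MM : 0 < M * M + 1 by rewrite ltr_wpDl// mulr_ge0.
have t0 : 0 < t by rewrite divr_gt0.
have tMe : t * (M * M) <= e.
  by rewrite /t mulrAC ler_pdivrMr// ler_pM2l// lerDl.
clearbody t.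
(* Up to the simple approximation, the final bound is [|f| (t M^2 / 2 + gap / (2 t))]. The choice of
   [t] and a gap of at most [t e] make each term at most [e |f| / 2]. *)
have [I [p [mp gap]]] := near_maximal_partition (mulr_gt0 t0 e0).
exists (W \o cond_exp k x0 mp); split.
- by apply: finite_rank_compl => //; exact: finite_rank_cond_exp.
- by move=> f /=; rewrite (le_trans (W_le _))// ler_wpM2l// cond_exp_le.
move=> f; set N := supnorm f; apply/lee_addgt0Pr => h h0.
have N0 : 0 <= N by exact: supnorm_ge0.
pose dl := h / (2 * cW * M + 1).
have D0 : 0 < 2 * cW * M + 1 by rewrite ltr_wpDl// !mulr_ge0.
have dl0 : 0 < dl by rewrite divr_gt0.
have [J [p' [mp' [c [cN ff']]]]] := simple_approximation f dl0.
set f' := \sum_j _ in ff'.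
have mpp := measurable_cells_pair mp mp'.
pose K := 2 * cW * dl + N * (t * M / 2).
have K0 : 0 <= K.
  by rewrite /K; apply: addr_ge0; repeat apply: mulr_ge0 => //; rewrite ?invr_ge0 // ltW.
have ptw : {ae mu, forall x, normc ((W f - (W \o cond_exp k x0 mp) f) x) <=
    K + N / (2 * t) * energy_gap mp mp' x}.
  apply: filterS (ae_cells (measurable_cells_pair mp mp')) => x dx.
  have condB : cond_exp k x0 mp f = cond_exp k x0 mp (f - f') + cond_exp k x0 mp f'.
    by rewrite -(linD (finite_rank_linear (finite_rank_cond_exp k x0 mp))) subrK.
  have -> : W f - (W \o cond_exp k x0 mp) f =
      (W (f - f') - W (cond_exp k x0 mp (f - f'))) +
      (W f' - W (cond_exp k x0 mp f')).
    rewrite /= condB (linD W_lin) -{1}(subrK f' f) (linD W_lin).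
    by rewrite opprD addrACA.
  rewrite [X in normc X](_ : _ =
      (W (f - f') x - W (cond_exp k x0 mp (f - f')) x) +
      (W f' - W (cond_exp k x0 mp f')) x)//.
  rewrite (le_trans (le_normcD _ _))// /K -addrA lerD//.
    rewrite (le_trans (le_normcD _ _))// normcN.
    have -> : 2 * cW * dl = cW * dl + cW * dl by ring.
    apply: lerD; rewrite (le_trans (supnorm_ub _ _))// (le_trans (W_le _))//.
      by rewrite ler_wpM2l.
    by rewrite ler_wpM2l// (le_trans (cond_exp_le _ _ _ _)).
  rewrite cond_exp_simple (le_trans (normc_sum _ _ _))//.
  have -> : N * (t * M / 2) + N / (2 * t) * energy_gap mp mp' x =
      N * (t * M / 2 + (2 * t)^-1 * energy_gap mp mp' x) by ring.
  rewrite /M -(weight_sum k x0 mpp) /energy_gap.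
  rewrite [t * _]mulr_sumr mulr_suml [(2 * t)^-1 * _]mulr_sumr -big_split/= mulr_sumr.
  rewrite ler_sum// => ij _; rewrite Normc.normcM.
  set g := _ - _; set w := weight _ _ _ ij.
  rewrite ler_pM ?normc_ge0//.
  have w0 : 0 <= w by exact: weight_ge0.
  have [wz|wz] := eqVneq w 0.
    rewrite /g -/w wz mul0r rmorph0 mul0r subr0.
    have := dx ij; rewrite -/w wz mulr0 => /le_trans; apply.
    by rewrite invr0 !mulr0 mul0r addr0.
  have {wz}w0 : 0 < w by rewrite lt_def wz.
  (* Young's inequality [|g| <= t w / 2 + |g|^2 / (2 t w)]: the weights [w] sum to [M], and the
     quotients [|g|^2 / w] to [energy_gap]. *)
  have -> : t * w / 2 + (2 * t)^-1 * (normc g ^+ 2 / w) =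
      ((t * w) ^+ 2 + normc g ^+ 2) / (2 * t * w).
    by field; rewrite !gt_eqF.
  rewrite ler_pdivlMr ?mulr_gt0//.
  have := sqr_ge0 (t * w - normc g); nra.
pose y := (\int[mu]_x (K%:E + (N / (2 * t))%:E * (energy_gap mp mp' x)%:E))%E.
apply: (@le_trans _ _ y).
  apply: ae_ge0_le_integral => //.
  - by move=> x _; rewrite lee_fin normc_ge0.
  - exact: normc_measurable.
  - move=> x _; rewrite -EFinM -EFinD lee_fin addr_ge0// mulr_ge0 ?energy_gap_ge0//.
    by rewrite divr_ge0// mulr_ge0// ltW.
  - apply: emeasurable_funD; first exact: measurable_cst.
    apply: measurable_funeM; exact/measurable_EFinP/measurable_energy_gap.
  - by apply: filterS ptw => x xK _; rewrite -EFinM -EFinD lee_fin.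
have Nt0 : 0 <= N / (2 * t) by rewrite divr_ge0// mulr_ge0// ltW.
rewrite /y ge0_integralD//; last 2 first.
- move=> x _; rewrite -EFinM lee_fin mulr_ge0 ?energy_gap_ge0//.
- apply: measurable_funeM; exact/measurable_EFinP/measurable_energy_gap.
rewrite integral_cst// ge0_integralZl_EFin//; last 2 first.
- by move=> x _; rewrite lee_fin energy_gap_ge0.
- exact/measurable_EFinP/measurable_energy_gap.
rewrite -[mu setT]fineK ?mu_fin_num// -/M.
apply: (@le_trans _ _ (K%:E * M%:E + (N / (2 * t))%:E * (t * e)%:E)%E).
  by rewrite leeD2l// lee_wpmul2l// gap.
rewrite -!EFinM -!EFinD lee_fin.
have -> : N / (2 * t) * (t * e) = N * e / 2 by field; rewrite gt_eqF.
have -> : K * M = 2 * cW * M * dl + N * (t * (M * M)) / 2 by rewrite /K; field.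
have h1 : 2 * cW * M * dl <= h.
  by rewrite /dl mulrA ler_pdivrMr// mulrC ler_pM2l// lerDl.
have h2 : N * (t * (M * M)) <= N * e by rewrite ler_wpM2l.
lra.
Qed.

End bounded_density.

(** * Splitting a kernel into a small part and a part with bounded density *)

(** Tested on [A = {f > c}], the hypothesis makes the integral of [f - c] over [A] vanish, although
    the integrand is positive there; so [A] is null. *)
Lemma ae_le_cst d (T : measurableType d) (R : realType)
    (mu : {measure set T -> \bar R}) (f : T -> \bar R) (c : R) :
  (mu setT < +oo)%E -> 0 <= c -> measurable_fun [set: T] f ->
  (forall x, 0 <= f x)%E -> (forall x, f x \is a fin_num) ->
  (forall A, measurable A -> \int[mu]_(x in A) f x <= c%:E * mu A)%E ->
  {ae mu, forall x, (f x <= c%:E)%E}.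
Proof.
move=> muoo c0 mf f0 ffin fA.
pose A := [set x | (c%:E < f x)%E].
have mA : measurable A.
  by rewrite -[A]setTI; exact: emeasurable_fun_o_infty.
have mg : measurable_fun A (fun x => f x - c%:E)%E.
  apply: measurable_funTS; apply: emeasurable_funB => //; exact: measurable_cst.
have Afin : mu A \is a fin_num.
  by rewrite ge0_fin_numE// (le_lt_trans _ muoo)// le_measure// inE.
have sub0 x : A x -> (0 <= f x - c%:E)%E by move=> /ltW h; rewrite suber_ge0.
have int0 : (\int[mu]_(x in A) (f x - c%:E)%E = 0)%E.
  apply/eqP; rewrite eq_le; apply/andP; split; last exact: integral_ge0.
  have := fA A mA.
  rewrite (_ : \int[mu]_(x in A) f x =
    \int[mu]_(x in A) ((f x - c%:E)%E + c%:E)%E)%E; last first.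
    by apply: eq_integral => x _; rewrite subeK.
  rewrite ge0_integralD//.
  by rewrite integral_cst// -leeBrDr ?subee// fin_numM.
have : ae_eq mu A (fun x => f x - c%:E)%E (cst 0).
  apply/ae_eq_integral_abs => //; rewrite -[RHS]int0; apply: eq_integral => x.
  by rewrite inE => /sub0 h; rewrite gee0_abs.
apply: filterS => x h; rewrite leNgt; apply/negP => Ax.
have fc : (f x - c%:E = 0)%E by exact: h.
by move: Ax; rewrite -(subeK (f x) (isT : c%:E \is a fin_num)) fc add0e ltxx.
Qed.

Section product_of_kernels.
Context d (T : measurableType d) (R : realType).
Variables (k : R.-fker T ~> T) (x0 : T).
Local Notation mu := (k x0).

(** Makes the product of [mu] with itself an instance of [kernel_prod], comparable with
    [mu(dx) q(x, dy)]. *)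
Definition kernel_cst (_ : T) : {measure set T -> \bar R} := mu.

Let measurable_kernel_cst U : measurable U -> measurable_fun [set: T] (kernel_cst ^~ U).
Proof. by move=> _; exact: measurable_cst. Qed.

HB.instance Definition _ := @isKernel.Build _ _ _ _ _ kernel_cst measurable_kernel_cst.

Let kernel_cst_uub : measure_fam_uub kernel_cst.
Proof. by have [M kM] := measure_uub k; exists M => y; exact: kM. Qed.

HB.instance Definition _ := @Kernel_isFinite.Build _ _ _ _ _ kernel_cst kernel_cst_uub.

(* The measure [mu(dx) q(x, dy)] on the product. *)
Definition kernel_prod (q : R.-fker T ~> T) : set (T * T) -> \bar R :=
  mkproduct k (ksnd q) x0.

HB.instance Definition _ q := Measure.on (kernel_prod q).

Lemma kernel_prodE q B : measurable B ->
  (kernel_prod q B = \int[mu]_x q x (xsection B x))%E.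
Proof.
move=> mB; apply: eq_integral => x _.
rewrite -[in RHS](setIT (xsection B x)) -integral_indic//; last exact: measurable_xsection.
by apply: eq_integral => y _; rewrite !indicE mem_xsection.
Qed.

Lemma kernel_prod_fin q B : measurable B -> kernel_prod q B \is a fin_num.
Proof.
move=> mB; rewrite ge0_fin_numE// kernel_prodE//.
have [c c0 qc] := fker_bound q.
apply: (@le_lt_trans _ _ (c%:E * mu setT)%E); last first.
  by rewrite lte_mul_pinfty ?lee_fin// kernelT_lty.
rewrite -integral_cst//; apply: ge0_le_integral => //.
- by apply: measurable_fun_xsection_finite_kernel; rewrite inE.
- move=> x _; rewrite (le_trans _ (qc x))// le_measure ?inE//.
  exact: measurable_xsection.
Qed.

HB.instance Definition _ q :=
  @Measure_isFinite.Build _ _ _ (kernel_prod q) (@kernel_prod_fin q).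

Lemma kernel_prod_restrict q A B : measurable A -> measurable B ->
  (kernel_prod q ((A `*` setT) `&` B) = \int[mu]_(x in A) q x (xsection B x))%E.
Proof.
move=> mA mB; rewrite kernel_prodE; last by apply: measurableI => //; exact: measurableX.
rewrite [RHS]integral_mkcond; apply: eq_integral => x _.
rewrite patchE xsectionI; case: ifPn => xA.
  by rewrite in_xsectionX// setTI.
by rewrite notin_xsectionX// set0I measure0.
Qed.

(* [G] is the positive set of a Hahn decomposition of
   [mu(dx) q(x, dy) - n mu(dx) mu(dy)], deprived of a null set of sections. *)
Lemma density_splitting (q : R.-fker T ~> T) (eta : R) : 0 < eta ->
  exists G, [/\ measurable G, forall x, (mu (xsection G x) <= eta%:E)%E &
    exists2 C : R, 0 <= C & forall A, measurable A ->
      {ae mu, forall x, (q x (A `&` xsection (~` G) x) <= C%:E * mu A)%E}].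
Proof.
move=> eta0; have [c c0 qc] := fker_bound q.
(* On the positive set [n mu(P_x) <= q(x, P_x) <= c] for almost every [x], so this [n] gives
   [mu(P_x) <= eta]; the added [1] keeps [n] positive. *)
pose n : R := (c + 1) / eta.
have n0 : 0 < n by rewrite divr_gt0// ltr_wpDl.
pose nu := cadd (charge_of_finite_measure (kernel_prod q))
  (cscale (- n) (charge_of_finite_measure (kernel_prod kernel_cst))).
have nuE B : measurable B -> nu B = (kernel_prod q B - n%:E * kernel_prod kernel_cst B)%E.
  by move=> mB; rewrite /nu /cadd/= /cscale/= EFinN mulNe.
have [P [N [[mP Ppos] [mN Nneg] PN PN0]]] := Hahn_decomposition nu.
have NE : N = ~` P.
  apply/seteqP; split=> x.
    by move=> Nx Px; have : set0 x by rewrite -PN0.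
  by move=> nPx; have : [set: T * T] x by []; rewrite -PN => -[].
have pos B : measurable B -> B `<=` P ->
    (n%:E * kernel_prod kernel_cst B <= kernel_prod q B)%E.
  move=> mB BP; have : (0 <= nu B)%E by exact: Ppos.
  rewrite nuE// suber_ge0//.
  by rewrite fin_numM// kernel_prod_fin.
have neg B : measurable B -> B `<=` N ->
    (kernel_prod q B <= n%:E * kernel_prod kernel_cst B)%E.
  move=> mB BN; have : (nu B <= 0)%E by exact: Nneg.
  by rewrite nuE// sube_le0.
have mX (A : set T) : measurable A -> measurable (A `*` [set: T]).
  by move=> mA; exact: measurableX.
have small : {ae mu, forall x, (mu (xsection P x) <= eta%:E)%E}.
  apply: ae_le_cst; rewrite ?kernelT_lty// ?ltW//.
  - by apply: (measurable_fun_xsection_finite_kernel kernel_cst); rewrite inE.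
  - by move=> x; apply: mu_fin_num; exact: measurable_xsection.
  move=> A mA; rewrite -(kernel_prod_restrict kernel_cst)//.
  rewrite -(@lee_pmul2l _ n%:E)// muleA -EFinM (_ : n * eta = c + 1); last first.
    by rewrite /n divfK// gt_eqF.
  have mAP := measurableI _ _ (mX _ mA) mP.
  have subP : (A `*` [set: T]) `&` P `<=` P by move=> z [].
  rewrite (le_trans (pos _ mAP subP))//.
  rewrite kernel_prod_restrict// -integral_cst//; apply: ge0_le_integral => //.
  - apply: measurable_funTS.
    by apply: measurable_fun_xsection_finite_kernel; rewrite inE.
  - move=> x _; apply: (@le_trans _ _ c%:E); last by rewrite lee_fin lerDl.
    rewrite (le_trans _ (qc x))// le_measure ?inE//; exact: measurable_xsection.
(* [Z] is null. Cutting it out makes the bound on the sections of [G] hold at every point, as a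
   sup-norm estimate requires; the density bound is only wanted almost everywhere. *)
pose Z := [set x | (eta%:E < mu (xsection P x))%E].
have mZ : measurable Z.
  rewrite -[Z]setTI; apply: emeasurable_fun_o_infty => //.
  by apply: (measurable_fun_xsection_finite_kernel kernel_cst); rewrite inE.
pose G := ((~` Z) `*` [set: T]) `&` P.
have mG : measurable G by apply: measurableI => //; apply: mX; exact: measurableC.
exists G; split=> //.
- move=> x; rewrite /G xsectionI; have [Zx|Zx] := boolP (x \in ~` Z).
    by rewrite in_xsectionX// setTI leNgt; apply/negP; move: Zx; rewrite inE.
  by rewrite notin_xsectionX// set0I measure0 lee_fin ltW.
exists n; first exact: ltW.
move=> A mA.
have mAN : measurable ((setT `*` A) `&` N) by apply: measurableI => //; exact: measurableX.
have secAN x : xsection ((setT `*` A) `&` N) x = A `&` xsection N x.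
  by rewrite xsectionI in_xsectionX ?inE.
have dens : {ae mu, forall x, (q x (A `&` xsection N x) <= (n * fine (mu A))%:E)%E}.
  apply: ae_le_cst; rewrite ?kernelT_lty//.
  - by rewrite mulr_ge0 ?fine_ge0// ltW.
  - under eq_fun do rewrite -secAN.
    by apply: measurable_fun_xsection_finite_kernel; rewrite inE.
  - move=> x; rewrite -secAN; apply: mu_fin_num; exact: measurable_xsection.
  move=> B mB.
  rewrite (eq_integral (fun x => q x (xsection ((setT `*` A) `&` N) x))); last first.
    by move=> x _; rewrite secAN.
  have mBN := measurableI _ _ (mX _ mB) mAN.
  have subN : (B `*` [set: T]) `&` (([set: T] `*` A) `&` N) `<=` N by move=> z [_ []].
  rewrite -kernel_prod_restrict// (le_trans (neg _ mBN subN))//.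
  have -> : ((n * fine (mu A))%:E = n%:E * mu A)%E.
    by rewrite EFinM fineK// mu_fin_num.
  rewrite -muleA.
  apply: lee_wpmul2l; first by rewrite lee_fin ltW.
  rewrite kernel_prod_restrict// -integral_cst//; apply: ge0_le_integral => //.
  - apply: measurable_funTS.
    by apply: (measurable_fun_xsection_finite_kernel kernel_cst); rewrite inE.
  - move=> x _; rewrite secAN le_measure ?inE//; apply: measurableI => //.
    exact: measurable_xsection.
apply: filterS2 small dens => x sx dx.
rewrite -[mu A]fineK ?mu_fin_num// -EFinM (le_trans _ dx)// le_measure ?inE//.
- by apply: measurableI => //; apply: measurable_xsection; exact: measurableC.
- by apply: measurableI => //; exact: measurable_xsection.
move=> y [Ay /xsectionP nG]; split=> //; apply/xsectionP.
rewrite NE => Pxy; apply: nG; split=> //; split=> //=.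
by apply/negP; rewrite -leNgt.
Qed.

End product_of_kernels.

(** * Lasota-Yorke inequality *)

Section uniform_integrability.
Context d (T : measurableType d) (R : realType).
Variables (nu : probability T R) (q : R.-fker T ~> T).

(** The supremum is monotone in [eta], so its limit at [0] is an infimum, and some [eta] comes
    within [e] of it. *)
Lemma DeltaP : 0 <= Delta nu q /\ forall e : R, 0 < e ->
  exists2 eta : R, 0 < eta & forall x A, measurable A -> (nu A <= eta%:E)%E ->
    (q x A <= (Delta nu q + e)%:E)%E.
Proof.
pose S eta := [set u | exists x A,
  [/\ measurable A, (nu A <= eta%:E)%E & u = q x A]].
pose g eta := ereal_sup (S eta).
have [c c0 qc] := fker_bound q.
(* A space carrying a probability is nonempty, so the suprema are nonnegative rather than [-oo]. *)
have [x0 _] : [set: T] !=set0.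
  apply/set0P/eqP => T0; have := @probability_setT _ _ _ nu.
  by rewrite T0 measure0 => /esym/eqP; rewrite onee_eq0.
have S0 eta : 0 < eta -> S eta 0%E.
  by move=> e0; exists x0, set0; rewrite measure0 lee_fin ltW.
have g0 eta : 0 < eta -> (0 <= g eta)%E by move=> /S0; exact: ereal_sup_ubound.
have gc eta : (g eta <= c%:E)%E.
  apply: ge_ereal_sup => _ [x [A [mA _ ->]]].
  by rewrite (le_trans _ (qc x))// le_measure ?inE.
have gnd : {homo g : s t / s <= t >-> (s <= t)%E}.
  move=> s t st; apply: ereal_sup_le => _ [x [A [mA nA ->]]].
  exists x, A; split=> //.
  by rewrite (le_trans nA)// lee_fin.
pose I := Interval (BRight (0 : R)) +oo%O.
have lim : g x @[x --> (0 : R)^'+] --> ereal_inf (g @` [set` I]).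
  by apply: nondecreasing_at_right_cvge => // s t _ _; exact: gnd.
have DE : Delta nu q = fine (ereal_inf (g @` [set` I])).
  by rewrite /Delta; congr fine; exact: cvg_lim.
have inf0 : (0 <= ereal_inf (g @` [set` I]))%E.
  apply: le_ereal_inf_tmp => _ [eta + <-]; rewrite /= in_itv/= andbT; exact: g0.
have inffin : ereal_inf (g @` [set` I]) \is a fin_num.
  rewrite ge0_fin_numE// (@le_lt_trans _ _ (g 1))//; last first.
    by rewrite (le_lt_trans (gc 1))// ltry.
  by apply: ereal_inf_lbound; exists 1 => //=; rewrite in_itv/= ltr01.
split; first by rewrite DE fine_ge0.
move=> e e0; have [_ [eta + <-] ge] := lb_ereal_inf_adherent e0 inffin.
rewrite /= in_itv/= andbT => eta0; exists eta => // x A mA nA.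
rewrite EFinD DE fineK// (le_trans _ (ltW ge))//.
by apply: ereal_sup_ubound; exists x, A.
Qed.

End uniform_integrability.

Section weak_norm.
Context d (T : measurableType d) (R : realType).
Variables (Q : R.-fker T ~> T) (nu : probability T R).
Implicit Types (f : bmfun T R) (h : T -> \bar R).

Let knu : R.-fker T ~> T :=
  kprobability (@measurable_cst _ _ T (pprobability T R) setT (nu : pprobability T R)).

(* The finite measures [\sum_(i < n.+1) nu Q^i]. *)
Fixpoint orbit_sum n : R.-fker T ~> T :=
  if n is n'.+1 then kadd knu (kernel_comp (orbit_sum n') Q) else knu.

Lemma integral_orbit_sumS n x h : (forall y, 0 <= h y)%E ->
  measurable_fun [set: T] h ->
  (\int[orbit_sum n.+1 x]_y h y =
    \int[nu]_y h y + \int[orbit_sum n x]_y \int[Q y]_z h z)%E.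
Proof.
move=> h0 mh; rewrite -integral_kernel_comp//.
exact: (ge0_integral_measure_add (knu x) (kernel_comp (orbit_sum n) Q x)).
Qed.

Lemma le_integral_orbit_sum n m x h : (n <= m)%N -> (forall y, 0 <= h y)%E ->
  measurable_fun [set: T] h ->
  (\int[orbit_sum n x]_y h y <= \int[orbit_sum m x]_y h y)%E.
Proof.
move=> /subnK <-; elim: (m - n)%N => // {m} j ih h0 mh.
apply: (le_trans (ih h0 mh)); rewrite addSn; move: (j + n)%N => {j ih} {}n.
elim: n h h0 mh => [|n ih] h h0 mh.
  by rewrite integral_orbit_sumS// leeDl// integral_ge0// => y _; exact: integral_ge0.
rewrite (integral_orbit_sumS n _ h0 mh) (integral_orbit_sumS n.+1 _ h0 mh).
rewrite leeD2l//; apply: ih.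
- by move=> y; exact: integral_ge0.
- exact: measurable_integral_kernel.
Qed.

Lemma le_nu_orbit_sum n x A : measurable A -> (nu A <= orbit_sum n x A)%E.
Proof.
move=> mA; have := @le_integral_orbit_sum 0 n x (fun y => (\1_A y)%:E) (leq0n n).
rewrite !integral_indic// !setIT; apply.
- by move=> y; rewrite lee_fin.
- exact/measurable_EFinP/measurable_indic.
Qed.

Definition l1norm (mu : {measure set T -> \bar R}) f : \bar R :=
  (\int[mu]_y (normc (f y))%:E)%E.

Variables (chi : bmfun (T * T)%type R).
Local Notation L := (kernel_mul_op Q chi).

Let normc_e0 f y : (0 <= (normc (f y))%:E)%E.
Proof. by rewrite lee_fin normc_ge0. Qed.

(** Integrating [|L f|] against [orbit_sum n] leads to [|f|] integrated against the image of that
    measure by [Q], which is one of the two summands of [orbit_sum n.+1]. *)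
Lemma l1norm_iter n i x f : (l1norm (orbit_sum n x) (iter i L f) <=
  (supnorm chi ^+ i)%:E * l1norm (orbit_sum (i + n) x) f)%E.
Proof.
elim: i n f => [|i ih] n f; first by rewrite expr0 mul1e.
rewrite iterSr (le_trans (ih _ _))// exprSr EFinM -muleA.
rewrite lee_wpmul2l ?lee_fin ?exprn_ge0 ?supnorm_ge0// addSn.
apply: (@le_trans _ _ ((supnorm chi)%:E *
    \int[orbit_sum (i + n) x]_y \int[Q y]_z (normc (f z))%:E)%E).
  rewrite -ge0_integralZl_EFin ?supnorm_ge0//; last 2 first.
  - by move=> y _; exact: integral_ge0.
  - by apply: measurable_integral_kernel => //; exact: normc_measurable.
  apply: ge0_le_integral => //.
  - exact: normc_measurable.
  - apply: measurable_funeM; apply: measurable_integral_kernel => //.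
    exact: normc_measurable.
  - by move=> y _; exact: kernel_mul_op_le.
rewrite lee_wpmul2l ?lee_fin ?supnorm_ge0// /l1norm integral_orbit_sumS//.
  by rewrite leeDr// integral_ge0.
exact: normc_measurable.
Qed.

Variables (l : nat) (a : R).
Hypothesis a_gt : supnorm chi ^+ l * Delta nu (kernel_pow Q l) < a.

Let b := supnorm chi.
Let b0 : 0 <= b. Proof. exact: supnorm_ge0. Qed.
Let D := Delta nu (kernel_pow Q l).
Let D0 : 0 <= D. Proof. exact: (DeltaP nu (kernel_pow Q l)).1. Qed.
Let a0 : 0 < a. Proof. by rewrite (le_lt_trans _ a_gt)// mulr_ge0// exprn_ge0. Qed.

Lemma uniform_small : exists2 eta : R, 0 < eta & forall x A, measurable A ->
  (nu A <= eta%:E)%E -> ((b ^+ l)%:E * kernel_pow Q l x A <= a%:E)%E.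
Proof.
pose e := (a - b ^+ l * D) / (b ^+ l + 1).
have bl : 0 < b ^+ l + 1 by rewrite ltr_wpDl// exprn_ge0.
have e0 : 0 < e by rewrite divr_gt0// subr_gt0.
have [eta eta0 etaP] := (DeltaP nu (kernel_pow Q l)).2 _ e0.
exists eta => // x A mA /(etaP x A mA) h.
apply: (@le_trans _ _ ((b ^+ l)%:E * (D + e)%:E)%E).
  by rewrite lee_wpmul2l// lee_fin exprn_ge0.
rewrite -EFinM lee_fin mulrDr -lerBrDl.
have -> : a - b ^+ l * D = (b ^+ l + 1) * e by rewrite /e [RHS]mulrC divfK// gt_eqF.
by rewrite ler_wpM2r ?(ltW e0)// lerDl.
Qed.

(** The integral is split at a level [t] proportional to the weak norm, up to a slack. By Markov's
    inequality the set [A] where [|f| >= t] has [nu]-measure at most [eta], so [uniform_small]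
    bounds its contribution by [a |f|]; elsewhere [|f| < t]. *)
Lemma lasota_yorke : exists2 C : R, 0 <= C & forall f delta, 0 <= delta ->
  (l1norm nu f <= delta%:E)%E -> supnorm (iter l L f) <= a * supnorm f + C * delta.
Proof.
have [eta eta0 etaP] := uniform_small.
have [c c0 qc] := fker_bound (kernel_pow Q l).
exists (b ^+ l * c / eta); first by rewrite !mulr_ge0 ?exprn_ge0 ?invr_ge0// ltW.
move=> f delta delta0 fd; apply/ler_addgt0Pr => e e0.
have N0 := supnorm_ge0 f.
pose K := b ^+ l * c / eta.
have K0 : 0 <= K by rewrite !mulr_ge0 ?exprn_ge0 ?invr_ge0// ltW.
(* The extra term keeps [s], hence the level [t], positive when [delta = 0]; it costs at most [e] in
   the end. *)
pose s := delta + e / (K + 1).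
have K1 : 0 < K + 1 by rewrite ltr_wpDl.
have s0 : 0 < s by rewrite ltr_wpDl// divr_gt0.
pose t := s / eta.
have t0 : 0 < t by rewrite divr_gt0.
pose A := [set y | t <= normc (f y)].
have mA : measurable A.
  rewrite (_ : A = setT `&` (fun y => normc (f y)) @^-1` `[t, +oo[%classic).
    by apply: (measurable_normc (bmfunP f)).
  by apply/seteqP; split=> y /=; rewrite in_itv/= andbT// => -[].
have nuA : (nu A <= eta%:E)%E.
  have teta : t * eta = s by rewrite /t divfK// gt_eqF.
  rewrite -(@lee_pmul2l _ t%:E) ?lte_fin// -EFinM teta.
  apply: (@le_trans _ _ (l1norm nu f)); last first.
    by rewrite (le_trans fd)// lee_fin lerDl divr_ge0 ?ltW.
  rewrite -[in leLHS](setIT A) -integral_indic// -ge0_integralZl_EFin ?(ltW t0)//; last first.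
    exact/measurable_EFinP/measurable_indic.
  apply: ge0_le_integral => //.
  - by move=> y _; rewrite mule_ge0 ?lee_fin// ltW.
  - apply: measurable_funeM; exact/measurable_EFinP/measurable_indic.
  - exact: normc_measurable.
  - move=> y _; rewrite -EFinM lee_fin indicE; case: (boolP (y \in A)) => yA.
      by rewrite mulr1; move: yA; rewrite inE.
    by rewrite mulr0 normc_ge0.
have le1 : a * supnorm f + b ^+ l * (t * c) <= a * supnorm f + b ^+ l * c / eta * delta + e.
  rewrite -addrA lerD2l -/K (_ : b ^+ l * (t * c) = K * s); last first.
    by rewrite /K /t; ring.
  rewrite /s mulrDr lerD2l mulrA ler_pdivrMr// mulrC ler_pM2l// lerDl.
  exact: ler01.
apply: (le_trans _ le1); apply: supnorm_le.
  apply: addr_ge0; first exact: mulr_ge0 (ltW a0) N0.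
  by apply: mulr_ge0; [exact: exprn_ge0|exact: mulr_ge0 (ltW t0) c0].
move=> x; rewrite -lee_fin (le_trans (iter_kernel_mul_op_le _ _ _ _ _))//.
apply: (@le_trans _ _ ((b ^+ l)%:E * (t%:E * kernel_pow Q l x setT +
    (supnorm f)%:E * kernel_pow Q l x A))%E).
  rewrite lee_wpmul2l ?lee_fin ?exprn_ge0//.
  rewrite -integral_cst// -[in leRHS](setIT A) -integral_indic//.
  rewrite -ge0_integralZl_EFin//; last exact/measurable_EFinP/measurable_indic.
  have mi : measurable_fun [set: T] (fun y => (supnorm f)%:E * (\1_A y)%:E)%E.
    apply: measurable_funeM; exact/measurable_EFinP/measurable_indic.
  rewrite -ge0_integralD//; last 2 first.
  - by move=> y _; rewrite lee_fin ltW.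
  - by move=> y _; rewrite mule_ge0 ?lee_fin.
  apply: ge0_le_integral => //.
  - exact: normc_measurable.
  - by apply: emeasurable_funD => //; exact: measurable_cst.
  - move=> y _; rewrite -EFinM -EFinD lee_fin indicE; case: (boolP (y \in A)) => yA.
      by rewrite mulr1 (le_trans (supnorm_ub f y))// lerDr ltW.
    rewrite mulr0 addr0 ltW// ltNge; apply: contra yA => yt.
    by rewrite inE.
rewrite ge0_muleDr; last 2 first.
- by rewrite mule_ge0// lee_fin ltW.
- by rewrite mule_ge0// lee_fin.
rewrite addeC EFinD; apply: leeD.
  rewrite muleCA [leRHS]EFinM [leRHS]muleC.
  by rewrite lee_wpmul2l ?lee_fin// etaP.
rewrite !EFinM lee_wpmul2l ?lee_fin ?exprn_ge0//.
by rewrite lee_wpmul2l ?lee_fin ?(ltW t0)//.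
Qed.

(** The inequality is iterated with measures that grow with [j]; all are then dominated by
    [orbit_sum (m * l)], so that one weak norm serves every [j <= m]. *)
Lemma lasota_yorke_iter m x : forall j, (j <= m)%N ->
  exists2 C : R, 0 <= C & forall f delta, 0 <= delta ->
    (l1norm (orbit_sum (m * l) x) f <= delta%:E)%E ->
    supnorm (iter (j * l) L f) <= a ^+ j * supnorm f + C * delta.
Proof.
suff H j : exists2 C : R, 0 <= C & forall f delta, 0 <= delta ->
    (l1norm (orbit_sum (j * l) x) f <= delta%:E)%E ->
    supnorm (iter (j * l) L f) <= a ^+ j * supnorm f + C * delta.
  move=> j jm; have [C C0 HC] := H j; exists C => // f delta d0 fd.
  apply: HC => //; apply: (le_trans _ fd).
  apply: le_integral_orbit_sum => //; first by rewrite leq_mul2r jm orbT.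
  exact: normc_measurable.
elim: j => [|j [C C0 ih]].
  exists 0 => // f delta d0 _; by rewrite mul0n expr0 mul1r mul0r addr0.
have [C' C'0 LY] := lasota_yorke.
exists (a ^+ j * C' + C * b ^+ l).
  by rewrite addr_ge0 ?mulr_ge0 ?exprn_ge0 ?(ltW a0).
move=> f delta d0 fd; rewrite mulSn addnC iterD.
have bd : 0 <= b ^+ l * delta by rewrite mulr_ge0 ?exprn_ge0.
apply: (le_trans (ih _ _ bd _)).
  rewrite (le_trans (l1norm_iter _ _ _ _))// EFinM.
  by rewrite lee_wpmul2l ?lee_fin ?exprn_ge0 -?mulSn.
have LYf : supnorm (iter l L f) <= a * supnorm f + C' * delta.
  apply: LY => //; apply: (le_trans _ fd).
  apply: (@le_integral_orbit_sum 0) => //; exact: normc_measurable.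
rewrite (le_trans (lerD (ler_wpM2l _ LYf) (lexx _))) ?exprn_ge0 ?(ltW a0)//.
by rewrite le_eqVlt; apply/orP; left; apply/eqP; rewrite exprSr; ring.
Qed.

End weak_norm.

(** * Quasi-compactness *)

Lemma iterD_telescope (R : realType) (V : lmodType R[i]) (U S W : V -> V) :
  linear U -> (forall x, U x = S x + W x) -> forall m x,
  iter m U x = iter m S x + \sum_(i < m) iter (m - i.+1) U (W (iter i S x)).
Proof.
move=> lU UE; elim=> [|m ih] x; first by rewrite big_ord0 addr0.
rewrite big_ord_recr/= subnn/= ih (linD lU) UE (lin_sum lU) -addrA [W _ + _]addrC.
congr (_ + (_ + _)); apply: eq_bigr => i _.
by rewrite subSS -iterS -subSn.
Qed.

Lemma poly_geometric_small (R : realType) (a s c K : R) :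
  0 < a -> a < s -> 0 < c -> 0 <= K ->
  exists2 m, (0 < m)%N & a ^+ m * (c + m%:R * K) < s ^+ m.
Proof.
move=> a0 ast c0 K0; have s0 := lt_trans a0 ast.
(* Both [a (1 + h)] and [v s] equal the midpoint of [a] and [s]. By Bernoulli's inequality the
   linear factor is at most a constant times [(1 + h)^m], which leaves [v^m] with [v < 1]. *)
pose v := ((a + s) / 2) / s; pose h := (s - a) / (2 * a).
have h0 : 0 < h by rewrite divr_gt0 ?subr_gt0// mulr_gt0.
have v0 : 0 < v by rewrite !divr_gt0// addr_gt0.
have v1 : `|v| < 1.
  rewrite ger0_norm ?(ltW v0)// /v ltr_pdivrMr// mul1r; lra.
have bern m : 1 + m%:R * h <= (1 + h) ^+ m.
  elim: m => [|m ih]; first by rewrite expr0 mul0r addr0.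
  rewrite exprS -natr1; have : 0 <= (m%:R : R) by [].
  move: ih; set y := (1 + h) ^+ m; set n : R := m%:R => ih n0.
  have : (1 + h) * (1 + n * h) <= (1 + h) * y by rewrite ler_wpM2l// addr_ge0 ?(ltW h0).
  have : 0 <= n * (h * h) by exact: mulr_ge0 n0 (mulr_ge0 (ltW h0) (ltW h0)).
  by nra.
have /cvgrPdist_lt/(_ _ ltr01)[N _ NP] := cvg_geometric (c + K / h) v1.
have := NP N.+1 (leqnSn N); rewrite /= sub0r normrN.
move=> /(le_lt_trans (ler_norm _)); set m := N.+1 => small.
exists m => //.
have bnd : c + m%:R * K <= (c + K / h) * (1 + h) ^+ m.
  have hm := bern m.
  have e1 : 1 <= (1 + h) ^+ m by rewrite (le_trans _ hm)// lerDl mulr_ge0// ltW.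
  have hm' : m%:R * h <= (1 + h) ^+ m by rewrite (le_trans _ hm)// lerDr ler01.
  rewrite mulrDl; apply: lerD; first by rewrite -[leLHS]mulr1 ler_pM2l.
  rewrite -[leLHS](mulfK (lt0r_neq0 h0)) [leRHS]mulrAC ler_pM2r ?invr_gt0//.
  by rewrite mulrAC [leLHS]mulrC ler_wpM2l.
rewrite (@le_lt_trans _ _ (a ^+ m * ((c + K / h) * (1 + h) ^+ m)))//.
  by rewrite ler_wpM2l// exprn_ge0// ltW.
have -> : a ^+ m * ((c + K / h) * (1 + h) ^+ m) = (c + K / h) * v ^+ m * s ^+ m.
  rewrite mulrCA -!mulrA -!exprMn; congr (_ * _ ^+ _).
  by rewrite /h /v; field; rewrite !gt_eqF.
by rewrite -[ltRHS]mul1r ltr_pM2r// exprn_gt0.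
Qed.

Section small_perturbation.
Context d (T : measurableType d) (R : realType).
Variables (Q : R.-fker T ~> T) (nu : probability T R)
  (chi : bmfun (T * T)%type R) (l : nat) (a : R).
Hypothesis a_gt : supnorm chi ^+ l * Delta nu (kernel_pow Q l) < a.
Implicit Types f : bmfun T R.
Local Notation L := (kernel_mul_op Q chi).
Local Notation b := (supnorm chi).

Let b0 : 0 <= b. Proof. exact: supnorm_ge0. Qed.
Let a0 : 0 < a.
Proof.
rewrite (le_lt_trans _ a_gt)// mulr_ge0 ?exprn_ge0//.
exact: (DeltaP nu (kernel_pow Q l)).1.
Qed.

(** [K] must not depend on [m]. It comes from [cW], a sup-norm bound for [W] and its approximant
    that involves only [chi] and [Q^l]. The measure, the density bound and the Lasota-Yorke
    constants do vary with [m], but they enter only through the weak error. *)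
Lemma iter_small_finite_rank (x0 : T) : exists2 K : R, 0 <= K & forall m,
  exists P F : bmfun T R -> bmfun T R, [/\ linear P, finite_rank F,
    forall f, iter (m * l) L f = P f + F f &
    forall f, supnorm (P f) <= a ^+ m * (2 + m%:R * K) * supnorm f].
Proof.
have [c c0 qc] := fker_bound (kernel_pow Q l).
pose cW := b ^+ l * c.
have cW0 : 0 <= cW by rewrite mulr_ge0 ?exprn_ge0.
exists (2 * cW / a); first exact: divr_ge0 (mulr_ge0 (ler0n _ 2) cW0) (ltW a0).
move=> m; pose k := orbit_sum Q nu (m * l).
have [eta eta0 etaP] := uniform_small a_gt.
have [G [mG Geta [C C0 GC]]] := density_splitting k x0 (kernel_pow Q l) eta0.
pose S := cut_op Q chi l mG; pose W := cut_op Q chi l (measurableC mG).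
have S_lin : linear S by exact: cut_op_linear.
have W_lin : linear W by exact: cut_op_linear.
have int_cut (A : set T) f x : measurable A ->
    (\int[kernel_pow Q l x]_(y in A) (normc (f y))%:E <=
     (supnorm f)%:E * kernel_pow Q l x A)%E.
  move=> mA; rewrite -integral_cst//; apply: ge0_le_integral => //.
  - by move=> y _; rewrite lee_fin normc_ge0.
  - by apply: measurable_funTS; exact: normc_measurable.
  - by move=> y _; rewrite lee_fin supnorm_ub.
have S_le f : supnorm (S f) <= a * supnorm f.
  apply: supnorm_le; first by rewrite mulr_ge0 ?supnorm_ge0 ?(ltW a0).
  move=> x; rewrite -lee_fin (le_trans (cut_op_le _ _ _ _ _ _))//.
  have mGx : measurable (xsection G x) by exact: measurable_xsection.
  apply: (@le_trans _ _ ((b ^+ l)%:E *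
      ((supnorm f)%:E * kernel_pow Q l x (xsection G x)))%E).
    by rewrite lee_wpmul2l ?lee_fin ?exprn_ge0// int_cut.
  rewrite muleCA muleC EFinM lee_wpmul2r ?lee_fin ?supnorm_ge0// etaP//.
  by rewrite (le_trans _ (Geta x))// le_nu_orbit_sum.
have W_le f : supnorm (W f) <= cW * supnorm f.
  apply: supnorm_le; first by rewrite mulr_ge0 ?supnorm_ge0.
  move=> x; rewrite -lee_fin (le_trans (cut_op_le _ _ _ _ _ _))//.
  have mGx : measurable (xsection (~` G) x).
    by apply: measurable_xsection; exact: measurableC.
  rewrite /cW -mulrA EFinM lee_wpmul2l ?lee_fin ?exprn_ge0//.
  rewrite (le_trans (int_cut _ _ _ mGx))// muleC EFinM lee_wpmul2r ?lee_fin ?supnorm_ge0//.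
  by rewrite (le_trans _ (qc x))// le_measure ?inE.
have W_density A : measurable A -> forall f, (forall x, f x = (\1_A x)%:C%C) ->
    {ae k x0, forall x, normc (W f x) <= b ^+ l * C * fine (k x0 A)}.
  move=> mA f fE; apply: filterS (GC A mA) => x GCx.
  rewrite -lee_fin (le_trans (cut_op_le _ _ _ _ _ _))//.
  rewrite -mulrA EFinM lee_wpmul2l ?lee_fin ?exprn_ge0//.
  rewrite EFinM fineK ?mu_fin_num//; apply: le_trans GCx.
  have mGx : measurable (xsection (~` G) x).
    by apply: measurable_xsection; exact: measurableC.
  rewrite -integral_indic// le_eqVlt; apply/orP; left; apply/eqP.
  apply: eq_integral => y _; rewrite fE /= expr0n addr0 sqrtr_sqr ger0_norm//.
have UE f : iter l L f = S f + W f by exact: cut_op_setC.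
have bC0 : 0 <= b ^+ l * C by rewrite mulr_ge0 ?exprn_ge0.
have /choice[Cs CsP] : forall i : 'I_m, exists C : R, 0 <= C /\
    forall f delta, 0 <= delta ->
    (l1norm (orbit_sum Q nu (m * l) x0) f <= delta%:E)%E ->
    supnorm (iter ((m - i.+1) * l) L f) <= a ^+ (m - i.+1) * supnorm f + C * delta.
  move=> i; have [C' C'0 H] := lasota_yorke_iter a_gt x0 (leq_subr i.+1 m).
  by exists C'.
pose Ct := \sum_(i < m) Cs i * a ^+ i.
have Ct0 : 0 <= Ct.
  by apply: sumr_ge0 => i _; rewrite mulr_ge0 ?(CsP i).1// exprn_ge0// ltW.
have Ct1 : 0 < Ct + 1 by rewrite ltr_wpDl.
(* The weak errors contribute [e Ct |f|], which this choice keeps below [a^m |f|]; with the term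
   [S^m] this accounts for the [2] in the bound. *)
pose e := a ^+ m / (Ct + 1).
have e0 : 0 < e by rewrite divr_gt0// exprn_gt0.
have eCt : e * Ct <= a ^+ m.
  by rewrite /e mulrAC ler_pdivrMr// ler_pM2l ?exprn_gt0// lerDl.
have [F0 [frF0 F0_le F0e]] := finite_rank_approximation W_lin cW0 W_le bC0 W_density e0.
have Si_le i f : supnorm (iter i S f) <= a ^+ i * supnorm f.
  elim: i => [|i ih]; first by rewrite expr0 mul1r.
  rewrite iterS (le_trans (S_le _))// exprS -mulrA ler_wpM2l// ltW//.
have Si_bounded i : bounded_op (iter i S).
  split; first by elim: i => [|i ih] u f g //=; rewrite ih S_lin.
  by exists (a ^+ i); [rewrite exprn_ge0// ltW|exact: Si_le].
have U_lin : linear (iter l L) by exact: iter_kernel_linear.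
have iterU j f : iter j (iter l L) f = iter (j * l) L f.
  by elim: j => // j ih; rewrite iterS ih mulSn iterD.
have Uj_lin j : linear (iter (j * l) L) by exact: iter_kernel_linear.
pose P f := iter m S f +
  \sum_(i < m) iter ((m - i.+1) * l) L (W (iter i S f) - F0 (iter i S f)).
pose F f := \sum_(i < m) iter ((m - i.+1) * l) L (F0 (iter i S f)).
exists P, F; split.
- move=> u f g; rewrite /P (Si_bounded m).1 scalerDr scaler_sumr addrACA -big_split/=.
  congr (_ + _); apply: eq_bigr => i _; rewrite -(Uj_lin (m - i.+1)%N).
  congr (iter _ L _); rewrite (Si_bounded i).1 W_lin (finite_rank_linear frF0).
  by rewrite scalerBr opprD addrACA.
- apply: finite_rank_sum => i; apply: (@finite_rank_compl _ _ (F0 \o iter i S)).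
    exact: Uj_lin.
  exact: finite_rank_compr.
- move=> f; rewrite -iterU (iterD_telescope U_lin UE) /P /F -addrA; congr (_ + _).
  rewrite -big_split/=; apply: eq_bigr => i _.
  by rewrite iterU -(linD (Uj_lin _)) subrK.
- move=> f; set N := supnorm f; rewrite -rnorm_supnorm (le_trans (rnormD _ _))//.
  have aE (i : 'I_m) : a ^+ (m - i.+1) * a ^+ i = a ^+ m / a.
    apply: (mulIf (lt0r_neq0 a0)); rewrite divfK ?gt_eqF// -mulrA -exprSr -exprD subnK//.
  have term (i : 'I_m) : rnorm (iter ((m - i.+1) * l) L
      (W (iter i S f) - F0 (iter i S f))) <=
      a ^+ m * (2 * cW / a) * N + e * (Cs i * a ^+ i) * N.
    have aiN : 0 <= a ^+ i * N by rewrite mulr_ge0 ?supnorm_ge0// exprn_ge0// ltW.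
    have l1 : (l1norm (orbit_sum Q nu (m * l) x0)
        (W (iter i S f) - F0 (iter i S f))%R <= (e * (a ^+ i * N))%:E)%E.
      by rewrite (le_trans (F0e _))// lee_fin ler_pM2l.
    rewrite (le_trans ((CsP i).2 _ _ (mulr_ge0 (ltW e0) aiN) l1))//.
    apply: lerD; last by rewrite le_eqVlt; apply/orP; left; apply/eqP; ring.
    rewrite (_ : a ^+ m * (2 * cW / a) * N =
        a ^+ (m - i.+1) * (2 * cW * (a ^+ i * N))); last first.
      by rewrite [RHS]mulrCA [in RHS](mulrA (a ^+ (m - i.+1))) aE; ring.
    rewrite ler_wpM2l ?exprn_ge0 ?(ltW a0)// -rnorm_supnorm (le_trans (rnormB _ _))//.
    rewrite -mulrA mulr_natl mulr2n; apply: lerD.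
      by rewrite (le_trans (W_le _))// ler_wpM2l.
    by rewrite (le_trans (F0_le _))// ler_wpM2l.
  apply: (@le_trans _ _ (a ^+ m * N + \sum_(i < m)
      (a ^+ m * (2 * cW / a) * N + e * (Cs i * a ^+ i) * N))).
    apply: lerD; first exact: Si_le.
    by rewrite (le_trans (rnorm_sum _ _ _))// ler_sum.
  rewrite big_split/= sumr_const card_ord -mulr_suml -mulr_sumr -/Ct -[_ *+ m]mulr_natl.
  have : e * Ct * N <= a ^+ m * N by rewrite ler_wpM2r ?supnorm_ge0.
  set X := e * Ct * N => XN.
  rewrite (_ : a ^+ m * (2 + _) * N = a ^+ m * N +
    (m%:R * (a ^+ m * (2 * cW / a) * N) + a ^+ m * N)); last by ring.
  by rewrite !lerD2l.
Qed.

End small_perturbation.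

Section main.
Context d (T : measurableType d) (R : realType).
Variables (Q : R.-fker T ~> T) (nu : probability T R) (l : nat)
  (chi : bmfun (T * T)%type R) (L : {linear bmfun T R -> bmfun T R}) (delta : R).
Hypotheses (l_gt0 : (0 < l)%N) (LE : L =1 kernel_mul_op Q chi)
  (chi_delta : supnorm chi * Delta nu (kernel_pow Q l) `^ (l%:R^-1) <= delta).

(** [L] is any linear map agreeing pointwise with some [kernel_mul_op], which covers [Q] itself
    through [chi = 1]. The numbers [r] and [a] are interpolated so that [|chi|^l Delta < a < r^l]
    and [delta < r < rho]. *)
Lemma kernel_ess_decomposition (rho : R) : delta < rho -> ess_decomposition L rho.
Proof.
move=> drho.
have D0 := (DeltaP nu (kernel_pow Q l)).1.
have := chi_delta; set D := Delta nu _ in D0 *; set p := D `^ _ => bp.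
have p0 : 0 <= p by exact: powR_ge0.
have b0 := supnorm_ge0 chi.
have d0 : 0 <= delta by rewrite (le_trans _ bp)// mulr_ge0.
have pl : p ^+ l = D.
  rewrite -powR_mulrn ?powR_ge0// -powRrM mulVf ?powRr1//.
  by rewrite pnatr_eq0 -lt0n.
have mid (x y : R) : x < y -> exists2 z, x < z & z < y.
  by move=> xy; exists ((x + y) / 2); lra.
have [r dr rrho] := mid _ _ drho.
have r0 : 0 < r := le_lt_trans d0 dr.
have bD : supnorm chi ^+ l * D < r ^+ l.
  rewrite -pl -exprMn ltr_pXn2r ?nnegrE ?mulr_ge0 ?(ltW r0)//.
  exact: le_lt_trans dr.
have [a a_gt ar] := mid _ _ bD.
have a0 : 0 < a by rewrite (le_lt_trans _ a_gt)// mulr_ge0 ?exprn_ge0.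
have [x0 _] : [set: T] !=set0.
  apply/set0P/eqP => T0; have := @probability_setT _ _ _ nu.
  by rewrite T0 measure0 => /esym/eqP; rewrite onee_eq0.
have [K K0 KP] := iter_small_finite_rank a_gt x0.
(* The constants [8] and [4 K] come from the requirement [4 q < r^(m l)] with
   [q = a^m (2 + m K)]. *)
have [m m0 small] := poly_geometric_small a0 ar (ltr0n R 8) (mulr_ge0 (ler0n R 4) K0).
have [P [F [P_lin frF PFE P_le]]] := KP m.
have q0 : 0 <= a ^+ m * (2 + m%:R * K).
  by rewrite mulr_ge0 ?exprn_ge0 ?(ltW a0)// addr_ge0// mulr_ge0.
have iterL j f : iter j L f = iter j (kernel_mul_op Q chi) f.
  by elim: j => // j ih; rewrite !iterS ih LE.
apply: (@ess_decomposition_power _ _ L _ P F (a ^+ m * (2 + m%:R * K)) (m * l)%N r) => //.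
- have [lin [c c0 cL]] := kernel_mul_op_bounded Q chi.
  by split; [exact: linearP|exists c => // f; rewrite LE].
- by move=> f; rewrite iterL PFE.
- by move=> z qz; exact: (bmfun_shift_surj P_lin q0 P_le qz).
- by rewrite muln_gt0 m0.
- rewrite mulnC exprM (le_lt_trans _ small)// le_eqVlt; apply/orP; left; apply/eqP.
  by ring.
Qed.

Lemma kernel_ess_spectral_radius_le : delta < spectral_radius L ->
  ess_spectral_radius L <= delta.
Proof.
move=> dL; apply/ler_addgt0Pr => e e0.
have d0 : 0 <= delta.
  rewrite (le_trans _ chi_delta)// mulr_ge0 ?supnorm_ge0//; exact: powR_ge0.
apply: ge_inf; last first.
  right; split; first by rewrite addr_ge0// ltW.
  by apply: kernel_ess_decomposition; rewrite ltrDl.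
by exists 0 => _ [->|[]//]; rewrite (le_trans d0)// ltW.
Qed.

End main.

Theorem mainTheorem2 (d : measure_display) (E : measurableType d)
    (R : realType) (Q : R.-fker E ~> E) (l : nat) (nu : probability E R) :
  countably_generated E ->
  (1 <= l)%N ->
  Delta nu (kernel_pow Q l) `^ (l%:R^-1) < spectral_radius (kernel_op Q) ->
  (quasi_compact (kernel_op Q) /\
   ess_spectral_radius (kernel_op Q) <= Delta nu (kernel_pow Q l) `^ (l%:R^-1))
  /\
  (forall chi : bmfun (E * E)%type R,
     supnorm chi * Delta nu (kernel_pow Q l) `^ (l%:R^-1)
       < spectral_radius (kernel_mul_op Q chi) ->
     quasi_compact (kernel_mul_op Q chi) /\
     ess_spectral_radius (kernel_mul_op Q chi)
       <= supnorm chi * Delta nu (kernel_pow Q l) `^ (l%:R^-1)).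
Proof.
move=> _ l0 hQ; split.
  pose chi1 : bmfun (E * E)%type R :=
    mk_bmfun (bounded_measurable_cst (E * E)%type (1 : R[i])).
  have chi1_le : supnorm chi1 * Delta nu (kernel_pow Q l) `^ (l%:R^-1) <=
      Delta nu (kernel_pow Q l) `^ (l%:R^-1).
    rewrite ler_piMl ?powR_ge0//; apply: supnorm_le => // z.
    by rewrite [leLHS]Normc.normc1.
  have QE : kernel_op Q =1 kernel_mul_op Q chi1.
    move=> f; apply: bmfun_ext => x; congr cintegral; apply/funext => y.
    by rewrite /= mulr1.
  have le_ess := kernel_ess_spectral_radius_le l0 QE chi1_le hQ.
  by split; [exact: le_lt_trans le_ess hQ|exact: le_ess].
move=> chi hchi.
have le_ess := kernel_ess_spectral_radius_le l0 (fun=> erefl) (lexx _) hchi.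
by split; [exact: le_lt_trans le_ess hchi|exact: le_ess].
Qed.
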